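(* Let $L=E(5,10)$. The following two compositions are (nonzero) morphisms of degree $5$ between Verma modules over $L$: $$t'=\nabla_C\circ t_{AB}: M(3,0,0,0)\to M(0,0,1,0),\qquad t''=t_{BC}\circ\nabla_A: M(0,1,0,0)\to M(0,0,0,3).$$
   Context: All over $\mathbb{C}$. The Lie superalgebra $L=E(5,10)$: the even part is $S_5$, the Lie algebra of divergence-free formal vector fields $\sum_i P_i\partial_i$, $P_i\in\mathbb{C}[[x_1,\dots,x_5]]$, $\partial_i=\partial/\partial x_i$; the odd part is the space of closed formal differential $2$-forms in $x_1,\dots,x_5$. Even elements act on odd ones by Lie derivative; writing $d_{ij}=dx_i\wedge dx_j$, the bracket of odd elements is given bilinearly by $[f d_{jk},g d_{\ell m}]=\epsilon_{ijk\ell m}\,fg\,\partial_i$ where $i$ is the remaining index and $\epsilon_{ijk\ell m}$ is the sign of the permutation $(i,j,k,\ell,m)$ of $(1,\dots,5)$ if all indices are distinct; the bracket is $0$ if $j,k,\ell,m$ are not distinct. Grading: $\deg x_i=2=-\deg\partial_i$, $\deg d_{ij}=-1$; $\mathfrak g_j$ is the degree $j$ part. $\mathfrak g_0\cong \mathfrak{sl}_5$ is spanned by the traceless combinations of $x_i\partial_j$, $\mathfrak g_{-1}=\langle d_{ij}\rangle$, $\mathfrak g_{-2}=\langle\partial_i\rangle$. $L_-=\mathfrak g_{-2}\oplus\mathfrak g_{-1}$; $L_+$ is the subalgebra of elements all of whose homogeneous components have positive degree; $L_0=\mathfrak g_0+L_+$. $U=U(L)$, $U_0=U(L_0)$, $U_-=U(L_-)$.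 The natural grading of $U_-$ has $\deg d_{ij}=1$, $\deg\partial_i=2$. Verma modules: a $\mathfrak g_0$-module $V$ is made an $L_0$-module with $L_+$ acting by zero, and $M(V)=U\otimes_{U_0}V\cong U_-\otimes V$. The Borel subalgebra of $\mathfrak g_0$ is spanned by $x_i\partial_j$ ($i<j$) and $h_i=x_i\partial_i-x_{i+1}\partial_{i+1}$; $F(n_1,n_2,n_3,n_4)$ is the finite-dimensional irreducible module whose highest weight vector has $h_i$-eigenvalue $n_i$; $M(n_1,n_2,n_3,n_4)=M(F(n_1,n_2,n_3,n_4))$. A morphism $\varphi:M(A)\to M(B)$ of $L$-modules has degree $k$ if there is $\Phi=\sum_i u_i\otimes\ell_i\in U_-\otimes \mathrm{Hom}(A,B)$ with $\varphi(1\otimes a)=\Phi(a)$ for all $a\in A$ and $u_i\in U_-$ all homogeneous of degree $k$. Let $z_i$, $x_{ij}=-x_{ji}$ be the standard bases of $\mathbb{C}^5=F(1,0,0,0)$ and $\Lambda^2\mathbb{C}^5=F(0,1,0,0)$, where $(x_a\partial_b)z_c=\delta_{bc}z_a$ and $x_{ij}$ transforms as $z_i\wedge z_j$, and $z_i^*$, $x_{ij}^*=-x_{ji}^*$ the dual bases of $\mathbb{C}^{5*}=F(0,0,0,1)$ and $\Lambda^2\mathbb{C}^{5*}=F(0,0,1,0)$. The instances of the degree $1$ morphisms needed are $\nabla_A:M(0,1,0,0)\to M(0,0,0,0)$, $u\otimes s\mapsto\sum_{i,j=1}^5u\,d_{ij}\otimes\frac{d}{dx_{ij}}s$ (where $\frac{d}{dx_{ji}}=-\frac{d}{dx_{ij}}$,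 $\frac{d}{dx_{ii}}=0$), and $\nabla_C:M(0,0,0,0)\to M(0,0,1,0)$, $u\otimes 1\mapsto\sum_{i,j=1}^5u\,d_{ij}\otimes x^*_{ij}$. The maps $t_{AB},t_{BC}$: the $\mathfrak{sl}_5$-submodule $N$ of $U_-$ generated by $d_{12}d_{13}d_{14}d_{15}$ is irreducible with this vector as highest weight vector; let $\iota:S^3(\mathbb{C}^5)\to N$ be the $\mathfrak{sl}_5$-isomorphism with $\iota(z_1^3)=d_{12}d_{13}d_{14}d_{15}$. For $\bar a=(a_1,\dots,a_5)\in\mathbb{Z}_{\ge0}^5$ with $\sum a_i=3$ let $u_{\bar a}=\frac{3!}{a_1!\cdots a_5!}\,\iota(z_1^{a_1}\cdots z_5^{a_5})$ (so $\{u_{\bar a}\}$ is the basis of $N$ dual to the monomial basis of $S^3(\mathbb{C}^{5*})$). Realize $F(n,0,0,0)$ as the degree $n$ part of $\mathbb{C}[z_1,\dots,z_5]$ and $F(0,0,0,n)$ as the degree $n$ part of $\mathbb{C}[z_1^*,\dots,z_5^*]$. Then $t_{AB}:M(n,0,0,0)\to M(n-3,0,0,0)$ ($n\ge3$) is $u\otimes s\mapsto\sum_{\bar a}u\,u_{\bar a}\otimes\prod_i(\partial/\partial z_i)^{a_i}s$, and $t_{BC}:M(0,0,0,n)\to M(0,0,0,n+3)$ ($n\ge0$) is $u\otimes s\mapsto\sum_{\bar a}u\,u_{\bar a}\otimes\prod_i(z_i^* )^{a_i}s$. *)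

(* Defs.v *)
From HB Require Import structures.
From mathcomp Require Import all_boot all_order all_fingroup all_algebra.
From mathcomp Require Import boolp mpoly ring.

Set Implicit Arguments.
Unset Strict Implicit.
Unset Printing Implicit Defensive.

Import GRing.Theory Num.Theory.
Local Open Scope ring_scope.
Local Open Scope quotient_scope.

(* all_fingroup also exports a repr. *)
Local Notation repr := generic_quotient.repr.

(* Formal power series K[[x_1, ..., x_n]]: a series is its family of          *)
(* coefficients, indexed by the exponents of the monomials.                   *)
Record fps (n : nat) (K : Type) := FPS { fps_coef :> 'X_{1..n} -> K }.

Section PowerSeries.
Variables (n : nat) (K : comNzRingType).
Implicit Types (f g h : fps n K) (m : 'X_{1..n}).

HB.instance Definition _ := gen_eqMixin (fps n K).
HB.instance Definition _ := gen_choiceMixin (fps n K).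

Lemma fpsP f g : (forall m, f m = g m) -> f = g.
Proof. by case: f g => [f] [g] /= /funext ->. Qed.

Definition fps0 : fps n K := FPS (fun=> 0).
Definition fps_opp f : fps n K := FPS (fun m => - f m).
Definition fps_add f g : fps n K := FPS (fun m => f m + g m).

Fact fps_addA : associative fps_add.
Proof. by move=> f g h; apply: fpsP => m /=; rewrite addrA. Qed.
Fact fps_addC : commutative fps_add.
Proof. by move=> f g; apply: fpsP => m /=; rewrite addrC. Qed.
Fact fps_add0 : left_id fps0 fps_add.
Proof. by move=> f; apply: fpsP => m /=; rewrite add0r. Qed.
Fact fps_addN : left_inverse fps0 fps_opp fps_add.
Proof. by move=> f; apply: fpsP => m /=; rewrite addNr. Qed.

HB.instance Definition _ := GRing.isZmodule.Build (fps n K)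
  fps_addA fps_addC fps_add0 fps_addN.

Definition fps_scale (c : K) f : fps n K := FPS (fun m => c * f m).

Fact fps_scaleA c d f : fps_scale c (fps_scale d f) = fps_scale (c * d) f.
Proof. by apply: fpsP => m /=; rewrite mulrA. Qed.
Fact fps_scale1 : left_id 1 fps_scale.
Proof. by move=> f; apply: fpsP => m /=; rewrite mul1r. Qed.
Fact fps_scaleDr : right_distributive fps_scale +%R.
Proof. by move=> c f g; apply: fpsP => m /=; rewrite mulrDr. Qed.
Fact fps_scaleDl f : {morph fps_scale^~ f : c d / c + d}.
Proof. by move=> c d; apply: fpsP => m /=; rewrite mulrDl. Qed.

HB.instance Definition _ := GRing.Zmodule_isLmodule.Build K (fps n K)
  fps_scaleA fps_scale1 fps_scaleDr fps_scaleDl.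

Lemma fps_coef0 m : (0 : fps n K) m = 0. Proof. by []. Qed.
Lemma fps_coefD f g m : (f + g) m = f m + g m. Proof. by []. Qed.
Lemma fps_coefN f m : (- f) m = - f m. Proof. by []. Qed.
Lemma fps_coefZ c f m : (c *: f) m = c * f m. Proof. by []. Qed.
Lemma fps_coefMn f k m : (f *+ k) m = f m *+ k.
Proof. by elim: k => // k IH; rewrite !mulrS fps_coefD IH. Qed.
Lemma fps_coef_sum (I : Type) (r : seq I) (P : pred I) (F : I -> fps n K) m :
  (\sum_(i <- r | P i) F i) m = \sum_(i <- r | P i) F i m.
Proof.
by elim/big_rec2: _ => [|i x y _ <-]; rewrite ?fps_coef0 ?fps_coefD.
Qed.

Definition fps_const (c : K) : fps n K := FPS (fun m => c *+ (m == 0%MM)).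

Definition fps_mul f g : fps n K := FPS (fun m =>
  \sum_(k : 'X_{1..n < (mdeg m).+1, (mdeg m).+1} | m == (k.1 + k.2)%MM)
     f k.1 * g k.2).

Definition fps_trunc (d : nat) f : {mpoly K[n]} :=
  \sum_(m : 'X_{1..n < d}) f m *: 'X_[m].

Lemma mcoeff_trunc d f m : (mdeg m < d)%N -> (fps_trunc d f)@_m = f m.
Proof.
move=> lt_md; rewrite /fps_trunc raddf_sum /= (bigD1 (BMultinom lt_md)) //=.
rewrite mcoeffZ mcoeffX eqxx mulr1 big1 ?addr0 // => k ne_k.
rewrite mcoeffZ mcoeffX; case: eqP => [eq_km|_]; last by rewrite mulr0.
by case/eqP: ne_k; apply: val_inj.
Qed.

Lemma fps_mulE d f g m : (mdeg m < d)%N ->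
  fps_mul f g m = (fps_trunc d f * fps_trunc d g)@_m.
Proof.
move=> lt_md; rewrite mcoeffM /=; apply: eq_bigr => k _.
by rewrite !mcoeff_trunc //; apply: leq_trans lt_md; case: k => -[? ?] [? ?].
Qed.

Lemma fps_mulE2 (p q : {mpoly K[n]}) f g m :
    (forall k, (mdeg k <= mdeg m)%N -> p@_k = f k) ->
    (forall k, (mdeg k <= mdeg m)%N -> q@_k = g k) ->
  fps_mul f g m = (p * q)@_m.
Proof.
move=> pf qg; rewrite mcoeffM /=; apply: eq_bigr => -[[/= a la] [/= b lb]] _.
by rewrite pf // qg.
Qed.

Fact fps_mulA : associative fps_mul.
Proof.
move=> f g h; apply: fpsP => m; have lem := ltnSn (mdeg m).
have le_trunc F k : (mdeg k <= mdeg m)%N ->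
  (fps_trunc (mdeg m).+1 F)@_k = F k by move=> ?; apply: mcoeff_trunc.
rewrite (fps_mulE2 (p := fps_trunc (mdeg m).+1 f)
  (q := fps_trunc (mdeg m).+1 g * fps_trunc (mdeg m).+1 h)); first last.
- by move=> k le_km; rewrite -fps_mulE.
- exact: le_trunc.
rewrite (fps_mulE2 (q := fps_trunc (mdeg m).+1 h)
  (p := fps_trunc (mdeg m).+1 f * fps_trunc (mdeg m).+1 g)).
- by rewrite mulrA.
- by move=> k le_km; rewrite -fps_mulE.
- exact: le_trunc.
Qed.

Fact fps_mulC : commutative fps_mul.
Proof. by move=> f g; apply: fpsP => m; rewrite !(fps_mulE _ _ (ltnSn _)) mulrC. Qed.

Fact fps_mul1 : left_id (fps_const 1) fps_mul.
Proof.
move=> f; apply: fpsP => m.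
rewrite (fps_mulE2 (p := 1) (q := fps_trunc (mdeg m).+1 f)) ?mul1r.
- exact: mcoeff_trunc.
- by move=> k _; rewrite mcoeff1.
- by move=> k le_km; apply: mcoeff_trunc.
Qed.

Fact fps_mulDl : left_distributive fps_mul fps_add.
Proof.
move=> f g h; apply: fpsP => m /=; rewrite -big_split /=.
by apply: eq_bigr => k _; rewrite mulrDl.
Qed.

Fact fps_oner_neq0 : fps_const 1 != 0.
Proof.
apply/eqP => /(congr1 (fun f : fps n K => f 0%MM)) /=.
by rewrite eqxx; apply/eqP/oner_neq0.
Qed.

HB.instance Definition _ := GRing.Zmodule_isComNzRing.Build (fps n K)
  fps_mulA fps_mulC fps_mul1 fps_mulDl fps_oner_neq0.

Lemma fps_coefM (p q : {mpoly K[n]}) f g m :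
    (forall k, (mdeg k <= mdeg m)%N -> p@_k = f k) ->
    (forall k, (mdeg k <= mdeg m)%N -> q@_k = g k) ->
  (f * g) m = (p * q)@_m.
Proof. exact: fps_mulE2. Qed.

Definition fps_deriv (i : 'I_n) f : fps n K :=
  FPS (fun m => f (m + U_(i))%MM *+ (m i).+1).

Fact fps_deriv_linear i : linear (fps_deriv i).
Proof.
by move=> c f g; apply: fpsP => m /=; rewrite mulrnDl mulrnAr.
Qed.

HB.instance Definition _ i := GRing.isLinear.Build K (fps n K) (fps n K) _
  (fps_deriv i) (fps_deriv_linear i).

Lemma fps_derivM i f g :
  fps_deriv i (f * g) = fps_deriv i f * g + f * fps_deriv i g.
Proof.
apply: fpsP => m; rewrite fps_coefD.
have -> : fps_deriv i (f * g) m = (f * g) (m + U_(i))%MM *+ (m i).+1 by [].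
have dU : mdeg (m + U_(i)) = (mdeg m).+1 by rewrite mdegD mdeg1 addn1.
pose T := fps_trunc (mdeg m).+2.
have TE F k : (mdeg k <= (mdeg m).+1)%N -> (T F)@_k = F k.
  by move=> ?; apply: mcoeff_trunc.
have TD F k : (mdeg k <= mdeg m)%N -> (T F)^`M(i)@_k = fps_deriv i F k.
  by move=> le_km; rewrite mcoeff_deriv TE // mdegD mdeg1 addn1.
rewrite (fps_coefM (p := T f) (q := T g) (m := (m + U_(i))%MM)); first last.
- by move=> k; rewrite dU; apply: TE.
- by move=> k; rewrite dU; apply: TE.
rewrite (fps_coefM (p := (T f)^`M(i)) (q := T g)); first last.
- by move=> k le_km; apply/TE/leqW.
- by move=> k; apply: TD.
rewrite (fps_coefM (p := T f) (q := (T g)^`M(i))); first last.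
- by move=> k; apply: TD.
- by move=> k le_km; apply/TE/leqW.
by rewrite -mcoeff_deriv mderivM mcoeffD.
Qed.

Lemma fps_derivC i j f :
  fps_deriv i (fps_deriv j f) = fps_deriv j (fps_deriv i f).
Proof.
apply: fpsP => m /=; rewrite -!mulrnA -!addmA [(U_(j) + U_(i))%MM]addmC.
congr (_ *+ _); rewrite !mnmDE !mnm1E [j == i]eq_sym.
by case: eqP => [->//|_]; rewrite !addn0 mulnC.
Qed.

Lemma fps_deriv_const i c : fps_deriv i (fps_const c) = 0.
Proof.
apply: fpsP => m /=; rewrite mnmD_eq0 mnm1_eq0 andbF mulr0n.
exact: mul0rn.
Qed.

End PowerSeries.

(* The five indices; i1, ..., i5 stand for 1, ..., 5.                         *)
Definition i1 : 'I_5 := @Ordinal 5 0 isT.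
Definition i2 : 'I_5 := @Ordinal 5 1 isT.
Definition i3 : 'I_5 := @Ordinal 5 2 isT.
Definition i4 : 'I_5 := @Ordinal 5 3 isT.
Definition i5 : 'I_5 := @Ordinal 5 4 isT.

Fact lie_deriv_closed_aux (R : comNzRingType)
  (Di Dj Dk x ak ai aj ij ik jk iak iaj jai jak kaj kai ajk aki aij wi wj wk : R) :
  Di * ajk + x * wi + (ij * ak + Dj * iak) + (ik * - aj + Dk * - iaj)
  + (Dj * aki + x * wj + (jk * ai + Dk * jai) + (ij * - ak + Di * - jak))
  + (Dk * aij + x * wk + (ik * aj + Di * kaj) + (jk * - ai + Dj * - kai))
  = Di * (ajk - jak + kaj) + Dj * (aki - kai + iak) + Dk * (aij - iaj + jai)
    + x * (wi + wj + wk).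
Proof. by ring. Qed.

Section VectorFieldsAndForms.
Variable K : numFieldType.

Local Notation D := (@fps_deriv 5 K).

(* \sum_i X i \partial_i *)
Definition vfield := {ffun 'I_5 -> fps 5 K}.

(* The 2-form \sum_(j < k) w (j, k) dx_j /\ dx_k, for w antisymmetric.        *)
Definition form2 := {ffun 'I_5 * 'I_5 -> fps 5 K}.

Implicit Types (X Y : vfield) (v w : form2).

Definition divergence X : fps 5 K := \sum_i D i (X i).

Definition divfree : {pred vfield} := fun X => divergence X == 0.

Definition closed_form : {pred form2} := fun w =>
  [forall j, forall k, w (k, j) == - w (j, k)] &&
  [forall i, forall j, forall k,
     D i (w (j, k)) + D j (w (k, i)) + D k (w (i, j)) == 0].

Lemma closed_formP w :
  reflect ((forall j k, w (k, j) = - w (j, k)) /\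
           (forall i j k, D i (w (j, k)) + D j (w (k, i)) + D k (w (i, j)) = 0))
          (w \in closed_form).
Proof.
apply: (iffP andP) => -[Aw Cw]; split.
- by move=> j k; move/forallP/(_ j)/forallP/(_ k)/eqP: Aw.
- by move=> i j k; move/forallP/(_ i)/forallP/(_ j)/forallP/(_ k)/eqP: Cw.
- by apply/forallP=> j; apply/forallP=> k; apply/eqP.
- by do 3!apply/forallP=> ?; apply/eqP.
Qed.

Fact divfree_submod : submod_closed divfree.
Proof.
split=> [|c X Y /eqP X0 /eqP Y0]; apply/eqP.
  by rewrite /divergence big1 // => i _; rewrite ffunE linear0.
rewrite -[RHS](scaler0 _ c) -[RHS]addr0 -{1}X0 -Y0 scaler_sumr -big_split /=.
by apply: eq_bigr => i _; rewrite !ffunE linearP.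
Qed.

Fact closed_form_submod : submod_closed closed_form.
Proof.
split=> [|c v w /closed_formP[Av Cv] /closed_formP[Aw Cw]]; apply/closed_formP.
  by split=> [j k|i j k]; rewrite !ffunE ?oppr0 // !linear0 !addr0.
split=> [j k|i j k]; rewrite !ffunE.
  by rewrite Av Aw scalerN opprD.
rewrite !linearP /= -[RHS](scaler0 _ c) -[RHS]addr0 -{1}(Cv i j k) -(Cw i j k).
by rewrite !scalerDr [X in X + _ = _]addrACA [LHS]addrACA.
Qed.

HB.instance Definition _ :=
  GRing.isSubmodClosed.Build K vfield divfree divfree_submod.
HB.instance Definition _ :=
  GRing.isSubmodClosed.Build K form2 closed_form closed_form_submod.

Definition vf_bracket X Y : vfield :=
  [ffun j => \sum_i (X i * D i (Y j) - Y i * D i (X j))].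

(* The Lie derivative of a 2-form, from                                       *)
(*   L_X (f dx_j /\ dx_k) = X(f) dx_j /\ dx_k + f dX_j /\ dx_k + f dx_j /\ dX_k. *)
Definition lie_deriv X w : form2 :=
  [ffun jk => \sum_i (X i * D i (w jk) + D jk.1 (X i) * w (i, jk.2)
                                       + D jk.2 (X i) * w (jk.1, i))].

(* [f d_jk, g d_lm] = eps_(ijklm) f g \partial_i, extended bilinearly: the    *)
(* permutation s runs over the (i, j, k, l, m) with j < k and l < m.          *)
Definition form_bracket v w : vfield :=
  [ffun i => \sum_(s : 'S_5 | [&& s i1 == i, (s i2 < s i3)%N & (s i4 < s i5)%N])
     (-1) ^+ s * (v (s i2, s i3) * w (s i4, s i5))].

Lemma vf_bracket_divfree X Y :
  X \in divfree -> Y \in divfree -> vf_bracket X Y \in divfree.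
Proof.
move=> /eqP X0 /eqP Y0; apply/eqP.
pose T (X Y : vfield) i j := D j (X i) * D i (Y j) + X i * D i (D j (Y j)).
transitivity (\sum_j \sum_i (T X Y i j - T Y X i j)).
  apply: eq_bigr => j _; rewrite ffunE linear_sum /=; apply: eq_bigr => i _.
  by rewrite linearB /= !fps_derivM /T ![D j (D i _)]fps_derivC.
have TE (Z W : vfield) : divergence W = 0 ->
  \sum_j \sum_i T Z W i j = \sum_j \sum_i D j (Z i) * D i (W j).
  move=> W0; under eq_bigr do rewrite big_split /=.
  rewrite big_split /= [X in _ + X]exchange_big /= [X in _ + X]big1 ?addr0 //.
  move=> i _; rewrite -mulr_sumr -(linear_sum (D i)) /= -/(divergence W).
  by rewrite W0 linear0 mulr0.
under eq_bigr do rewrite sumrB; rewrite sumrB !TE // exchange_big /=.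
by rewrite -sumrB big1 // => i _; rewrite -sumrB big1 // => j _; rewrite mulrC subrr.
Qed.

Lemma lie_deriv_closed X w : w \in closed_form -> lie_deriv X w \in closed_form.
Proof.
case/closed_formP=> Aw Cw; apply/closed_formP; split=> [j k|i j k].
  rewrite !ffunE -sumrN; apply: eq_bigr => i _ /=.
  by rewrite (Aw j k) (Aw i k) (Aw j i) linearN /=; ring.
rewrite !ffunE !linear_sum -!big_split /= big1 // => a _.
transitivity
  (D i (X a) * (D a (w (j, k)) + D j (w (k, a)) + D k (w (a, j))) +
   D j (X a) * (D a (w (k, i)) + D k (w (i, a)) + D i (w (a, k))) +
   D k (X a) * (D a (w (i, j)) + D i (w (j, a)) + D j (w (a, i))) +
   X a * D a (D i (w (j, k)) + D j (w (k, i)) + D k (w (i, j)))); last first.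
  by rewrite !Cw linear0 !mulr0 !addr0.
rewrite !linearD /= !fps_derivM (Aw a i) (Aw a j) (Aw a k) !linearN /=.
rewrite !(fps_derivC i a) !(fps_derivC j a) !(fps_derivC k a).
rewrite (fps_derivC j i (X a)) (fps_derivC k i (X a)) (fps_derivC k j (X a)).
exact: lie_deriv_closed_aux.
Qed.


Fact fps_muln_eq0 (f : fps 5 K) k : f *+ k.+1 = 0 -> f = 0.
Proof.
move=> f0; apply: fpsP => m; apply/eqP.
by have /eqP := congr1 (fun g : fps 5 K => g m) f0; rewrite fps_coefMn mulrn_eq0.
Qed.

Fact sum_perm_halve (V : zmodType) (F : 'S_5 -> V) (P Q : pred 'S_5) a :
    (forall s, F (a * s)%g = F s) -> (forall s, P (a * s)%g = P s) ->
    (forall s, Q (a * s)%g = ~~ Q s) ->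
  \sum_(s | P s) F s = (\sum_(s | P s && Q s) F s) *+ 2.
Proof.
move=> Fa Pa Qa; rewrite (bigID Q) /= mulr2n; congr (_ + _).
rewrite (reindex_inj (mulgI a)) /=.
by apply: eq_big => [s|s _]; rewrite ?Pa ?Qa ?negbK.
Qed.

Fact sum_perm_cycle (F : 'S_5 -> fps 5 K) c :
  (forall s, F s + F (c * s)%g + F (c * (c * s))%g = 0) -> \sum_s F s = 0.
Proof.
move=> F0; apply: (@fps_muln_eq0 _ 2).
transitivity (\sum_s (F s + F (c * s)%g + F (c * (c * s))%g)); last exact: big1.
rewrite !big_split /= !mulrS mulr0n addr0 -addrA; congr (_ + (_ + _)).
  by rewrite (reindex_inj (mulgI c)).
rewrite (reindex_inj (mulgI c)) (reindex_inj (mulgI c)) /=.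
by apply: eq_bigr.
Qed.

Lemma form_bracket_divfree v w :
  v \in closed_form -> w \in closed_form -> form_bracket v w \in divfree.
Proof.
move=> /closed_formP[Av Cv] /closed_formP[Aw Cw]; apply/eqP.
pose P := [pred s : 'S_5 | (s i2 < s i3)%N && (s i4 < s i5)%N].
pose F (s : 'S_5) : fps 5 K :=
  (-1) ^+ s * D (s i1) (v (s i2, s i3) * w (s i4, s i5)).
transitivity (\sum_(s : 'S_5 | P s) F s).
  rewrite (partition_big (fun s : 'S_5 => s i1) predT) //=.
  apply: eq_bigr => i _; rewrite ffunE linear_sum /=.
  apply: eq_big => [s|s /and3P[/eqP<- _ _]]; first by rewrite andbC.
  by rewrite /F; case: (odd_perm s); rewrite ?expr0 ?expr1 ?mul1r // !mulN1r linearN.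
have oddT (a b : 'I_5) (s : 'S_5) : a != b -> odd_perm (tperm a b * s)%g = ~~ odd_perm s.
  by move=> ab; rewrite odd_permM odd_tperm ab addTb.
have signN b : (-1) ^+ (~~ b) = - (-1) ^+ b :> fps 5 K by rewrite signrN.
have Fa s : F (tperm i2 i3 * s)%g = F s.
  by rewrite /F oddT // signN !permM tpermL tpermR !tpermD // Av !mulNr linearN /= mulrN opprK.
have Fb s : F (tperm i4 i5 * s)%g = F s.
  by rewrite /F oddT // signN !permM tpermL tpermR !tpermD // Aw mulrN linearN /= mulNr mulrN opprK.
have ltN (s : 'S_5) (a b : 'I_5) : a != b -> (s b < s a)%N = ~~ (s a < s b)%N.
  move=> ab; rewrite -leqNgt ltn_neqAle; case: eqP => // /val_inj; move/(@perm_inj _ s) => ba.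
  by rewrite ba eqxx in ab.
apply: (@fps_muln_eq0 _ 3).
pose Q1 (s : 'S_5) := (s i2 < s i3)%N; pose Q2 (s : 'S_5) := (s i4 < s i5)%N.
rewrite (mulrnA _ 2 2) -(@sum_perm_halve _ F Q1 Q2 (tperm i4 i5)) //; first last.
- by move=> s; rewrite /Q2 !permM tpermL tpermR ltN.
- by move=> s; rewrite /Q1 !permM !tpermD.
rewrite -(@sum_perm_halve _ F predT Q1 (tperm i2 i3)) //; last first.
  by move=> s; rewrite /Q1 !permM tpermL tpermR ltN.
under eq_bigr do rewrite /F fps_derivM mulrDr.
rewrite big_split /=.
rewrite (@sum_perm_cycle _ (tperm i1 i2 * tperm i1 i3)%g) ?add0r; last first.
  have c1 : tperm i1 i3 (tperm i1 i2 i1) = i2 by rewrite !permE.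
  have c2 : tperm i1 i3 (tperm i1 i2 i2) = i3 by rewrite !permE.
  have c3 : tperm i1 i3 (tperm i1 i2 i3) = i1 by rewrite !permE.
  have c4 : tperm i1 i3 (tperm i1 i2 i4) = i4 by rewrite !permE.
  have c5 : tperm i1 i3 (tperm i1 i2 i5) = i5 by rewrite !permE.
  move=> s; rewrite -!mulgA !oddT // !negbK !permM !(c1, c2, c3, c4, c5).
  by rewrite -!mulrDr -!mulrDl Cv mul0r mulr0.
rewrite (@sum_perm_cycle _ (tperm i1 i4 * tperm i1 i5)%g) // => s.
have c1 : tperm i1 i5 (tperm i1 i4 i1) = i4 by rewrite !permE.
have c2 : tperm i1 i5 (tperm i1 i4 i2) = i2 by rewrite !permE.
have c3 : tperm i1 i5 (tperm i1 i4 i3) = i3 by rewrite !permE.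
have c4 : tperm i1 i5 (tperm i1 i4 i4) = i5 by rewrite !permE.
have c5 : tperm i1 i5 (tperm i1 i4 i5) = i1 by rewrite !permE.
rewrite -!mulgA !oddT // !negbK !permM !(c1, c2, c3, c4, c5).
by rewrite -!mulrDr Cw !mulr0.
Qed.

End VectorFieldsAndForms.

Section E510.
Variable K : numFieldType.

(* L = E(5, 10): its even part S_5 and its odd part, with their brackets; the *)
(* bracket of an odd w with an even X is - even_odd_bracket X w.              *)
Record L_even := LEven { vfield_of :> {ffun 'I_5 -> fps 5 K}; _ : vfield_of \in @divfree K }.
Record L_odd := LOdd { form_of :> {ffun 'I_5 * 'I_5 -> fps 5 K}; _ : form_of \in @closed_form K }.

HB.instance Definition _ := [isSub for vfield_of].
HB.instance Definition _ := [Choice of L_even by <:].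
HB.instance Definition _ := [SubChoice_isSubLmodule of L_even by <:].
HB.instance Definition _ := [isSub for form_of].
HB.instance Definition _ := [Choice of L_odd by <:].
HB.instance Definition _ := [SubChoice_isSubLmodule of L_odd by <:].

Implicit Types (X Y : L_even) (v w : L_odd).

Definition even_bracket X Y : L_even :=
  LEven (vf_bracket_divfree (valP X) (valP Y)).
Definition even_odd_bracket X w : L_odd :=
  LOdd (lie_deriv_closed X (valP w)).
Definition odd_bracket v w : L_even :=
  LEven (form_bracket_divfree (valP v) (valP w)).

(* X has all its homogeneous components in degrees satisfying P, for the      *)
(* grading deg x_i = 2 = - deg \partial_i; same for a 2-form, deg d_ij = -1.  *)
Definition even_degs (P : pred int) X : Prop :=
  forall i m, X i m != 0 -> P ((mdeg m * 2)%:Z - 2).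
Definition odd_degs (P : pred int) w : Prop :=
  forall jk m, w jk m != 0 -> P ((mdeg m * 2)%:Z - 1).

Fact partial_divfree i : [ffun j => fps_const 5 (j == i)%:R] \in @divfree K.
Proof. by apply/eqP; rewrite /divergence big1 // => j _; rewrite ffunE fps_deriv_const. Qed.

Definition partial i : L_even := LEven (partial_divfree i).

Fact dform_closed i j :
  [ffun kl : 'I_5 * 'I_5 =>
     fps_const 5 ((kl == (i, j))%:R - (kl == (j, i))%:R)] \in @closed_form K.
Proof.
apply/closed_formP; split=> [k l|a b c]; rewrite !ffunE ?fps_deriv_const ?addr0 //.
apply: fpsP => m /=; rewrite -[RHS]mulNrn opprB; congr ((_ - _) *+ _); congr (_ %:R).
all: by rewrite !xpair_eqE andbC.
Qed.

(* d_ij = dx_i /\ dx_j *)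
Definition dform i j : L_odd := LOdd (dform_closed i j).

(* g_0 is identified with sl_5 by x_i \partial_j |-> E_ij; this is the matrix *)
(* of the degree 0 component of X.                                            *)
Definition linear_part X : 'M[K]_5 := \matrix_(i, j) X j U_(i)%MM.

(* The enveloping algebra U(L): the K-algebra generated by L subject to the   *)
(* linear relations of L and xy - (-1)^(p(x)p(y)) yx = [x, y]; uterm is the   *)
(* type of the algebraic expressions in the generators, uterm_eq the          *)
(* congruence generated by the relations and by the axioms of K-algebras.     *)
Inductive uterm : Type :=
| UEven of L_even
| UOdd of L_odd
| UZero
| UOne
| UAdd of uterm & uterm
| UMul of uterm & uterm
| UScale of K & uterm.

Inductive uterm_eq : uterm -> uterm -> Prop :=
| ueq_refl s : uterm_eq s s
| ueq_sym s t : uterm_eq s t -> uterm_eq t s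
| ueq_trans s t r : uterm_eq s t -> uterm_eq t r -> uterm_eq s r
| ueq_add s s' t t' :
    uterm_eq s s' -> uterm_eq t t' -> uterm_eq (UAdd s t) (UAdd s' t')
| ueq_mul s s' t t' :
    uterm_eq s s' -> uterm_eq t t' -> uterm_eq (UMul s t) (UMul s' t')
| ueq_scale c s s' : uterm_eq s s' -> uterm_eq (UScale c s) (UScale c s')
| ueq_addA s t r : uterm_eq (UAdd s (UAdd t r)) (UAdd (UAdd s t) r)
| ueq_addC s t : uterm_eq (UAdd s t) (UAdd t s)
| ueq_add0 s : uterm_eq (UAdd UZero s) s
| ueq_addN s : uterm_eq (UAdd (UScale (-1) s) s) UZero
| ueq_scaleA c d s : uterm_eq (UScale c (UScale d s)) (UScale (c * d) s)
| ueq_scale1 s : uterm_eq (UScale 1 s) s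
| ueq_scaleDr c s t :
    uterm_eq (UScale c (UAdd s t)) (UAdd (UScale c s) (UScale c t))
| ueq_scaleDl c d s :
    uterm_eq (UScale (c + d) s) (UAdd (UScale c s) (UScale d s))
| ueq_mulA s t r : uterm_eq (UMul s (UMul t r)) (UMul (UMul s t) r)
| ueq_mul1 s : uterm_eq (UMul UOne s) s
| ueq_mulr1 s : uterm_eq (UMul s UOne) s
| ueq_mulDl s t r : uterm_eq (UMul (UAdd s t) r) (UAdd (UMul s r) (UMul t r))
| ueq_mulDr s t r : uterm_eq (UMul r (UAdd s t)) (UAdd (UMul r s) (UMul r t))
| ueq_scaleAl c s t : uterm_eq (UScale c (UMul s t)) (UMul (UScale c s) t)
| ueq_scaleAr c s t : uterm_eq (UScale c (UMul s t)) (UMul s (UScale c t))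
| ueq_even c X Y :
    uterm_eq (UEven (c *: X + Y)) (UAdd (UScale c (UEven X)) (UEven Y))
| ueq_odd c v w :
    uterm_eq (UOdd (c *: v + w)) (UAdd (UScale c (UOdd v)) (UOdd w))
| ueq_even_even X Y :
    uterm_eq (UMul (UEven X) (UEven Y))
             (UAdd (UMul (UEven Y) (UEven X)) (UEven (even_bracket X Y)))
| ueq_even_odd X w :
    uterm_eq (UMul (UEven X) (UOdd w))
             (UAdd (UMul (UOdd w) (UEven X)) (UOdd (even_odd_bracket X w)))
| ueq_odd_odd v w :
    uterm_eq (UMul (UOdd v) (UOdd w))
             (UAdd (UScale (-1) (UMul (UOdd w) (UOdd v)))
                   (UEven (odd_bracket v w))).

HB.instance Definition _ := gen_eqMixin uterm.
HB.instance Definition _ := gen_choiceMixin uterm.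

Fact uterm_eq_equiv : equiv_class_of (fun s t => `[< uterm_eq s t >]).
Proof.
split=> [s|s t|t s r /asboolP st /asboolP tr]; first exact/asboolP/ueq_refl.
  by apply: asbool_equiv_eq; split; apply: ueq_sym.
exact/asboolP/(ueq_trans st).
Qed.

Canonical uterm_equiv := EquivRelPack uterm_eq_equiv.

Definition UL := {eq_quot uterm_equiv}.

HB.instance Definition _ := Choice.on UL.

Definition upi (s : uterm) : UL := \pi_UL s.

Lemma upiP s t : upi s = upi t <-> uterm_eq s t.
Proof. by split=> [/eqmodP/asboolP|st]; last exact/eqmodP/asboolP. Qed.

Lemma upiW (P : UL -> Prop) : (forall s, P (upi s)) -> forall u, P u.
Proof. exact: quotW. Qed.

Lemma repr_upi s : uterm_eq (repr (upi s)) s.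
Proof. by apply/upiP; rewrite /upi reprK. Qed.

Definition uzero := upi UZero.
Definition uone := upi UOne.
Definition uadd (u v : UL) : UL := upi (UAdd (repr u) (repr v)).
Definition umul (u v : UL) : UL := upi (UMul (repr u) (repr v)).
Definition uscale (c : K) (u : UL) : UL := upi (UScale c (repr u)).
Definition uopp (u : UL) : UL := uscale (-1) u.

Lemma uaddE s t : uadd (upi s) (upi t) = upi (UAdd s t).
Proof. by apply/upiP/ueq_add; apply: repr_upi. Qed.
Lemma umulE s t : umul (upi s) (upi t) = upi (UMul s t).
Proof. by apply/upiP/ueq_mul; apply: repr_upi. Qed.
Lemma uscaleE c s : uscale c (upi s) = upi (UScale c s).
Proof. exact/upiP/ueq_scale/repr_upi. Qed.

Local Tactic Notation "by_ueq" uconstr(c) :=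
  do ![elim/upiW => ?];
  rewrite /uopp /uzero /uone !(uaddE, umulE, uscaleE); apply/upiP; apply c.

Fact uaddA : associative uadd. Proof. by_ueq ueq_addA. Qed.
Fact uaddC : commutative uadd. Proof. by_ueq ueq_addC. Qed.
Fact uadd0 : left_id uzero uadd. Proof. by_ueq ueq_add0. Qed.
Fact uaddN : left_inverse uzero uopp uadd. Proof. by_ueq ueq_addN. Qed.

HB.instance Definition _ := GRing.isZmodule.Build UL uaddA uaddC uadd0 uaddN.

Fact umulA : associative umul. Proof. by_ueq ueq_mulA. Qed.
Fact umul1 : left_id uone umul. Proof. by_ueq ueq_mul1. Qed.
Fact umulr1 : right_id uone umul. Proof. by_ueq ueq_mulr1. Qed.
Fact umulDl : left_distributive umul uadd. Proof. by_ueq ueq_mulDl. Qed.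
Fact umulDr : right_distributive umul uadd.
Proof. by move=> r s t; move: r s t; by_ueq ueq_mulDr. Qed.

(* U(L) is not the zero ring: the augmentation sends 1 to 1. *)
Fixpoint uaug (s : uterm) : K :=
  match s with
  | UEven _ | UOdd _ | UZero => 0
  | UOne => 1
  | UAdd s t => uaug s + uaug t
  | UMul s t => uaug s * uaug t
  | UScale c s => c * uaug s
  end.

Fact uone_neq0 : uone != uzero.
Proof.
apply/eqP => /upiP; suff augP s t : uterm_eq s t -> uaug s = uaug t.
  by move/augP/eqP; rewrite /= oner_eq0.
elim=> {s t} //=.
- by move=> s t r _ -> _ ->.
- by move=> s s' t t' _ -> _ ->.
- by move=> s s' t t' _ -> _ ->.
- by move=> c s s' _ ->.
- by move=> *; rewrite addrA.
- by move=> *; rewrite addrC.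
- by move=> *; rewrite add0r.
- by move=> *; rewrite mulN1r addNr.
- by move=> *; rewrite mulrA.
- by move=> *; rewrite mul1r.
- by move=> *; rewrite mulrDr.
- by move=> *; rewrite mulrDl.
- by move=> *; rewrite mulrA.
- by move=> *; rewrite mul1r.
- by move=> *; rewrite mulr1.
- by move=> *; rewrite mulrDl.
- by move=> *; rewrite mulrDr.
- by move=> *; rewrite mulrA.
- by move=> *; rewrite mulrCA.
- by move=> *; rewrite mulr0 addr0.
- by move=> *; rewrite mulr0 addr0.
- by move=> *; rewrite mul0r addr0.
- by move=> *; rewrite mul0r addr0.
- by move=> *; rewrite mul0r mulr0 addr0.
Qed.

HB.instance Definition _ := GRing.Zmodule_isNzRing.Build UL
  umulA umul1 umulr1 umulDl umulDr uone_neq0.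

Fact uscaleA c d u : uscale c (uscale d u) = uscale (c * d) u.
Proof. by move: u; by_ueq ueq_scaleA. Qed.
Fact uscale1 : left_id 1 uscale. Proof. by_ueq ueq_scale1. Qed.
Fact uscaleDr : right_distributive uscale uadd.
Proof. by move=> c; by_ueq ueq_scaleDr. Qed.
Fact uscaleDl u : {morph uscale^~ u : c d / c + d >-> uadd c d}.
Proof. by move=> c d; move: u; by_ueq ueq_scaleDl. Qed.

HB.instance Definition _ := GRing.Zmodule_isLmodule.Build K UL
  uscaleA uscale1 uscaleDr uscaleDl.

Fact uscaleAl (c : K) (u v : UL) : uscale c (umul u v) = umul (uscale c u) v.
Proof. by move: u v; by_ueq ueq_scaleAl. Qed.
Fact uscaleAr (c : K) (u v : UL) : uscale c (umul u v) = umul u (uscale c v).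
Proof. by move: u v; by_ueq ueq_scaleAr. Qed.

HB.instance Definition _ := GRing.Lmodule_isLalgebra.Build K UL uscaleAl.
HB.instance Definition _ := GRing.Lalgebra_isAlgebra.Build K UL uscaleAr.

Definition of_even X : UL := upi (UEven X).
Definition of_odd w : UL := upi (UOdd w).

Lemma of_even_even X Y :
  of_even X * of_even Y = of_even Y * of_even X + of_even (even_bracket X Y).
Proof. by rewrite [_ * _]umulE [X in X + _]umulE [RHS]uaddE; apply/upiP/ueq_even_even. Qed.

Lemma of_even_odd X w :
  of_even X * of_odd w = of_odd w * of_even X + of_odd (even_odd_bracket X w).
Proof. by rewrite [_ * _]umulE [X in X + _]umulE [RHS]uaddE; apply/upiP/ueq_even_odd. Qed.

Lemma of_odd_odd v w :
  of_odd v * of_odd w = - (of_odd w * of_odd v) + of_even (odd_bracket v w).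
Proof.
rewrite [_ * _]umulE [X in - X]umulE [- _]uscaleE [RHS]uaddE.
exact/upiP/ueq_odd_odd.
Qed.

End E510.

Section VermaModules.
Variable K : numFieldType.

Record g0_module := G0Module {
  g0_sort :> lmodType K;
  g0_act : 'M[K]_5 -> g0_sort -> g0_sort;
  g0_act_linear : forall A, \tr A = 0 -> linear (g0_act A);
  g0_act_linear_l : forall c A B v, \tr A = 0 -> \tr B = 0 ->
    g0_act (c *: A + B) v = c *: g0_act A v + g0_act B v;
  g0_act_bracket : forall A B v, \tr A = 0 -> \tr B = 0 ->
    g0_act (A *m B - B *m A) v = g0_act A (g0_act B v) - g0_act B (g0_act A v)
}.

(* M(V) = U(L) \otimes_(U(L_0)) V, generated by the pure tensors u \otimes v  *)
(* subject to bilinearity and u x \otimes v = u \otimes x v for x in L_0 (as  *)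
(* L_0 generates U(L_0)). An x in L_0 (nonnegative degrees) acts on V through *)
(* its degree 0 component, which is 0 for x odd.                              *)
Section Verma.
Variable V : g0_module.
Implicit Types (u : UL K) (v : V).

Inductive vterm : Type :=
| VTens of UL K & V
| VZero
| VAdd of vterm & vterm
| VScale of K & vterm.

Inductive vterm_eq : vterm -> vterm -> Prop :=
| veq_refl s : vterm_eq s s
| veq_sym s t : vterm_eq s t -> vterm_eq t s
| veq_trans s t r : vterm_eq s t -> vterm_eq t r -> vterm_eq s r
| veq_add s s' t t' :
    vterm_eq s s' -> vterm_eq t t' -> vterm_eq (VAdd s t) (VAdd s' t')
| veq_scale c s s' : vterm_eq s s' -> vterm_eq (VScale c s) (VScale c s')
| veq_addA s t r : vterm_eq (VAdd s (VAdd t r)) (VAdd (VAdd s t) r)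
| veq_addC s t : vterm_eq (VAdd s t) (VAdd t s)
| veq_add0 s : vterm_eq (VAdd VZero s) s
| veq_addN s : vterm_eq (VAdd (VScale (-1) s) s) VZero
| veq_scaleA c d s : vterm_eq (VScale c (VScale d s)) (VScale (c * d) s)
| veq_scale1 s : vterm_eq (VScale 1 s) s
| veq_scaleDr c s t :
    vterm_eq (VScale c (VAdd s t)) (VAdd (VScale c s) (VScale c t))
| veq_scaleDl c d s :
    vterm_eq (VScale (c + d) s) (VAdd (VScale c s) (VScale d s))
| veq_tensl c u u' v :
    vterm_eq (VTens (c *: u + u') v) (VAdd (VScale c (VTens u v)) (VTens u' v))
| veq_tensr c u v v' :
    vterm_eq (VTens u (c *: v + v')) (VAdd (VScale c (VTens u v)) (VTens u v'))
| veq_even u (X : L_even K) v : even_degs (>= 0) X ->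
    vterm_eq (VTens (u * of_even X) v) (VTens u (g0_act (linear_part X) v))
| veq_odd u (w : L_odd K) v : odd_degs (>= 0) w ->
    vterm_eq (VTens (u * of_odd w) v) VZero.

HB.instance Definition _ := gen_eqMixin vterm.
HB.instance Definition _ := gen_choiceMixin vterm.

Fact vterm_eq_equiv : equiv_class_of (fun s t => `[< vterm_eq s t >]).
Proof.
split=> [s|s t|t s r /asboolP st /asboolP tr]; first exact/asboolP/veq_refl.
  by apply: asbool_equiv_eq; split; apply: veq_sym.
exact/asboolP/(veq_trans st).
Qed.

Canonical vterm_equiv := EquivRelPack vterm_eq_equiv.

Definition Verma := {eq_quot vterm_equiv}.

HB.instance Definition _ := Choice.on Verma.

Definition vpi (s : vterm) : Verma := \pi_Verma s.

Lemma vpiP s t : vpi s = vpi t <-> vterm_eq s t.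
Proof. by split=> [/eqmodP/asboolP|st]; last exact/eqmodP/asboolP. Qed.

Lemma vpiW (P : Verma -> Prop) : (forall s, P (vpi s)) -> forall m, P m.
Proof. exact: quotW. Qed.

Lemma repr_vpi s : vterm_eq (repr (vpi s)) s.
Proof. by apply/vpiP; rewrite /vpi reprK. Qed.

Definition vzero := vpi VZero.
Definition vadd (m p : Verma) : Verma := vpi (VAdd (repr m) (repr p)).
Definition vscale (c : K) (m : Verma) : Verma := vpi (VScale c (repr m)).
Definition vopp (m : Verma) : Verma := vscale (-1) m.

Lemma vaddE s t : vadd (vpi s) (vpi t) = vpi (VAdd s t).
Proof. by apply/vpiP/veq_add; apply: repr_vpi. Qed.
Lemma vscaleE c s : vscale c (vpi s) = vpi (VScale c s).
Proof. exact/vpiP/veq_scale/repr_vpi. Qed.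

Local Tactic Notation "by_veq" uconstr(c) :=
  do ![elim/vpiW => ?];
  rewrite /vopp /vzero !(vaddE, vscaleE); apply/vpiP; apply c.

Fact vaddA : associative vadd. Proof. by_veq veq_addA. Qed.
Fact vaddC : commutative vadd. Proof. by_veq veq_addC. Qed.
Fact vadd0 : left_id vzero vadd. Proof. by_veq veq_add0. Qed.
Fact vaddN : left_inverse vzero vopp vadd. Proof. by_veq veq_addN. Qed.

HB.instance Definition _ := GRing.isZmodule.Build Verma vaddA vaddC vadd0 vaddN.

Fact vscaleA c d m : vscale c (vscale d m) = vscale (c * d) m.
Proof. by move: m; by_veq veq_scaleA. Qed.
Fact vscale1 : left_id 1 vscale. Proof. by_veq veq_scale1. Qed.
Fact vscaleDr : right_distributive vscale vadd.
Proof. by move=> c; by_veq veq_scaleDr. Qed.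
Fact vscaleDl m : {morph vscale^~ m : c d / c + d >-> vadd c d}.
Proof. by move=> c d; move: m; by_veq veq_scaleDl. Qed.

HB.instance Definition _ := GRing.Zmodule_isLmodule.Build K Verma
  vscaleA vscale1 vscaleDr vscaleDl.

Definition tens u v : Verma := vpi (VTens u v).

Lemma tens_linearl c u u' v : tens (c *: u + u') v = c *: tens u v + tens u' v.
Proof. by rewrite [c *: tens _ _]vscaleE [RHS]vaddE; apply/vpiP/veq_tensl. Qed.

Lemma tens_linearr c u v v' : tens u (c *: v + v') = c *: tens u v + tens u v'.
Proof. by rewrite [c *: tens _ _]vscaleE [RHS]vaddE; apply/vpiP/veq_tensr. Qed.

Lemma tens_even u X v : even_degs (>= 0) X ->
  tens (u * of_even X) v = tens u (g0_act (linear_part X) v).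
Proof. by move=> ?; apply/vpiP/veq_even. Qed.

Lemma tens_odd u w v : odd_degs (>= 0) w -> tens (u * of_odd w) v = 0.
Proof. by move=> ?; apply/vpiP/veq_odd. Qed.

(* The action of U(L): x (u \otimes v) = x u \otimes v. *)
Fixpoint vterm_act u (s : vterm) : vterm :=
  match s with
  | VTens u' v => VTens (u * u') v
  | VZero => VZero
  | VAdd s t => VAdd (vterm_act u s) (vterm_act u t)
  | VScale c s => VScale c (vterm_act u s)
  end.

Fact vterm_act_eq u s t :
  vterm_eq s t -> vterm_eq (vterm_act u s) (vterm_act u t).
Proof.
elim=> {s t} /=; try by [constructor].
- by move=> s t r _ st _ tr; apply: veq_trans st tr.
- by move=> *; rewrite mulrDr -scalerAr; apply: veq_tensl.
- by move=> *; rewrite mulrA; apply: veq_even.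
- by move=> *; rewrite mulrA; apply: veq_odd.
Qed.

Definition Verma_act u (m : Verma) : Verma := vpi (vterm_act u (repr m)).

Lemma Verma_act_tens u u' v : Verma_act u (tens u' v) = tens (u * u') v.
Proof. exact/vpiP/(vterm_act_eq u (repr_vpi _)). Qed.

Lemma Verma_act_linear u : linear (Verma_act u).
Proof.
move=> c; do 2!elim/vpiW => ?; rewrite [_ *: _]vscaleE [_ + _]vaddE.
rewrite [_ *: _]vscaleE [RHS]vaddE; apply/vpiP.
apply: (veq_trans (vterm_act_eq u (repr_vpi _))) => /=.
apply/veq_sym; apply: veq_add; last exact/vterm_act_eq/repr_vpi.
exact/veq_scale/vterm_act_eq/repr_vpi.
Qed.

End Verma.

Definition L_morphism (A B : g0_module) (phi : Verma A -> Verma B) : Prop :=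
  [/\ linear phi,
      forall X m, phi (Verma_act (of_even X) m) = Verma_act (of_even X) (phi m) &
      forall w m, phi (Verma_act (of_odd w) m) = Verma_act (of_odd w) (phi m)].

(* The elements of degree k of U_-, the subalgebra of U(L) generated by       *)
(* L_- = <d_ij, \partial_i>.                                                  *)
Inductive Uminus_deg : nat -> UL K -> Prop :=
| Uminus_one : Uminus_deg 0 1
| Uminus_dform k i j u :
    Uminus_deg k u -> Uminus_deg k.+1 (of_odd (dform K i j) * u)
| Uminus_partial k i u :
    Uminus_deg k u -> Uminus_deg k.+2 (of_even (partial K i) * u)
| Uminus_linear k c u v :
    Uminus_deg k u -> Uminus_deg k v -> Uminus_deg k (c *: u + v).

Definition has_degree (k : nat) (A B : g0_module) (phi : Verma A -> Verma B) :=
  exists (r : nat) (u : 'I_r -> UL K) (l : 'I_r -> {linear A -> B}),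
    (forall i, Uminus_deg k (u i)) /\
    (forall a : A, phi (tens 1 a) = \sum_i tens (u i) (l i a)).

End VermaModules.

Section FundamentalModules.
Variable K : numFieldType.

(* sl_5 acts on polynomials by derivations: E_ij acts as z_i d/dz_j. *)
Definition poly_act (A : 'M[K]_5) (p : {mpoly K[5]}) : {mpoly K[5]} :=
  \sum_i \sum_j A i j *: ('X_i * p^`M(j)).

Fact poly_act_linear A : linear (poly_act A).
Proof.
move=> c p q; rewrite /poly_act scaler_sumr -big_split; apply: eq_bigr => i _ /=.
rewrite scaler_sumr -big_split; apply: eq_bigr => j _ /=.
by rewrite linearP mulrDr -scalerAr scalerDr !scalerA mulrC.
Qed.

Fact poly_act_linear_l c A B p :
  poly_act (c *: A + B) p = c *: poly_act A p + poly_act B p.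
Proof.
rewrite /poly_act scaler_sumr -big_split; apply: eq_bigr => i _ /=.
rewrite scaler_sumr -big_split; apply: eq_bigr => j _ /=.
by rewrite !mxE scalerDl scalerA.
Qed.

Fact poly_act_comp A B p :
  poly_act A (poly_act B p) = poly_act (A *m B) p +
    \sum_i \sum_j \sum_k \sum_l
      (A i j * B k l) *: ('X_i * 'X_k * p^`M(l)^`M(j)).
Proof.
have dX j k : ('X_k : {mpoly K[5]})^`M(j) = (k == j)%:R.
  rewrite mderivX mnm1E; case: eqP => [->|_]; last by rewrite scale0r.
  rewrite scale1r (_ : U_(j) - U_(j) = 0)%MM ?mpolyX0 //.
  by apply/mnmP=> i; rewrite mnmBE subnn mnm0E.
rewrite {1 3}/poly_act -big_split; apply: eq_bigr => i _ /=.
transitivity (\sum_j \sum_k \sum_l (A i j * B k l) *: ((k == j)%:R *: ('X_i * p^`M(l)))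
  + \sum_j \sum_k \sum_l (A i j * B k l) *: ('X_i * 'X_k * p^`M(l)^`M(j))).
  rewrite -big_split; apply: eq_bigr => j _ /=.
  rewrite linear_sum mulr_sumr scaler_sumr -big_split; apply: eq_bigr => k _ /=.
  rewrite linear_sum mulr_sumr scaler_sumr -big_split; apply: eq_bigr => l _ /=.
  rewrite linearZ /= mderivM dX mulr_natl scaler_nat -scalerAr scalerA mulrDr.
  by rewrite scalerDr mulrnAr mulrA.
congr (_ + _); rewrite exchange_big /=.
under eq_bigr do rewrite exchange_big /=.
rewrite exchange_big /=; apply: eq_bigr => l _; rewrite mxE scaler_suml.
apply: eq_bigr => k _; rewrite (bigD1 k) //= eqxx scale1r big1 ?addr0 // => j.
by rewrite eq_sym => /negPf->; rewrite scale0r scaler0.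
Qed.

Fact sum4_exchange (V : zmodType) (F : 'I_5 -> 'I_5 -> 'I_5 -> 'I_5 -> V) :
  \sum_i \sum_j \sum_k \sum_l F i j k l = \sum_k \sum_l \sum_i \sum_j F i j k l.
Proof.
rewrite pair_bigA /= [RHS]pair_bigA /=.
under eq_bigr do rewrite pair_bigA /=.
under [RHS]eq_bigr do rewrite pair_bigA /=.
exact: exchange_big.
Qed.

Fact poly_act_bracket A B p :
  poly_act (A *m B - B *m A) p = poly_act A (poly_act B p) - poly_act B (poly_act A p).
Proof.
rewrite !poly_act_comp [A *m B - _]addrC -[- _]scaleN1r poly_act_linear_l scaleN1r.
rewrite addrC opprD addrACA -[LHS]addr0; congr (_ + _); apply/esym/eqP.
rewrite subr_eq0; apply/eqP; rewrite sum4_exchange; do 4!apply: eq_bigr => ? _.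
by rewrite mulrC ['X__ * 'X__]mulrC mderiv_comm.
Qed.

Fact poly_act_homog n A p : p \is n.-homog -> poly_act A p \is n.-homog.
Proof.
move=> hp; rewrite /poly_act; do 2!apply: rpred_sum => ? _; apply/rpredZ.
case: n hp => [|n] hp.
  rewrite (_ : p^`M(_) = 0) ?mulr0 ?rpred0 //; apply/mpolyP => m.
  rewrite mcoeff0 mcoeff_deriv (dhomog_nemf_coeff hp) ?mul0rn //.
  by rewrite /= mdegD mdeg1 addn1.
apply: (@dhomogM _ _ _ 1 _ n); first by rewrite dhomogX /= mdeg1.
apply/dhomogP => m; rewrite mcoeff_msupp mcoeff_deriv => nz.
apply/eqP; apply: contraR nz => ne_m; rewrite (dhomog_nemf_coeff hp) ?mul0rn //.
by rewrite /= mdegD mdeg1 addn1 eqSS.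
Qed.

Definition Sym_act n A (p : dhomog 5 K n) : dhomog 5 K n :=
  DHomog (poly_act_homog A (dhomog_is_dhomog p)).

Fact Sym_act_linear n A : \tr A = 0 -> linear (@Sym_act n A).
Proof. by move=> _ c p q; apply: val_inj; apply: poly_act_linear. Qed.

Fact Sym_act_linear_l n c A B (p : dhomog 5 K n) : \tr A = 0 -> \tr B = 0 ->
  Sym_act (c *: A + B) p = c *: Sym_act A p + Sym_act B p.
Proof. by move=> _ _; apply: val_inj; apply: poly_act_linear_l. Qed.

Fact Sym_act_bracket n A B (p : dhomog 5 K n) : \tr A = 0 -> \tr B = 0 ->
  Sym_act (A *m B - B *m A) p = Sym_act A (Sym_act B p) - Sym_act B (Sym_act A p).
Proof. by move=> _ _; apply: val_inj; apply: poly_act_bracket. Qed.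

(* F(n, 0, 0, 0) = S^n(C^5), the degree n part of K[z_1, ..., z_5]. *)
Definition Sym n : g0_module K :=
  @G0Module K (dhomog 5 K n) (@Sym_act n) (@Sym_act_linear n)
    (@Sym_act_linear_l n) (@Sym_act_bracket n).

(* Lambda^2 C^5, as antisymmetric matrices: s stands for                      *)
(* \sum_(i < j) s i j x_ij, so that d/dx_ij s = s i j.                        *)
Definition antisym : {pred 'M[K]_5} := fun s => s^T == - s.

Fact antisym_submod : submod_closed antisym.
Proof.
split=> [|c s t /eqP s0 /eqP t0]; apply/eqP; first by rewrite trmx0 oppr0.
by rewrite linearP /= s0 t0 scalerN opprD.
Qed.

HB.instance Definition _ :=
  GRing.isSubmodClosed.Build K 'M[K]_5 antisym antisym_submod.

Record wedge2 := Wedge2 { wedge2_mx :> 'M[K]_5; _ : wedge2_mx \in antisym }.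

HB.instance Definition _ := [isSub for wedge2_mx].
HB.instance Definition _ := [Choice of wedge2 by <:].
HB.instance Definition _ := [SubChoice_isSubLmodule of wedge2 by <:].

Fact x_antisym (i j : 'I_5) : delta_mx i j - delta_mx j i \in antisym.
Proof. by apply/eqP; rewrite linearB /= !trmx_delta opprB. Qed.

Definition x_ i j : wedge2 := Wedge2 (x_antisym i j).

Fact wedge2_act_antisym A (s : wedge2) : A *m s + s *m A^T \in antisym.
Proof.
have /eqP s0 := valP s; apply/eqP.
by rewrite linearD /= !trmx_mul trmxK s0 mulNmx mulmxN opprD addrC.
Qed.

Definition wedge2_act A s : wedge2 := Wedge2 (wedge2_act_antisym A s).

Fact wedge2_act_linear A : \tr A = 0 -> linear (wedge2_act A).
Proof.
move=> _ c s t; apply: val_inj; rewrite /= mulmxDr mulmxDl scalerDr addrACA.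
by rewrite -scalemxAr -scalemxAl.
Qed.

Fact wedge2_act_linear_l c A B s : \tr A = 0 -> \tr B = 0 ->
  wedge2_act (c *: A + B) s = c *: wedge2_act A s + wedge2_act B s.
Proof.
move=> _ _; apply: val_inj; rewrite /= linearP /= mulmxDr mulmxDl scalerDr addrACA.
by rewrite -scalemxAr -scalemxAl.
Qed.

Fact wedge2_act_bracket A B s : \tr A = 0 -> \tr B = 0 ->
  wedge2_act (A *m B - B *m A) s =
  wedge2_act A (wedge2_act B s) - wedge2_act B (wedge2_act A s).
Proof.
move=> _ _; apply: val_inj; rewrite /= linearB /= !trmx_mul.
rewrite !(mulmxDr, mulmxDl, mulmxBl, mulmxBr, mulmxN, mulNmx) !mulmxA.
move: (A *m B *m s) (B *m A *m s) (s *m B^T *m A^T) (s *m A^T *m B^T).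
move: (A *m s *m B^T) (B *m s *m A^T) => a b c d e f.
by apply/matrixP => i j; rewrite !mxE; ring.
Qed.

(* F(0, 1, 0, 0) = Lambda^2 C^5 *)
Definition Wedge : g0_module K :=
  @G0Module K wedge2 wedge2_act wedge2_act_linear wedge2_act_linear_l
    wedge2_act_bracket.

(* The twist of V by the automorphism A |-> - A^T of sl_5. It turns C^5, with *)
(* basis z_i, into its dual, with z_i playing the role of the dual basis      *)
(* vector z_i^*: here E_ab z_c = - delta_ac z_b. Hence it turns F(n, 0, 0, 0) *)
(* and F(0, 1, 0, 0) into F(0, 0, 0, n) and F(0, 0, 1, 0), realized with the  *)
(* z_i^* and x_ij^* in place of the z_i and x_ij.                             *)
Section Twist.
Variable V : g0_module K.

Definition twist_act (A : 'M[K]_5) (v : V) : V := g0_act (- A^T) v.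

Fact trace_twist (A : 'M[K]_5) : \tr A = 0 -> \tr (- A^T) = 0.
Proof. by move=> A0; rewrite linearN /= mxtrace_tr A0 oppr0. Qed.

Fact twist_act_linear A : \tr A = 0 -> linear (twist_act A).
Proof. by move/trace_twist; apply: g0_act_linear. Qed.

Fact twist_act_linear_l c A B v : \tr A = 0 -> \tr B = 0 ->
  twist_act (c *: A + B) v = c *: twist_act A v + twist_act B v.
Proof.
move=> /trace_twist A0 /trace_twist B0; rewrite -g0_act_linear_l //.
by rewrite /twist_act linearP /= opprD scalerN.
Qed.

Fact twist_act_bracket A B v : \tr A = 0 -> \tr B = 0 ->
  twist_act (A *m B - B *m A) v =
  twist_act A (twist_act B v) - twist_act B (twist_act A v).
Proof.
move=> /trace_twist A0 /trace_twist B0; rewrite -g0_act_bracket //.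
by rewrite /twist_act linearB /= !trmx_mul !mulNmx !mulmxN !opprK opprB.
Qed.

Definition twist : g0_module K :=
  @G0Module K V twist_act twist_act_linear twist_act_linear_l twist_act_bracket.

End Twist.

(* F(0, 0, 0, n) and F(0, 0, 1, 0) *)
Definition SymDual n := twist (Sym n).
Definition WedgeDual := twist Wedge.

End FundamentalModules.

Section Morphisms.
Variable K : numFieldType.

Local Notation d_ i j := (of_odd (dform K i j)).

(* N is the sl_5-submodule of U_- generated by d_12 d_13 d_14 d_15, for the   *)
(* adjoint action.                                                            *)
Definition hw_vector : UL K := d_ i1 i2 * d_ i1 i3 * d_ i1 i4 * d_ i1 i5.

Definition ad (X : L_even K) (u : UL K) : UL K :=
  of_even X * u - u * of_even X.

Inductive in_N : UL K -> Prop :=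
| in_N_hw : in_N hw_vector
| in_N_linear c u v : in_N u -> in_N v -> in_N (c *: u + v)
| in_N_ad X u : even_degs (pred1 0) X -> in_N u -> in_N (ad X u).

(* z^a, for a of degree n (the value for other a, 0, is never used). *)
Definition z_ n (a : 'X_{1..5}) : dhomog 5 K n := ['dhomog_n 'X_[a]].

(* iota is an sl_5-isomorphism from S^3(C^5) onto N, with iota(z_1^3) the     *)
(* highest weight vector; by Schur's lemma there is only one.                 *)
Definition is_iota (iota : Sym K 3 -> UL K) : Prop :=
  [/\ linear iota,
      forall X p, even_degs (pred1 0) X ->
        iota (g0_act (linear_part X) p) = ad X (iota p),
      injective iota,
      forall u, in_N u <-> exists p, iota p = u &
      iota (z_ 3 (U_(i1) *+ 3)%MM) = hw_vector].

Definition u_ (iota : Sym K 3 -> UL K) (a : 'X_{1..5}) : UL K :=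
  (3`!%:R / (\prod_i (a i)`!)%:R) *: iota (z_ 3 a).

(* The next four predicates specify linear maps between Verma modules by      *)
(* their values on the pure tensors u \otimes s, with u in U(L); these span   *)
(* M(V), so that at most one map satisfies each of them. F(0, 0, 0, 0) is     *)
(* realized as the constants, with z_ 0 0 = 1.                                *)
Definition is_nabla_A (phi : Verma (Wedge K) -> Verma (SymDual K 0)) : Prop :=
  linear phi /\ forall u (s : wedge2 K),
    phi (@tens K (Wedge K) u s) =
    \sum_i \sum_j @tens K (SymDual K 0) (u * d_ i j) (s i j *: z_ 0 0%MM).

Definition is_nabla_C (phi : Verma (Sym K 0) -> Verma (WedgeDual K)) : Prop :=
  linear phi /\ forall u,
    phi (@tens K (Sym K 0) u (z_ 0 0%MM)) =
    \sum_i \sum_j @tens K (WedgeDual K) (u * d_ i j) (x_ K i j).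

Definition is_t_AB iota n (phi : Verma (Sym K n.+3) -> Verma (Sym K n)) : Prop :=
  linear phi /\ forall u (s : dhomog 5 K n.+3),
    phi (@tens K (Sym K n.+3) u s) =
    \sum_(a : 'X_{1..5 < 4} | mdeg a == 3%N)
       @tens K (Sym K n) (u * u_ iota a) ['dhomog_n s^`M[a]].

Definition is_t_BC iota n (phi : Verma (SymDual K n) -> Verma (SymDual K n.+3)) :
    Prop :=
  linear phi /\ forall u (s : dhomog 5 K n),
    phi (@tens K (SymDual K n) u s) =
    \sum_(a : 'X_{1..5 < 4} | mdeg a == 3%N)
       @tens K (SymDual K n.+3) (u * u_ iota a) ['dhomog_n.+3 ('X_[a] * s)].

End Morphisms.

(* Main.v *)
(* A morphism M(A) -> M(B) amounts to a g_0-equivariant map A -> M(B) with    *)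
(* image killed by L_+. For t_AB and nabla_A, s |-> iota s \otimes 1 and      *)
(* s |-> \sum s_ij d_ij \otimes 1, this image is killed because the property  *)
(* "X u \otimes 1 = 0 for all X vanishing at 0 to the required order" is      *)
(* stable under ad g_0, hence need only be verified for the highest weight    *)
(* vector of N. The morphisms nabla_C and t_BC are determined by the image of *)
(* 1, an explicit combination of elements u \otimes v with u a word in the    *)
(* d_ij. Moving an undetermined vector field or closed 2-form to the right    *)
(* through such words produces finitely many of its partial derivatives at 0; *)
(* after reduction modulo div X = 0, resp. dw = 0, all coefficients cancel,   *)
(* which is a computation.                                                    *)
(*                                                                            *)
(* For the nonvanishing, the PBW theorem is replaced by explicit functionals. *)
(* L acts on the multilinear functions on L^k; the functions                  *)
(* det(e_i, y_1(0), ..., y_4(0)), where y(0) is the value at 0 of the vector  *)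
(* field component of y, span a copy of F(0,0,0,1) killed by L_+. Products of *)
(* two or three of them realize F(0,0,1,0) and F(0,0,0,3), so that evaluation *)
(* of the transformed functions at a tuple of elements of L gives linear forms*)
(* on M(0,0,1,0) and M(0,0,0,3); well-chosen tuples give nonzero values.      *)

From HB Require Import structures.
From mathcomp Require Import all_boot all_order all_fingroup all_algebra.
From mathcomp Require Import boolp mpoly ring.
From mathcomp Require Import complex reals.
Require Import Defs.

Set Implicit Arguments.
Unset Strict Implicit.
Unset Printing Implicit Defensive.

Import GRing.Theory Num.Theory.
Local Open Scope ring_scope.


(** By Frobenius reciprocity ([Verma_morphism]), a morphism M(A) -> M(B) is an sl_5-equivariant map
    A -> M(B) whose image is killed by L_+. Each of the four factors has the trivial module at one
    end.

    If the source is trivial (nabla_C, t_BC), the morphism is given by one vector, [Phi_C] or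
    [Phi_BC], which all of L_0 must kill ([scalar_source]). If the target is trivial (nabla_A,
    t_AB), it is s -> T(s) ⊗ 1 for an equivariant map T from A to U_-, and T(s) ⊗ 1 must be killed
    by L_+ ([scalar_target]). That last property is stable under ad g_0 ([killed_ad]). Hence for
    t_AB, where T(s) = iota(6 s), it is enough to treat the highest weight vector of N
    ([in_N_killed]); for nabla_A it holds for each d_ij ([dform_killed]).

    The vanishing statements for [Phi_C], [Phi_BC] and the highest weight vector are finite
    computations with an undetermined field X or closed 2-form w. Moving it to the right through a
    word in the d_ij only produces partial derivatives of its components, and on reaching the
    coefficient vector only values and first derivatives at 0 count ([expandP]). The words are then
    brought to PBW normal form ([norm_wordsP]), the jets are reduced by div X = 0 or dw = 0, and
    every coefficient cancels ([check_evenP], [check_oddP]).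

    A Verma module is a quotient by generated relations, so nonvanishing needs linear forms on it.
    The super Jacobi identities let U(L) act on multilinear functions of tuples of elements of L, by
    the transposed adjoint action ([uterm_act_eq]). The determinants [omega] span a copy of
    F(0,0,0,1) killed by L_+; tensor products of two or three of them realize F(0,0,1,0) and
    F(0,0,0,3), and [test_functional] makes linear forms on M(0,0,1,0) and M(0,0,0,3) out of them.
    The images of 1 ⊗ z_1^3 and 1 ⊗ x_12 then have computable nonzero values ([hw_Phi_C_neq0],
    [d12_Phi_BC_neq0]).

    The degree is 5 = 4 + 1, since N lies in degree 4 of U_- ([in_N_deg]) and the d_ij in degree
    1. *)

Lemma mderivX1 (R : comNzRingType) n (i j : 'I_n) : ('X_i : {mpoly R[n]})^`M(j) = (i == j)%:R.
Proof.
rewrite mderivX mnm1E; case: eqP => [->|_]; last by rewrite scale0r.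
rewrite scale1r (_ : U_(j) - U_(j) = 0)%MM ?mpolyX0 //.
by apply/mnmP=> a; rewrite mnmBE subnn mnm0E.
Qed.

(** * Sums over the five indices and signs of index sequences *)

Lemma sum5 (V : nmodType) (F : 'I_5 -> V) :
  \sum_i F i = F i1 + F i2 + F i3 + F i4 + F i5.
Proof.
rewrite !big_ord_recl big_ord0 addr0 !addrA.
by congr (F _ + F _ + F _ + F _ + F _); apply: val_inj.
Qed.

Lemma ord5_ind (P : 'I_5 -> Prop) :
  P i1 -> P i2 -> P i3 -> P i4 -> P i5 -> forall i, P i.
Proof.
move=> P1 P2 P3 P4 P5 [[|[|[|[|[|//]]]]] lt_i]; [move: P1|move: P2|move: P3|move: P4|move: P5].
all: by congr (P _); apply: val_inj.
Qed.

(* The sign of the sequence (a, b, c, d, e), as a product of comparisons so   *)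
(* that it can be computed.                                                   *)
Definition cmp_sign (a b : nat) : int :=
  if (a < b)%N then 1 else if (b < a)%N then -1 else 0.

Definition eps (a b c d e : nat) : int :=
  cmp_sign a b * cmp_sign a c * cmp_sign a d * cmp_sign a e *
  cmp_sign b c * cmp_sign b d * cmp_sign b e *
  cmp_sign c d * cmp_sign c e * cmp_sign d e.

Lemma cmp_signE (a b : nat) : cmp_sign a b = sgz (b%:Z - a%:Z).
Proof.
rewrite /cmp_sign; case: ltngtP => [lt_ab|lt_ba|->]; last by rewrite subrr sgz0.
  by rewrite gtr0_sgz // subr_gt0 ltz_nat.
by rewrite ltr0_sgz // subr_lt0 ltz_nat.
Qed.

(** The Vandermonde product of s(1), ..., s(5) is the sign of s times that of 1, ..., 5; its own
    sign is the product of the signs of the differences, which is [eps]. *)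
Lemma eps_perm (s : 'S_5) : (-1) ^+ s = eps (s i1) (s i2) (s i3) (s i4) (s i5) :> int.
Proof.
pose a (t : 'S_5) : 'rV[int]_5 := \row_j (t j : nat)%:Z.
pose P t := \prod_(i < 5) \prod_(j < 5 | (i < j)%N) (a t 0 j - a t 0 i).
have sgP t : sgz (P t) = eps (t i1) (t i2) (t i3) (t i4) (t i5).
  rewrite /P (big_morph _ (@sgzM _) (sgz1 _)).
  under eq_bigr do rewrite (big_morph _ (@sgzM _) (sgz1 _)) big_mkcond /=.
  rewrite !big_ord_recl !big_ord0 /= !mulr1 !mul1r /eps !cmp_signE !mulrA !mxE.
  have [-> -> -> ->] : [/\ lift ord0 ord0 = i2, lift ord0 (lift ord0 ord0) = i3,
      lift ord0 (lift ord0 (lift ord0 ord0)) = i4 &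
      lift ord0 (lift ord0 (lift ord0 (lift ord0 ord0))) = i5 :> 'I_5].
    by split; apply: val_inj.
  by have -> : ord0 = i1 :> 'I_5 by apply: val_inj.
have PE : P s = (-1) ^+ s * P 1%g.
  rewrite /P -!det_Vandermonde.
  have -> : Vandermonde 5 (a s) = col_perm s (Vandermonde 5 (a 1%g)).
    by apply/matrixP => p q; rewrite !mxE perm1.
  by rewrite col_permE det_mulmx !det_perm odd_permV mulrC.
by rewrite -sgP PE sgzM sgP !perm1; case: (odd_perm s).
Qed.

Lemma eps_inj (i j k l m : 'I_5) : eps i j k l m != 0 ->
  exists s : 'S_5, [/\ s i1 = i, s i2 = j, s i3 = k, s i4 = l & s i5 = m].
Proof.
move=> nz; pose f (p : 'I_5) := nth i1 [:: i; j; k; l; m] p.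
have ne0 (a b : 'I_5) : cmp_sign a b != 0 -> a != b.
  by apply: contraNneq => ->; rewrite /cmp_sign ltnn.
have injf : injective f.
  apply/injectiveP/dinjectiveP => //.
  move: nz; rewrite /eps !mulf_eq0 !negb_or.
  do 9!case/andP; do 10!move/ne0 => ?.
  have lem (x : 'I_5) y : f x = f y -> x = y; last by move=> x y _ _; apply: lem.
  suff: uniq [:: i; j; k; l; m] by move=> u /eqP; rewrite /f nth_uniq // => /eqP/val_inj.
  rewrite /= !inE !negb_or; do !(apply/andP; split) => //.
by exists (perm injf); rewrite !permE.
Qed.

(** * Components of the bracket of two 2-forms *)

Section Brackets.
Variable K : numFieldType.
Local Notation D := (@fps_deriv 5 K).
Implicit Types (X Y Z : vfield K) (u v w : form2 K).

Lemma form_bracket_eps v w i :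
  form_bracket v w i =
  \sum_(jk : 'I_5 * 'I_5 | (jk.1 < jk.2)%N) \sum_(lm : 'I_5 * 'I_5 | (lm.1 < lm.2)%N)
     (v jk * w lm) *~ eps i jk.1 jk.2 lm.1 lm.2.
Proof.
rewrite ffunE pair_big_dep /=.
rewrite [RHS](bigID (fun q : ('I_5 * 'I_5) * ('I_5 * 'I_5) => eps i q.1.1 q.1.2 q.2.1 q.2.2 == 0)) /=.
rewrite [X in _ = X + _]big1 ?add0r => [|q /andP[_ /eqP->]]; last by rewrite mulr0z.
(* [h] reads the two index pairs off a permutation; [h'] recovers the permutation from them, its
   first value being i. Index sequences with a repetition have [eps] equal to 0. *)
pose h (s : 'S_5) := ((s i2, s i3), (s i4, s i5)).
pose h' q := odflt 1%g [pick s : 'S_5 | (s i1 == i) && (h s == q)].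
rewrite [RHS](reindex_onto h h') => [|q /andP[_ /eps_inj[s [s1 s2 s3 s4 s5]]]]; last first.
  rewrite /h'; case: pickP => [t /andP[_ /eqP]//|/(_ s)].
  by rewrite /h s1 s2 s3 s4 s5 -!surjective_pairing !eqxx.
apply: eq_big => [s|s /and3P[/eqP s1 _ _]] /=; last first.
  by rewrite -s1 -eps_perm; case: odd_perm; rewrite ?expr1 ?expr0 ?mulN1r ?mulrN1z ?mul1r ?mulr1z.
have [s1|ne_s1] /= := eqVneq (s i1) i.
  rewrite -s1 -eps_perm signr_eq0 andbT; case: (_ && _) => //=; apply/esym/eqP.
  rewrite /h'; case: pickP => [t /andP[/eqP t1 /eqP[t2 t3 t4 t5]]|/(_ s)]; last by rewrite s1 !eqxx.
  by apply/permP; apply: ord5_ind; rewrite // t1.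
apply/esym/negbTE; apply: contra ne_s1 => /andP[/andP[_ nz]].
rewrite /h'; case: pickP => [t /andP[/eqP t1 _] /= /eqP <-|]; first by rewrite t1.
have [t [t1 t2 t3 t4 t5]] := eps_inj nz.
by move/(_ t); rewrite t1 /h t2 t3 t4 t5 !eqxx.
Qed.

Lemma sum_lt5 (V : nmodType) (F : 'I_5 * 'I_5 -> V) :
  \sum_(jk : 'I_5 * 'I_5 | (jk.1 < jk.2)%N) F jk =
  F (i1, i2) + F (i1, i3) + F (i1, i4) + F (i1, i5) + F (i2, i3) +
  F (i2, i4) + F (i2, i5) + F (i3, i4) + F (i3, i5) + F (i4, i5).
Proof.
transitivity (\sum_(j : 'I_5) \sum_(k : 'I_5 | (j < k)%N) F (j, k)).
  by rewrite pair_big_dep; apply: eq_bigr => -[].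
under eq_bigr do rewrite big_mkcond /= sum5.
by rewrite sum5 /= !(addr0, add0r) !addrA.
Qed.

Definition pairs5 : seq ('I_5 * 'I_5) :=
  [:: (i1, i2); (i1, i3); (i1, i4); (i1, i5); (i2, i3);
      (i2, i4); (i2, i5); (i3, i4); (i3, i5); (i4, i5)].

Definition bracket_terms (i : 'I_5) : seq (('I_5 * 'I_5) * ('I_5 * 'I_5)) :=
  [seq q : ('I_5 * 'I_5) * ('I_5 * 'I_5) <- [seq (jk, lm) | jk <- pairs5, lm <- pairs5] |
    eps i q.1.1 q.1.2 q.2.1 q.2.2 != 0].

Lemma form_bracket_terms v w i : form_bracket v w i =
  \sum_(q <- bracket_terms i) (v q.1 * w q.2) *~ eps i q.1.1 q.1.2 q.2.1 q.2.2.
Proof.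
have sumP (V : nmodType) (F : 'I_5 * 'I_5 -> V) :
    \sum_(jk : 'I_5 * 'I_5 | (jk.1 < jk.2)%N) F jk = \sum_(jk <- pairs5) F jk.
  by rewrite sum_lt5 !big_cons big_nil addr0 !addrA.
rewrite form_bracket_eps sumP; under eq_bigr do rewrite sumP.
rewrite big_filter [RHS]big_mkcond big_allpairs.
by do 2!apply: eq_bigr => ? _; case: eqP => //= ->; rewrite mulr0z.
Qed.

Local Ltac form_bracket_tac :=
  rewrite form_bracket_terms;
  match goal with |- context [bracket_terms ?i] =>
    let l := eval vm_compute in (bracket_terms i) in
    have -> : bracket_terms i = l by vm_compute
  end;
  rewrite !big_cons big_nil; cbn [fst snd];
  repeat match goal with |- context [eps ?a ?b ?c ?d ?e] =>
    let t := constr:(eps a b c d e) in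
    let v := eval vm_compute in t in change t with v
  end;
  rewrite /intmul; cbn match; rewrite !mulr1n addr0 !addrA ?mulNr.

Lemma form_bracket1 v w : form_bracket v w i1 =
  v (i2, i3) * w (i4, i5) - v (i2, i4) * w (i3, i5) + v (i2, i5) * w (i3, i4)
  + v (i3, i4) * w (i2, i5) - v (i3, i5) * w (i2, i4) + v (i4, i5) * w (i2, i3).
Proof. by form_bracket_tac. Qed.

Lemma form_bracket2 v w : form_bracket v w i2 =
  - v (i1, i3) * w (i4, i5) + v (i1, i4) * w (i3, i5) - v (i1, i5) * w (i3, i4)
  - v (i3, i4) * w (i1, i5) + v (i3, i5) * w (i1, i4) - v (i4, i5) * w (i1, i3).
Proof. by form_bracket_tac. Qed.

Lemma form_bracket3 v w : form_bracket v w i3 =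
  v (i1, i2) * w (i4, i5) - v (i1, i4) * w (i2, i5) + v (i1, i5) * w (i2, i4)
  + v (i2, i4) * w (i1, i5) - v (i2, i5) * w (i1, i4) + v (i4, i5) * w (i1, i2).
Proof. by form_bracket_tac. Qed.

Lemma form_bracket4 v w : form_bracket v w i4 =
  - v (i1, i2) * w (i3, i5) + v (i1, i3) * w (i2, i5) - v (i1, i5) * w (i2, i3)
  - v (i2, i3) * w (i1, i5) + v (i2, i5) * w (i1, i3) - v (i3, i5) * w (i1, i2).
Proof. by form_bracket_tac. Qed.

Lemma form_bracket5 v w : form_bracket v w i5 =
  v (i1, i2) * w (i3, i4) - v (i1, i3) * w (i2, i4) + v (i1, i4) * w (i2, i3)
  + v (i2, i3) * w (i1, i4) - v (i2, i4) * w (i1, i3) + v (i3, i4) * w (i1, i2).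
Proof. by form_bracket_tac. Qed.

Definition form_bracketE := (form_bracket1, form_bracket2, form_bracket3,
  form_bracket4, form_bracket5).

End Brackets.

(** * The super Jacobi identities of L *)

HB.lock Definition der (K : numFieldType) (X : vfield K) (f : fps 5 K) : fps 5 K :=
  \sum_i X i * fps_deriv i f.

Section Jacobi.
Variable K : numFieldType.
Local Notation D := (@fps_deriv 5 K).
Implicit Types (X Y Z : vfield K) (u v w : form2 K) (f g : fps 5 K).

Lemma fps_mulZr c f g : f * (c *: g) = c *: (f * g).
Proof.
apply: fpsP => m; rewrite fps_coefZ /= mulr_sumr.
by apply: eq_bigr => k _; rewrite mulrCA.
Qed.

Lemma derE X f : der X f = \sum_i X i * D i f. Proof. by rewrite unlock. Qed.

Fact der_linear X : linear (der X).
Proof.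
move=> c f g; rewrite !derE scaler_sumr -big_split; apply: eq_bigr => i _ /=.
by rewrite linearP mulrDr fps_mulZr.
Qed.

HB.instance Definition _ X := GRing.isLinear.Build K (fps 5 K) (fps 5 K) _
  (der X) (der_linear X).

Lemma derD X f g : der X (f + g) = der X f + der X g. Proof. exact: linearD. Qed.
Lemma der_sum X (F : 'I_5 -> fps 5 K) : der X (\sum_i F i) = \sum_i der X (F i).
Proof. exact: linear_sum. Qed.

Lemma derM X f g : der X (f * g) = der X f * g + f * der X g.
Proof.
rewrite !derE mulr_suml mulr_sumr -big_split; apply: eq_bigr => i _ /=.
by rewrite fps_derivM; ring.
Qed.

Lemma vf_bracketE X Y j : vf_bracket X Y j = der X (Y j) - der Y (X j).
Proof. by rewrite !derE ffunE sumrB. Qed.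

Lemma D_der X k f : D k (der X f) = der X (D k f) + \sum_i D k (X i) * D i f.
Proof.
rewrite !derE linear_sum -big_split; apply: eq_bigr => i _ /=.
by rewrite fps_derivM [D k (D i f)]fps_derivC addrC.
Qed.

Lemma der_bracket X Y f : der (vf_bracket X Y) f = der X (der Y f) - der Y (der X f).
Proof.
have E A B : der A (der B f) = \sum_i (der A (B i) * D i f + B i * der A (D i f)).
  by rewrite [der B f]derE linear_sum; apply: eq_bigr => i _ /=; rewrite derM.
rewrite derE !E !big_split /= opprD addrACA -sumrB [X in _ + X](_ : _ = 0) ?addr0.
  by apply: eq_bigr => i _; rewrite vf_bracketE mulrBl.
apply/eqP; rewrite subr_eq0; apply/eqP; under eq_bigr do rewrite derE mulr_sumr.
rewrite exchange_big; apply: eq_bigr => i _ /=; rewrite derE mulr_sumr.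
by apply: eq_bigr => j _; rewrite fps_derivC mulrCA.
Qed.

Lemma jacobi_vvv X Y Z :
  vf_bracket (vf_bracket X Y) Z =
  vf_bracket X (vf_bracket Y Z) - vf_bracket Y (vf_bracket X Z).
Proof.
apply/ffunP => j; rewrite [RHS]ffunE [(- _ : vfield K) j]ffunE !vf_bracketE !der_bracket !linearB /=.
ring.
Qed.

Lemma lie_derivE X w j k : lie_deriv X w (j, k) =
  der X (w (j, k)) + \sum_i (D j (X i) * w (i, k) + D k (X i) * w (j, i)).
Proof. by rewrite !derE ffunE -big_split /=; apply: eq_bigr => i _; rewrite addrA. Qed.

Lemma jacobi_vvf X Y w :
  lie_deriv (vf_bracket X Y) w =
  lie_deriv X (lie_deriv Y w) - lie_deriv Y (lie_deriv X w).
Proof.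
apply/ffunP => -[j k]; rewrite [RHS]ffunE [(- _ : form2 K) _]ffunE.
(* In L_U L_V w, [A] collects the second derivatives of V, [S] the derivatives of w, [Q] and [P] the
   products of first derivatives of U and V. The [S] terms and [P] are symmetric in U and V, so they
   cancel in the commutator; [A] and [Q] combine to the derivatives of [X, Y]. *)
pose A X Y := \sum_i (der X (D j (Y i)) * w (i, k) + der X (D k (Y i)) * w (j, i)).
pose S X Y := \sum_i (D j (Y i) * der X (w (i, k)) + D k (Y i) * der X (w (j, i))).
pose Q X Y := \sum_i \sum_a
  (D j (X i) * D i (Y a) * w (a, k) + D k (X i) * D i (Y a) * w (j, a)).
pose P X Y := \sum_i \sum_a
  (D j (X i) * D k (Y a) * w (i, a) + D k (X i) * D j (Y a) * w (a, i)).
have LL U V : lie_deriv U (lie_deriv V w) (j, k) =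
    der U (der V (w (j, k))) + A U V + (S U V + S V U) + (Q U V + P U V).
  rewrite lie_derivE [lie_deriv V w (j, k)]lie_derivE derD.
  rewrite der_sum -!addrA; congr (_ + _).
  rewrite /A /S /Q /P -!big_split /=; apply: eq_bigr => i _.
  rewrite derD !derM !lie_derivE !mulrDr !mulr_sumr.
  have lem (a b c d e f x y z t : fps 5 K) : x + y = z + t ->
      a + b + (c + d) + (e + x + (f + y)) = a + c + (b + d + (e + f + (z + t))).
    by move=> <-; ring.
  by apply: lem; rewrite -!big_split; apply: eq_bigr => a _ /=; ring.
have PC U V : P U V = P V U.
  rewrite /P exchange_big; apply: eq_bigr => i _; apply: eq_bigr => a _; ring.
rewrite !LL (PC Y X) lie_derivE der_bracket.
rewrite (_ : \sum_i _ = A X Y - A Y X + (Q X Y - Q Y X)); first by ring.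
rewrite /Q exchange_big [X in _ = _ + (_ - X)]exchange_big /A -!sumrB -big_split.
apply: eq_bigr => i _ /=; rewrite !vf_bracketE !linearB /= !D_der -sumrB.
rewrite sumrB !big_split /= -!mulr_suml; ring.
Qed.

Definition antisym2 w := forall j k, w (k, j) = - w (j, k).

Lemma antisym2_diag w j : antisym2 w -> w (j, j) = 0.
Proof.
move=> aw; apply: (@fps_muln_eq0 _ _ 1).
by rewrite mulr2n {2}aw subrr.
Qed.

Lemma antisym2_sort w : antisym2 w ->
  ((w (i2, i1) = - w (i1, i2)) * (w (i3, i1) = - w (i1, i3)) *
   (w (i4, i1) = - w (i1, i4)) * (w (i5, i1) = - w (i1, i5)) *
   (w (i3, i2) = - w (i2, i3)) * (w (i4, i2) = - w (i2, i4)) *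
   (w (i5, i2) = - w (i2, i5)) * (w (i4, i3) = - w (i3, i4)) *
   (w (i5, i3) = - w (i3, i5)) * (w (i5, i4) = - w (i4, i5)) *
   ((w (i1, i1) = 0) * (w (i2, i2) = 0) * (w (i3, i3) = 0) *
    (w (i4, i4) = 0) * (w (i5, i5) = 0)))%type.
Proof. by move=> aw; do !split; rewrite ?antisym2_diag //; apply: aw. Qed.

Lemma form_bracketDl v v' w i :
  form_bracket (v + v') w i = form_bracket v w i + form_bracket v' w i.
Proof.
rewrite !form_bracket_terms -big_split; apply: eq_bigr => q _ /=.
by rewrite ffunE mulrDl mulrzDl.
Qed.

Lemma form_bracketC v w : form_bracket v w = form_bracket w v.
Proof. by apply/ffunP; apply: ord5_ind; rewrite !form_bracketE; ring. Qed.

Lemma der_form_bracket X v w i : der X (form_bracket v w i) =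
  form_bracket [ffun jk => der X (v jk)] w i + form_bracket v [ffun jk => der X (w jk)] i.
Proof.
rewrite !form_bracket_terms linear_sum -big_split; apply: eq_bigr => q _ /=.
by rewrite !ffunE -mulrzDl -derM; apply: raddfMz.
Qed.

(** The bracket of 2-forms is the wedge product into 4-forms, identified with vector fields through
    the volume form, which a divergence free X preserves. By Leibniz the derivatives of v and w
    cancel; what is left is an algebraic identity in the D_i X_j, the invariance of the pairing
    under traceless matrices. *)
Lemma jacobi_vff X v w : divergence X = 0 -> antisym2 v -> antisym2 w ->
  vf_bracket X (form_bracket v w) =
  form_bracket (lie_deriv X v) w + form_bracket v (lie_deriv X w).
Proof.
rewrite /divergence sum5 => /eqP; rewrite addr_eq0 -eqr_oppLR eq_sym => /eqP div0 av aw.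
pose d u : form2 K := [ffun jk => der X (u jk)].
pose m u : form2 K := [ffun jk => \sum_i (D jk.1 (X i) * u (i, jk.2) + D jk.2 (X i) * u (jk.1, i))].
have lieE u : lie_deriv X u = d u + m u.
  by apply/ffunP => -[j k]; rewrite lie_derivE !ffunE.
have mE u : antisym2 u -> (
  (m u (i1, i2) = (D i1 (X i1) * u (i1, i2) + D i2 (X i2) * u (i1, i2)
     - D i1 (X i3) * u (i2, i3) + D i2 (X i3) * u (i1, i3) - D i1 (X i4) * u (i2, i4)
     + D i2 (X i4) * u (i1, i4) - D i1 (X i5) * u (i2, i5) + D i2 (X i5) * u (i1, i5))%R) *
  (m u (i1, i3) = (D i1 (X i1) * u (i1, i3) + D i1 (X i2) * u (i2, i3)
     + D i3 (X i2) * u (i1, i2) + D i3 (X i3) * u (i1, i3) - D i1 (X i4) * u (i3, i4)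
     + D i3 (X i4) * u (i1, i4) - D i1 (X i5) * u (i3, i5) + D i3 (X i5) * u (i1, i5))%R) *
  (m u (i1, i4) = (D i1 (X i1) * u (i1, i4) + D i1 (X i2) * u (i2, i4)
     + D i4 (X i2) * u (i1, i2) + D i1 (X i3) * u (i3, i4) + D i4 (X i3) * u (i1, i3)
     + D i4 (X i4) * u (i1, i4) - D i1 (X i5) * u (i4, i5) + D i4 (X i5) * u (i1, i5))%R) *
  (m u (i1, i5) = (D i1 (X i1) * u (i1, i5) + D i1 (X i2) * u (i2, i5)
     + D i5 (X i2) * u (i1, i2) + D i1 (X i3) * u (i3, i5) + D i5 (X i3) * u (i1, i3)
     + D i1 (X i4) * u (i4, i5) + D i5 (X i4) * u (i1, i4) + D i5 (X i5) * u (i1, i5))%R) *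
  (m u (i2, i3) = (D i2 (X i1) * u (i1, i3) - D i3 (X i1) * u (i1, i2)
     + D i2 (X i2) * u (i2, i3) + D i3 (X i3) * u (i2, i3) - D i2 (X i4) * u (i3, i4)
     + D i3 (X i4) * u (i2, i4) - D i2 (X i5) * u (i3, i5) + D i3 (X i5) * u (i2, i5))%R) *
  (m u (i2, i4) = (D i2 (X i1) * u (i1, i4) - D i4 (X i1) * u (i1, i2)
     + D i2 (X i2) * u (i2, i4) + D i2 (X i3) * u (i3, i4) + D i4 (X i3) * u (i2, i3)
     + D i4 (X i4) * u (i2, i4) - D i2 (X i5) * u (i4, i5) + D i4 (X i5) * u (i2, i5))%R) *
  (m u (i2, i5) = (D i2 (X i1) * u (i1, i5) - D i5 (X i1) * u (i1, i2)
     + D i2 (X i2) * u (i2, i5) + D i2 (X i3) * u (i3, i5) + D i5 (X i3) * u (i2, i3)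
     + D i2 (X i4) * u (i4, i5) + D i5 (X i4) * u (i2, i4) + D i5 (X i5) * u (i2, i5))%R) *
  (m u (i3, i4) = (D i3 (X i1) * u (i1, i4) - D i4 (X i1) * u (i1, i3)
     + D i3 (X i2) * u (i2, i4) - D i4 (X i2) * u (i2, i3) + D i3 (X i3) * u (i3, i4)
     + D i4 (X i4) * u (i3, i4) - D i3 (X i5) * u (i4, i5) + D i4 (X i5) * u (i3, i5))%R) *
  (m u (i3, i5) = (D i3 (X i1) * u (i1, i5) - D i5 (X i1) * u (i1, i3)
     + D i3 (X i2) * u (i2, i5) - D i5 (X i2) * u (i2, i3) + D i3 (X i3) * u (i3, i5)
     + D i3 (X i4) * u (i4, i5) + D i5 (X i4) * u (i3, i4) + D i5 (X i5) * u (i3, i5))%R) *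
  (m u (i4, i5) = (D i4 (X i1) * u (i1, i5) - D i5 (X i1) * u (i1, i4)
     + D i4 (X i2) * u (i2, i5) - D i5 (X i2) * u (i2, i4) + D i4 (X i3) * u (i3, i5)
     - D i5 (X i3) * u (i3, i4) + D i4 (X i4) * u (i4, i5) + D i5 (X i5) * u (i4, i5))%R))%type.
  by move=> /antisym2_sort Au; do !split; rewrite ffunE sum5 /= !Au; ring.
suff key i : - der (form_bracket v w) (X i) = form_bracket (m v) w i + form_bracket v (m w) i.
  apply/ffunP => i; rewrite [RHS]ffunE vf_bracketE key der_form_bracket -/(d v) -/(d w) !lieE.
  by rewrite ![form_bracket v _]form_bracketC !form_bracketDl addrACA.
have mv := mE v av; have mw := mE w aw; clearbody m.
move: i; apply: ord5_ind; rewrite derE sum5 !form_bracketE.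
all: rewrite !(mv, mw).
all: rewrite ?div0.
(* ring is much faster on variables than on these atoms. *)
all: clear m d lieE mE mv mw div0 av aw;
  repeat match goal with
  | |- context [fps_deriv ?i (fun_of_fin ?Y ?j)] => generalize (fps_deriv i (fun_of_fin Y j)); intro
  end.
all: repeat match goal with |- context [fun_of_fin ?u (?j, ?k)] => generalize (fun_of_fin u (j, k)); intro end.
all: ring.
Qed.

(** Cartan's formula L_Y w = d(i_Y w) + i_Y(dw) with dw = 0. *)
Lemma lie_deriv_closedE Y w j k : w \in @closed_form K ->
  lie_deriv Y w (j, k) = D j (\sum_i Y i * w (i, k)) - D k (\sum_i Y i * w (i, j)).
Proof.
case/closed_formP=> aw cw; rewrite ffunE !linear_sum /= -big_split; apply: eq_bigr => i _ /=.
rewrite !fps_derivM (aw i j).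
have -> : D i (w (j, k)) = - D j (w (k, i)) - D k (w (i, j)).
  by apply/eqP; rewrite -subr_eq0 opprD !opprK addrA cw.
by rewrite (aw i k) linearN /=; ring.
Qed.

(** The 6-form u ∧ v ∧ w is 0 in five variables. Contracting it with ∂_k gives the cyclic sum of u ∧
    v ∧ i_k w, and u ∧ v is the contraction of the volume form with [u, v]. *)
Lemma form_bracket_contract u v w k : antisym2 u -> antisym2 v -> antisym2 w ->
  \sum_i form_bracket u v i * w (i, k) + \sum_i form_bracket v w i * u (i, k) +
  \sum_i form_bracket w u i * v (i, k) = 0.
Proof.
move=> /antisym2_sort Au /antisym2_sort Av /antisym2_sort Aw.
by elim/ord5_ind: k; rewrite !sum5 !form_bracketE !(Au, Av, Aw); ring.
Qed.

Lemma jacobi_fff u v w :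
    u \in @closed_form K -> v \in @closed_form K -> w \in @closed_form K ->
  lie_deriv (form_bracket u v) w + lie_deriv (form_bracket v w) u +
  lie_deriv (form_bracket w u) v = 0.
Proof.
move=> cu cv cw; apply/ffunP => -[j k].
rewrite [(_ + _ : form2 K) _]ffunE [(_ + _ : form2 K) _]ffunE [RHS]ffunE.
have [[[au _] [av _]] [aw _]] := (closed_formP _ cu, closed_formP _ cv, closed_formP _ cw).
have re (a a' b b' c c' : fps 5 K) :
  a - a' + (b - b') + (c - c') = (a + b + c) - (a' + b' + c') by ring.
by rewrite !lie_deriv_closedE // re -!linearD /=;
   rewrite !form_bracket_contract // !linear0 addr0.
Qed.

Lemma vf_bracketC X Y : vf_bracket X Y = - vf_bracket Y X.
Proof. by apply/ffunP => j; rewrite [RHS]ffunE !vf_bracketE opprB. Qed.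


End Jacobi.

Section BracketLinearity.
Variable K : numFieldType.
Implicit Types (X Y : vfield K) (u v w : form2 K).

Lemma der_linearl c X Y f : der (c *: X + Y) f = c *: der X f + der Y f.
Proof.
rewrite !derE scaler_sumr -big_split; apply: eq_bigr => i _ /=.
by rewrite !ffunE mulrDl; congr (_ + _); rewrite mulrC fps_mulZr mulrC.
Qed.

Lemma vf_bracket_linear X : linear (vf_bracket X).
Proof.
move=> c Y Z; apply/ffunP => j; rewrite [RHS]ffunE [(_ *: _ : vfield K) j]ffunE !vf_bracketE.
by rewrite der_linearl !ffunE linearP scalerBr opprD addrACA; congr (_ + _).
Qed.

Lemma lie_deriv_linear X : linear (lie_deriv X).
Proof.
move=> c v w; apply/ffunP => jk; rewrite !ffunE scaler_sumr -big_split.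
apply: eq_bigr => i _; rewrite /= !ffunE !(linearP, mulrDr, fps_mulZr) !scalerDr /=.
ring.
Qed.

Lemma lie_deriv_linearl c X Y w :
  lie_deriv (c *: X + Y) w = c *: lie_deriv X w + lie_deriv Y w.
Proof.
apply/ffunP => jk; rewrite !ffunE scaler_sumr -big_split; apply: eq_bigr => i _.
rewrite /= !ffunE !linearP /= !mulrDl.
have Zl (f g : fps 5 K) : (c *: f) * g = c *: (f * g) by rewrite mulrC fps_mulZr mulrC.
by rewrite !Zl !scalerDr; ring.
Qed.

Lemma form_bracket_linear v : linear (form_bracket v).
Proof.
move=> c w w'; apply/ffunP => i; rewrite !ffunE scaler_sumr -big_split.
by apply: eq_bigr => s _; rewrite /= !ffunE !mulrDr !fps_mulZr.
Qed.

End BracketLinearity.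

(** * L as a superspace and its transposed adjoint action *)

Section Adjoint.
Variable K : numFieldType.
Implicit Types (X Y Z : L_even K) (u v w : L_odd K) (c : K).

Lemma even_bracket_linear X : linear (even_bracket X).
Proof. by move=> c Y Z; apply: val_inj; apply: vf_bracket_linear. Qed.

Lemma even_bracketC X Y : even_bracket X Y = - even_bracket Y X.
Proof. by apply: val_inj; apply: vf_bracketC. Qed.

Lemma even_bracket_linearl c X Y Z :
  even_bracket (c *: X + Y) Z = c *: even_bracket X Z + even_bracket Y Z.
Proof.
rewrite ![even_bracket _ Z]even_bracketC even_bracket_linear.
by rewrite opprD scalerN.
Qed.

Lemma even_odd_bracket_linear X : linear (even_odd_bracket X).
Proof. by move=> c v w; apply: val_inj; apply: lie_deriv_linear. Qed.

Lemma even_odd_bracket_linearl c X Y w :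
  even_odd_bracket (c *: X + Y) w = c *: even_odd_bracket X w + even_odd_bracket Y w.
Proof. by apply: val_inj; apply: lie_deriv_linearl. Qed.

Lemma odd_bracketC v w : odd_bracket v w = odd_bracket w v.
Proof. by apply: val_inj; apply: form_bracketC. Qed.

Lemma odd_bracket_linear v : linear (odd_bracket v).
Proof. by move=> c w w'; apply: val_inj; apply: form_bracket_linear. Qed.

Lemma odd_bracket_linearl c u v w :
  odd_bracket (c *: u + v) w = c *: odd_bracket u w + odd_bracket v w.
Proof. by rewrite ![odd_bracket _ w]odd_bracketC odd_bracket_linear. Qed.

HB.instance Definition _ X := GRing.isLinear.Build K _ _ _ (even_bracket X) (even_bracket_linear X).
HB.instance Definition _ X := GRing.isLinear.Build K _ _ _ (even_odd_bracket X) (even_odd_bracket_linear X).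
HB.instance Definition _ v := GRing.isLinear.Build K _ _ _ (odd_bracket v) (odd_bracket_linear v).

Lemma jacobi_eee X Y Z : even_bracket (even_bracket X Y) Z =
  even_bracket X (even_bracket Y Z) - even_bracket Y (even_bracket X Z).
Proof. by apply: val_inj; apply: jacobi_vvv. Qed.

Lemma jacobi_eeo X Y w : even_odd_bracket (even_bracket X Y) w =
  even_odd_bracket X (even_odd_bracket Y w) - even_odd_bracket Y (even_odd_bracket X w).
Proof. by apply: val_inj; apply: jacobi_vvf. Qed.

Lemma jacobi_eoo X v w : even_bracket X (odd_bracket v w) =
  odd_bracket (even_odd_bracket X v) w + odd_bracket v (even_odd_bracket X w).
Proof.
apply: val_inj; apply: jacobi_vff; first exact/eqP/(valP X).
  by have /closed_formP[] := valP v.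
by have /closed_formP[] := valP w.
Qed.

Lemma jacobi_ooo u v w : even_odd_bracket (odd_bracket u v) w +
  even_odd_bracket (odd_bracket v w) u + even_odd_bracket (odd_bracket w u) v = 0.
Proof. by apply: val_inj; apply: jacobi_fff; apply: valP. Qed.

Definition Lsuper : lmodType K := (L_even K * L_odd K)%type.
Implicit Types z : Lsuper.

Definition parity z : Lsuper := (z.1, - z.2).

(* The transposes of the adjoint action on the dual of L; the sign on the odd *)
(* part comes from the Koszul rule.                                           *)
Definition coad_even X z : Lsuper := (- even_bracket X z.1, - even_odd_bracket X z.2).
Definition coad_odd w z : Lsuper := (- odd_bracket w z.2, - even_odd_bracket z.1 w).

Lemma fst_linear c (x y : Lsuper) : (c *: x + y).1 = c *: x.1 + y.1. Proof. by []. Qed.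
Lemma snd_linear c (x y : Lsuper) : (c *: x + y).2 = c *: x.2 + y.2. Proof. by []. Qed.

Lemma fst_opp (x : Lsuper) : (- x).1 = - x.1. Proof. by []. Qed.
Lemma snd_opp (x : Lsuper) : (- x).2 = - x.2. Proof. by []. Qed.
Lemma fst_add (x y : Lsuper) : (x + y).1 = x.1 + y.1. Proof. by []. Qed.
Lemma snd_add (x y : Lsuper) : (x + y).2 = x.2 + y.2. Proof. by []. Qed.

Local Definition LsuperE :=
  (fst_linear, snd_linear, fst_opp, snd_opp, fst_add, snd_add).

Lemma Lsuper_eq (x y : Lsuper) : x.1 = y.1 -> x.2 = y.2 -> x = y.
Proof. by case: x y => [? ?] [? ?] /= -> ->. Qed.

Lemma parity_linear : linear parity.
Proof.
move=> c x y; apply: Lsuper_eq; rewrite !LsuperE // /parity /= ?LsuperE.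
by rewrite opprD scalerN.
Qed.

Lemma coad_even_linear X : linear (coad_even X).
Proof.
move=> c x y; apply: Lsuper_eq; rewrite !LsuperE /= ?LsuperE linearP opprD.
all: by rewrite scalerN.
Qed.

Lemma coad_odd_linear w : linear (coad_odd w).
Proof.
move=> c x y; apply: Lsuper_eq; rewrite !LsuperE /= ?LsuperE.
  by rewrite linearP opprD scalerN.
by rewrite even_odd_bracket_linearl opprD scalerN.
Qed.

Lemma coad_even_linearl c X Y z :
  coad_even (c *: X + Y) z = c *: coad_even X z + coad_even Y z.
Proof.
apply: Lsuper_eq; rewrite !LsuperE /=.
  by rewrite even_bracket_linearl opprD scalerN.
by rewrite even_odd_bracket_linearl opprD scalerN.
Qed.

Lemma coad_odd_linearl c v w z :
  coad_odd (c *: v + w) z = c *: coad_odd v z + coad_odd w z.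
Proof.
apply: Lsuper_eq; rewrite !LsuperE /=.
  by rewrite odd_bracket_linearl opprD scalerN.
by rewrite linearP opprD scalerN.
Qed.

Lemma even_bracketN X Y : even_bracket X (- Y) = - even_bracket X Y.
Proof. exact: linearN. Qed.
Lemma even_odd_bracketN X w : even_odd_bracket X (- w) = - even_odd_bracket X w.
Proof. exact: linearN. Qed.
Lemma odd_bracketN v w : odd_bracket v (- w) = - odd_bracket v w.
Proof. exact: linearN. Qed.
Lemma even_odd_bracketNl X w : even_odd_bracket (- X) w = - even_odd_bracket X w.
Proof.
have := even_odd_bracket_linearl (-1) X 0 w; rewrite addr0 !scaleN1r => ->.
have := even_odd_bracket_linearl (-1) 0 0 w; rewrite scaler0 addr0 scaleN1r addNr => ->.
by rewrite addr0.
Qed.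

Lemma parityK : involutive parity.
Proof. by move=> z; apply: Lsuper_eq; rewrite //= opprK. Qed.

Lemma parity_even X z : parity (coad_even X z) = coad_even X (parity z).
Proof. by apply: Lsuper_eq; rewrite //= even_odd_bracketN. Qed.

Lemma parity_odd w z : parity (coad_odd w z) = - coad_odd w (parity z).
Proof. by apply: Lsuper_eq; rewrite !LsuperE /= ?odd_bracketN ?opprK. Qed.

(** The composition order is opposite to that of a representation because these operators act on the
    arguments of functions; on the functions themselves they give a representation of L. *)
Lemma coad_even_even X Y z : coad_even Y (coad_even X z) =
  coad_even X (coad_even Y z) + coad_even (even_bracket X Y) z.
Proof.
apply: Lsuper_eq; rewrite !LsuperE /= ?even_bracketN ?even_odd_bracketN !opprK.
  by rewrite jacobi_eee opprB addrCA subrr addr0.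
by rewrite jacobi_eeo opprB addrCA subrr addr0.
Qed.

Lemma coad_even_odd X w z : coad_odd w (coad_even X z) =
  coad_even X (coad_odd w z) + coad_odd (even_odd_bracket X w) z.
Proof.
apply: Lsuper_eq; rewrite !LsuperE /= ?even_bracketN ?odd_bracketN ?even_odd_bracketN ?even_odd_bracketNl !opprK.
  by rewrite jacobi_eoo addrAC subrr add0r.
by rewrite jacobi_eeo.
Qed.

Lemma coad_odd_odd v w z : coad_odd w (coad_odd v z) =
  - coad_odd v (coad_odd w z) + coad_even (odd_bracket v w) z.
Proof.
apply: Lsuper_eq; rewrite !LsuperE /= ?even_bracketN ?odd_bracketN ?even_odd_bracketN ?even_odd_bracketNl !opprK.
  by rewrite even_bracketC opprK jacobi_eoo [RHS]addrC addrK odd_bracketC.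
have /eqP := jacobi_ooo v w z.2; rewrite addr_eq0 => /eqP sum0.
by rewrite (odd_bracketC v z.2); apply: oppr_inj; rewrite -sum0 opprD !opprK addrC.
Qed.

End Adjoint.

(** * The action of U(L) on multilinear functions *)

Section TensorAction.
Variables (R : comNzRingType) (V : lmodType R).
Implicit Types (f g : seq V -> R) (a b r s : V -> V).

Definition multilinear f := forall l t c x y,
  f (l ++ (c *: x + y) :: t) = c * f (l ++ x :: t) + f (l ++ y :: t).

(* The derivation of the tensor algebra induced by a, which passes through    *)
(* the later factors with the sign s, transposed.                             *)
Fixpoint tensor_act a s f (l : seq V) : R :=
  match l with
  | [::] => 0
  | x :: t => f (a x :: map s t) + tensor_act a s (fun t => f (x :: t)) t
  end.

Lemma multilinear_cons f x : multilinear f -> multilinear (fun t => f (x :: t)).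
Proof. by move=> fl l; apply: (fl (x :: l)). Qed.

Lemma multilinear_head f t c x y : multilinear f ->
  f ((c *: x + y) :: t) = c * f (x :: t) + f (y :: t).
Proof. by move=> fl; apply: (fl [::]). Qed.

Lemma tensor_act_linear a s c f g l :
  tensor_act a s (fun t => c * f t + g t) l =
  c * tensor_act a s f l + tensor_act a s g l.
Proof.
elim: l f g => [|x l IH] f g /=; first by rewrite mulr0 addr0.
by rewrite (IH (fun t => f (x :: t)) (fun t => g (x :: t))) mulrDr addrACA.
Qed.

Lemma eq_tensor_act a s f g l : f =1 g -> tensor_act a s f l = tensor_act a s g l.
Proof. by move/funext->. Qed.

Lemma multilinear_tensor_act a s f : linear a -> linear s ->
  multilinear f -> multilinear (tensor_act a s f).
Proof.
move=> al sl fl l; elim: l f fl => [|z l IH] f fl t c x y /=.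
  rewrite al multilinear_head // mulrDr addrACA; congr (_ + _).
  rewrite (eq_tensor_act _ _ _ (fun t => fl [::] t c x y)).
  exact: tensor_act_linear.
rewrite (IH (fun t => f (z :: t))); last exact: multilinear_cons.
rewrite !map_cat /= sl.
have /= -> := fl (a z :: map s l) (map s t) c (s x) (s y).
by rewrite mulrDr addrACA.
Qed.

Lemma multilinear_sign f e l t x : multilinear f -> 
  f (l ++ ((-1) ^+ e *: x) :: t) = (-1) ^+ e * f (l ++ x :: t).
Proof.
move=> fl; have := fl l t ((-1) ^+ e) x 0; rewrite addr0 => ->.
have := fl l t (-1) 0 0; rewrite scaler0 addr0 mulN1r addNr => ->.
by rewrite addr0.
Qed.

Lemma tensor_act_map a s r f e l : multilinear f ->
    (forall x, r (a x) = (-1) ^+ e *: a (r x)) -> (forall x, r (s x) = s (r x)) ->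
  tensor_act a s (fun t => f (map r t)) l = (-1) ^+ e * tensor_act a s f (map r l).
Proof.
move=> fl ra rs; elim: l f fl => [|x l IH] f fl /=; first by rewrite mulr0.
rewrite (IH (fun t => f (r x :: t))) ?mulrDr; last exact: multilinear_cons.
rewrite ra (multilinear_sign e [::]) //; congr (_ * f (_ :: _) + _).
by rewrite -!map_comp; apply: eq_map => y; apply: rs.
Qed.

(** Where a and b hit different factors, the two orders differ by the sign (-1)^e that arises when
    one operator crosses the twist of the other. Where they hit the same factor, the difference is
    c, followed by both twists on the later factors. *)
Lemma tensor_act_comm a s b r c e f l : multilinear f ->
    (forall x, b (a x) = (-1) ^+ e *: a (b x) + c x) ->
    (forall x, r (a x) = (-1) ^+ e *: a (r x)) ->
    (forall x, s (b x) = (-1) ^+ e *: b (s x)) ->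
    (forall x, r (s x) = s (r x)) ->
  tensor_act a s (tensor_act b r f) l =
  (-1) ^+ e * tensor_act b r (tensor_act a s f) l + tensor_act c (r \o s) f l.
Proof.
move=> fl ba ra sb rs; elim: l f fl => [|x l IH] f fl /=; first by rewrite mulr0 addr0.
have tD a' s' g h l' : tensor_act a' s' (fun t => g t + h t) l' =
    tensor_act a' s' g l' + tensor_act a' s' h l'.
  rewrite -[X in X + _]mul1r -tensor_act_linear.
  by apply: eq_tensor_act => t; rewrite mul1r.
rewrite !tD (IH (fun t => f (x :: t))); last exact: multilinear_cons.
have fb := multilinear_cons (b x) fl; have fa := multilinear_cons (a x) fl.
rewrite (@tensor_act_map a s r (fun t => f (b x :: t)) e) //.
rewrite (@tensor_act_map b r s (fun t => f (a x :: t)) e) //.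
rewrite -!map_comp (eq_map (f := s \o r) (g := r \o s)); last by move=> y; rewrite /= rs.
rewrite ba multilinear_head // !mulrDr !mulrA -expr2 sqrr_sign mul1r.
ring.
Qed.

End TensorAction.

Section DualTensorModule.
Variable K : numFieldType.
Local Notation L := (Lsuper K).
Implicit Types (f g : seq L -> K) (X : L_even K) (w : L_odd K) (u v : UL K).

Fixpoint uterm_act (s : uterm K) f : seq L -> K :=
  match s with
  | UEven X => tensor_act (coad_even X) id f
  | UOdd w => tensor_act (coad_odd w) (@parity K) f
  | UZero => fun=> 0
  | UOne => f
  | UAdd s t => fun l => uterm_act s f l + uterm_act t f l
  | UMul s t => uterm_act s (uterm_act t f)
  | UScale c s => fun l => c * uterm_act s f l
  end.

Lemma uterm_act_linear s c f g :
  uterm_act s (fun l => c * f l + g l) =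
  fun l => c * uterm_act s f l + uterm_act s g l.
Proof.
elim: s f g => [X|w|||s IHs t IHt|s IHs t IHt|d s IHs] f g /=; apply/funext => l.
- exact: tensor_act_linear.
- exact: tensor_act_linear.
- by rewrite mulr0 addr0.
- by [].
- by rewrite IHs IHt mulrDr addrACA.
- by rewrite IHt IHs.
- by rewrite IHs mulrDr mulrCA.
Qed.

Lemma uterm_actD s f g :
  uterm_act s (fun l => f l + g l) = fun l => uterm_act s f l + uterm_act s g l.
Proof.
have := uterm_act_linear s 1 f g; under eq_fun do rewrite mul1r.
by move->; apply/funext => l; rewrite mul1r.
Qed.

Lemma uterm_actZ s c f :
  uterm_act s (fun l => c * f l) = fun l => c * uterm_act s f l.
Proof.
have s0 : uterm_act s (fun=> 0) = fun=> 0.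
  have := uterm_act_linear s (-1) (fun=> 0) (fun=> 0).
  under eq_fun do rewrite mulr0 addr0.
  by move->; apply/funext => l; rewrite mulN1r addNr.
have := uterm_act_linear s c f (fun=> 0); under eq_fun do rewrite addr0.
by move->; apply/funext => l; rewrite s0 addr0.
Qed.

Lemma uterm_act_multilinear s f : multilinear f -> multilinear (uterm_act s f).
Proof.
elim: s f => [X|w|||s IHs t IHt|s IHs t IHt|d s IHs] f fl /=.
- by apply: multilinear_tensor_act => //; apply: coad_even_linear.
- by apply: multilinear_tensor_act => //; [apply: coad_odd_linear|apply: parity_linear].
- by move=> *; rewrite mulr0 addr0.
- by [].
- by move=> l t' c x y; rewrite (IHs _ fl) (IHt _ fl) mulrDr addrACA.
- exact/IHs/IHt.
- by move=> l t' c x y; rewrite (IHs _ fl) mulrDr mulrCA.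
Qed.

Lemma tensor_act_linearl a b (c : K) s d f l : multilinear f ->
    (forall x : L, d x = c *: a x + b x) ->
  tensor_act d s f l = c * tensor_act a s f l + tensor_act b s f l.
Proof.
move=> fl dE; elim: l f fl => [|x l IH] f fl /=; first by rewrite mulr0 addr0.
rewrite dE multilinear_head // (IH (fun t => f (x :: t))); last exact: multilinear_cons.
by rewrite mulrDr addrACA.
Qed.

(** The bracket relations of U(L) reduce by [tensor_act_comm] to the Jacobi identities on a single
    factor. For two odd elements the twists compose to the identity, as the even element [v, w]
    requires. *)
Lemma uterm_act_eq s t : uterm_eq s t ->
  forall f, multilinear f -> uterm_act s f = uterm_act t f.
Proof.
have sub1 (x : L) : x = (-1) ^+ false *: x by rewrite scale1r.
elim=> {s t} /= [s|s t _ IH|s t r _ IHs _ IHt|s s' t t' _ IHs _ IHt|s s' t t' _ IHs _ IHt|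
  c s s' _ IHs|s t r|s t|s|s|c d s|s|c s t|c d s|s t r|s|s|s t r|s t r|c s t|c s t|
  c X Y|c v w|X Y|X w|v w] f fl; try apply/funext => l.
- by [].
- by rewrite IH.
- by rewrite IHs ?IHt.
- by rewrite IHs ?IHt.
- by rewrite IHt // IHs //; apply: uterm_act_multilinear.
- by rewrite IHs.
- by rewrite addrA.
- by rewrite addrC.
- by rewrite add0r.
- by rewrite mulN1r addNr.
- by rewrite mulrA.
- by rewrite mul1r.
- by rewrite mulrDr.
- by rewrite mulrDl.
- by [].
- by [].
- by [].
- by [].
- by rewrite uterm_actD.
- by [].
- by rewrite uterm_actZ.
- by apply: tensor_act_linearl => // x; apply: coad_even_linearl.
- by apply: tensor_act_linearl => // x; apply: coad_odd_linearl.
- rewrite (tensor_act_comm (c := coad_even (even_bracket X Y)) (e := false)) ?mul1r //.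
  by move=> x; rewrite -sub1 coad_even_even.
- rewrite (tensor_act_comm (c := coad_odd (even_odd_bracket X w)) (e := false)) ?mul1r //.
  + by move=> x; rewrite -sub1 coad_even_odd.
  + by move=> x; rewrite -sub1 parity_even.
- rewrite (tensor_act_comm (c := coad_even (odd_bracket v w)) (e := true)) ?expr1 //.
  + congr (_ + _); congr tensor_act; apply/funext => x; exact: parityK.
  + by move=> x; rewrite scaleN1r coad_odd_odd.
  + by move=> x; rewrite scaleN1r parity_odd.
  + by move=> x; rewrite scaleN1r parity_odd.
Qed.

Definition U_act u f := uterm_act (generic_quotient.repr u) f.

Lemma U_act_upi s f : multilinear f -> U_act (upi s) f = uterm_act s f.
Proof. exact/uterm_act_eq/repr_upi. Qed.

Lemma U_act_linear u c f g :
  U_act u (fun l => c * f l + g l) = fun l => c * U_act u f l + U_act u g l.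
Proof. exact: uterm_act_linear. Qed.

Lemma U_act_multilinear u f : multilinear f -> multilinear (U_act u f).
Proof. exact: uterm_act_multilinear. Qed.

Lemma U_act_linearl c u v f : multilinear f ->
  U_act (c *: u + v) f = fun l => c * U_act u f l + U_act v f l.
Proof.
move=> fl; elim/upiW: u => s; elim/upiW: v => t.
by rewrite [_ *: _]uscaleE [_ + _]uaddE !U_act_upi.
Qed.

Lemma U_actM u v f : multilinear f -> U_act (u * v) f = U_act u (U_act v f).
Proof.
move=> fl; elim/upiW: u => s; elim/upiW: v => t.
by rewrite [_ * _]umulE !U_act_upi //; apply: uterm_act_multilinear.
Qed.

Lemma U_act1 f : multilinear f -> U_act 1 f = f.
Proof. by move=> fl; have := U_act_upi (UOne K) fl. Qed.

Lemma U_act_even X f : multilinear f ->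
  U_act (of_even X) f = tensor_act (coad_even X) id f.
Proof. by move=> fl; rewrite U_act_upi. Qed.

Lemma U_act_odd w f : multilinear f ->
  U_act (of_odd w) f = tensor_act (coad_odd w) (@parity K) f.
Proof. by move=> fl; rewrite U_act_upi. Qed.

End DualTensorModule.

(** * Universal property of Verma modules *)

Section VermaModuleTheory.
Variables (K : numFieldType) (V : g0_module K).
Implicit Types (u : UL K) (v : V) (m : Verma V).

HB.instance Definition _ u := GRing.isLinear.Build K (Verma V) (Verma V) _
  (@Verma_act K V u) (Verma_act_linear u).

Fact tens_linear u : linear (@tens K V u).
Proof. by move=> c v v'; apply: tens_linearr. Qed.

HB.instance Definition _ u := GRing.isLinear.Build K V (Verma V) _
  (@tens K V u) (tens_linear u).

Fact tens_linearL v : linear ((@tens K V)^~ v).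
Proof. by move=> c u u'; apply: tens_linearl. Qed.

Definition tens_l v u := @tens K V u v.
HB.instance Definition _ v := GRing.isLinear.Build K (UL K) (Verma V) _
  (tens_l v) (tens_linearL v).

Lemma tensDl u u' v : tens (u + u') v = tens u v + tens u' v.
Proof. exact: (linearD (tens_l v)). Qed.
Lemma tensZl c u v : tens (c *: u) v = c *: tens u v.
Proof. exact: (linearZ_LR (tens_l v)). Qed.
Lemma tensNl u v : tens (- u) v = - tens u v.
Proof. exact: (linearN (tens_l v)). Qed.
Lemma tens0l v : tens 0 v = 0 :> Verma V.
Proof. exact: (linear0 (tens_l v)). Qed.
Lemma tens_suml (I : Type) (r : seq I) (P : pred I) (F : I -> UL K) v :
  tens (\sum_(i <- r | P i) F i) v = \sum_(i <- r | P i) tens (F i) v.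
Proof. exact: (linear_sum (tens_l v)). Qed.

Lemma Verma_ind (P : Verma V -> Prop) :
    (forall u v, P (tens u v)) -> (forall c m n, P m -> P n -> P (c *: m + n)) ->
  forall m, P m.
Proof.
move=> Pt Pl; have P0 : P 0 by rewrite -(tens0l 0); apply: Pt.
elim/vpiW; elim=> [u v||s Ps t Pt'|c s Ps].
- exact: Pt.
- exact: P0.
- by rewrite -vaddE -[vpi s]scale1r; apply: Pl.
- by rewrite -vscaleE -[vscale _ _]addr0; apply: Pl.
Qed.

Lemma Verma_actM u u' m : Verma_act (u * u') m = Verma_act u (Verma_act u' m).
Proof.
elim/Verma_ind: m => [x v|c m n IHm IHn]; first by rewrite !Verma_act_tens mulrA.
by rewrite !linearP /= IHm IHn.
Qed.

Lemma Verma_act_linearl c u u' m :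
  Verma_act (c *: u + u') m = c *: Verma_act u m + Verma_act u' m.
Proof.
elim/Verma_ind: m => [x v|d m n IHm IHn].
  by rewrite !Verma_act_tens mulrDl -scalerAl tens_linearl.
rewrite !linearP /= IHm IHn !scalerDr !scalerA mulrC -!addrA; congr (_ + _).
by rewrite addrCA.
Qed.

Lemma Verma_actZl c u m : Verma_act (c *: u) m = c *: Verma_act u m.
Proof.
elim/Verma_ind: m => [x v|d m n IHm IHn]; first by rewrite !Verma_act_tens -scalerAl tensZl.
by rewrite !(linearP (Verma_act _)) /= IHm IHn scalerDr !scalerA mulrC.
Qed.

Section Lift.
Variables (M : lmodType K) (T : UL K -> V -> M).
Hypothesis T_linearl : forall c u u' v, T (c *: u + u') v = c *: T u v + T u' v.
Hypothesis T_linearr : forall u, linear (T u).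
Hypothesis T_even : forall u X v, even_degs (>= 0) X ->
  T (u * of_even X) v = T u (g0_act (linear_part X) v).
Hypothesis T_odd : forall u w v, odd_degs (>= 0) w -> T (u * of_odd w) v = 0.

Fixpoint vterm_lift (s : vterm V) : M :=
  match s with
  | VTens u v => T u v
  | VZero => 0
  | VAdd s t => vterm_lift s + vterm_lift t
  | VScale c s => c *: vterm_lift s
  end.

Lemma vterm_lift_eq s t : vterm_eq s t -> vterm_lift s = vterm_lift t.
Proof.
elim=> {s t} //=.
- by move=> s t r _ -> _ ->.
- by move=> s s' t t' _ -> _ ->.
- by move=> c s s' _ ->.
- by move=> *; rewrite addrA.
- by move=> *; rewrite addrC.
- by move=> *; rewrite add0r.
- by move=> *; rewrite scaleN1r addNr.
- by move=> *; rewrite scalerA.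
- by move=> *; rewrite scale1r.
- by move=> *; rewrite scalerDr.
- by move=> *; rewrite scalerDl.
- by move=> *; apply: T_linearr.
Qed.

Definition Verma_lift m : M := vterm_lift (generic_quotient.repr m).

Lemma Verma_lift_vpi s : Verma_lift (vpi s) = vterm_lift s.
Proof. exact/vterm_lift_eq/repr_vpi. Qed.

Lemma Verma_lift_tens u v : Verma_lift (tens u v) = T u v.
Proof. exact: Verma_lift_vpi. Qed.

Lemma Verma_lift_linear : linear Verma_lift.
Proof.
move=> c; elim/vpiW => s; elim/vpiW => t.
by rewrite [_ *: _]vscaleE [_ + _]vaddE !Verma_lift_vpi.
Qed.

End Lift.
End VermaModuleTheory.

Section VermaMorphisms.
Variable K : numFieldType.

(** Frobenius reciprocity: u ⊗ a -> u Theta(a) is balanced over U(L_0) because [Theta] is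
    L_0-equivariant. *)
Lemma Verma_morphism (A B : g0_module K) (Theta : A -> Verma B) :
    linear Theta ->
    (forall X a, even_degs (>= 0) X ->
       Verma_act (of_even X) (Theta a) = Theta (g0_act (linear_part X) a)) ->
    (forall w a, odd_degs (>= 0) w -> Verma_act (of_odd w) (Theta a) = 0) ->
  exists phi : Verma A -> Verma B,
    L_morphism phi /\ forall u a, phi (tens u a) = Verma_act u (Theta a).
Proof.
move=> ThL ThE ThO; pose T u a := Verma_act u (Theta a).
have Tl c u u' v : T (c *: u + u') v = c *: T u v + T u' v by apply: Verma_act_linearl.
have Tr u : linear (T u) by move=> c a b; rewrite /T ThL linearP.
have Te u X v : even_degs (>= 0) X -> T (u * of_even X) v = T u (g0_act (linear_part X) v).
  by move=> X0; rewrite /T Verma_actM ThE.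
have To u w v : odd_degs (>= 0) w -> T (u * of_odd w) v = 0.
  by move=> w0; rewrite /T Verma_actM ThO // linear0.
have tE := Verma_lift_tens Tl Tr Te To; have lL := Verma_lift_linear Tl Tr Te To.
have actE u m : Verma_lift T (Verma_act u m) = Verma_act u (Verma_lift T m).
  elim/Verma_ind: m => [x v|c m n IHm IHn]; first by rewrite Verma_act_tens !tE -Verma_actM.
  by rewrite linearP /= !lL IHm IHn linearP.
by exists (Verma_lift T).
Qed.

Lemma L_morphism_comp (A B C : g0_module K) (phi : Verma A -> Verma B)
    (psi : Verma B -> Verma C) :
  L_morphism phi -> L_morphism psi -> L_morphism (psi \o phi).
Proof.
move=> [phiL phiE phiO] [psiL psiE psiO]; split=> [c m n|X m|w m] /=.
- by rewrite phiL psiL.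
- by rewrite phiE psiE.
- by rewrite phiO psiO.
Qed.

End VermaMorphisms.

(** * Formal integer combinations and a test for zero *)

Section IntegerCombinations.
Variables (K : numFieldType) (M : lmodType K).

(** A list of pairs (c, x) is a formal integer combination of keys x, and [den] is the vector a key
    denotes. The computations run on such lists, and [lc] carries their results to modules over
    K. *)
Definition lc (T : Type) (den : T -> M) (l : seq (int * T)) : M :=
  \sum_(t <- l) t.1%:~R *: den t.2.

Definition lbind (T U : Type) (l : seq (int * T)) (f : T -> seq (int * U)) :=
  flatten [seq [seq (t.1 * s.1, s.2) | s <- f t.2] | t <- l].

Lemma lc_nil (T : Type) (den : T -> M) : lc den [::] = 0.
Proof. exact: big_nil. Qed.

Lemma lc_cons (T : Type) (den : T -> M) c x l : lc den ((c, x) :: l) = c%:~R *: den x + lc den l.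
Proof. exact: big_cons. Qed.

Lemma lc_cat (T : Type) (den : T -> M) l1 l2 : lc den (l1 ++ l2) = lc den l1 + lc den l2.
Proof. exact: big_cat. Qed.

Lemma lc_seq1 (T : Type) (den : T -> M) c x : lc den [:: (c, x)] = c%:~R *: den x.
Proof. by rewrite lc_cons lc_nil addr0. Qed.

Lemma lc_bind (T U : Type) (den : U -> M) (l : seq (int * T)) f :
  lc den (lbind l f) = lc (fun x => lc den (f x)) l.
Proof.
rewrite /lc big_flatten big_map; apply: eq_bigr => t _ /=.
by rewrite big_map scaler_sumr; apply: eq_bigr => s _ /=; rewrite scalerA -intrM.
Qed.

Lemma lc_map (T U : Type) (den : U -> M) (c : T -> int) (f : T -> U) r :
  lc den [seq (c x, f x) | x <- r] = \sum_(x <- r) (c x)%:~R *: den (f x).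
Proof. by rewrite /lc big_map. Qed.

Lemma lc_filter0 (T : Type) (den : T -> M) l : lc den [seq t <- l | t.1 != 0] = lc den l.
Proof.
rewrite /lc big_filter [RHS](bigID (fun t => t.1 == 0)) /= [X in _ = X + _]big1 ?add0r //.
by move=> t /eqP->; rewrite scale0r.
Qed.

Lemma eq_lc (T : eqType) (den den' : T -> M) (l : seq (int * T)) (P : pred T) :
    (forall x, P x -> den x = den' x) -> all (fun t => P t.2) l ->
  lc den l = lc den' l.
Proof.
move=> e /allP Pl; rewrite /lc big_seq_cond [RHS]big_seq_cond.
by apply: eq_bigr => t /andP[/Pl/e-> _].
Qed.

Lemma eq_lcT (T : Type) (den den' : T -> M) l : den =1 den' -> lc den l = lc den' l.
Proof. by move=> e; apply: eq_bigr => t _; rewrite e. Qed.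

Lemma lcD (T : Type) (den den' : T -> M) l :
  lc den l + lc den' l = lc (fun x => den x + den' x) l.
Proof. by rewrite /lc -big_split; apply: eq_bigr => t _; rewrite scalerDr. Qed.

Lemma lc_sum (T I : Type) (r : seq I) (P : pred I) (den : I -> T -> M) l :
  \sum_(i <- r | P i) lc (den i) l = lc (fun x => \sum_(i <- r | P i) den i x) l.
Proof. by rewrite /lc exchange_big; apply: eq_bigr => t _; rewrite scaler_sumr. Qed.

Lemma lcZ (T : Type) a (den : T -> M) l : a *: lc den l = lc (fun x => a *: den x) l.
Proof.
rewrite /lc scaler_sumr; apply: eq_bigr => t _; rewrite !scalerA mulrC //.
Qed.

End IntegerCombinations.

Lemma lc_linear (K : numFieldType) (M N : lmodType K) (f : {linear M -> N}) T (den : T -> M) l :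
  f (lc den l) = lc (fun x => f (den x)) l.
Proof. by rewrite /lc linear_sum; apply: eq_bigr => t _ /=; rewrite linearZ. Qed.

Section ZeroTest.
Variables (T : eqType) (le : rel T).

Fixpoint zero_runs (k : T) (a : int) (l : seq (int * T)) : bool :=
  match l with
  | [::] => a == 0
  | (c, x) :: l => if x == k then zero_runs k (a + c) l else (a == 0) && zero_runs x c l
  end.

Definition zero_sum (l : seq (int * T)) :=
  if sort (fun t s => le t.2 s.2) l is (c, x) :: l then zero_runs x c l else true.

(** Sorting permutes the terms, and each run of adjacent equal keys contributes one vector times the
    sum of its coefficients, which the test found to be 0. *)
Lemma zero_sumP (K : numFieldType) (M : lmodType K) (den : T -> M) l :
  zero_sum l -> lc den l = 0.
Proof.
rewrite /zero_sum /lc -(perm_big _ (permEl (perm_sort (fun t s => le t.2 s.2) l))) /= -/(lc den _).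
case: sort => [|[c x] {}l]; first by rewrite lc_nil.
rewrite lc_cons; elim: l x c => [|[c x] l IH] k a /=.
  by move/eqP->; rewrite scale0r lc_nil addr0.
rewrite lc_cons; case: eqP => [->|_] => [/IH|/andP[/eqP-> /IH->]].
  by rewrite intrD scalerDl addrA.
by rewrite scale0r addr0.
Qed.
End ZeroTest.

(** Symbolic indices are the naturals 0, ..., 4, which compute well; any other natural is sent to
    index 0. *)
Definition o5 (n : nat) : 'I_5 := inord n.

Lemma o5K n : (n < 5)%N -> o5 n = n :> nat. Proof. exact: inordK. Qed.

Lemma sum_o5 (V : nmodType) (F : 'I_5 -> V) : \sum_i F i = \sum_(n <- iota 0 5) F (o5 n).
Proof.
rewrite -[iota 0 5]/(index_iota 0 5) big_mkord; apply: eq_bigr => i _.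
by rewrite /o5 inord_val.
Qed.

Lemma lc_flatten5 (K : numFieldType) (M : lmodType K) (T : Type) (den : T -> M) H :
  lc den (flatten [seq H n | n <- iota 0 5]) = \sum_(a < 5) lc den (H a).
Proof. by rewrite /= cats0 !lc_cat sum_o5 !big_cons big_nil addr0 !o5K. Qed.

(** * Symbolic action of L_0 on words in the d_ij *)

(* The jet (J, s) stands for the partial derivative along the multi-index J   *)
(* of the component s of an undetermined vector field or 2-form; components   *)
(* e of vector fields are encoded as pairs (e, _).                            *)
Definition jet := (seq nat * (nat * nat))%type.

Fixpoint insn (x : nat) (s : seq nat) : seq nat :=
  if s is y :: t then (if (x <= y)%N then x :: s else y :: insn x t) else [:: x].

Definition wfd (d : nat * nat) := ((d.1 < d.2) && (d.2 < 5))%N.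

Definition sort_d (x : jet) (k l : nat) : seq (int * (jet * (nat * nat))) :=
  if (k < l)%N then [:: (1, (x, (k, l)))]
  else if (l < k)%N then [:: (-1, (x, (l, k)))] else [::].

(** L_Y(dx_i ∧ dx_j) = dY_i ∧ dx_j + dx_i ∧ dY_j. A term (c, (x, e)) of [F] stands for c times the
    jet x times ∂_e, and [form_d] reads its terms (c, (x, (k, l))) in the same way with d_kl. *)
Definition field_d (F : seq (int * (jet * nat))) (d : nat * nat) :=
  lbind F (fun x : jet * nat =>
    (if x.2 == d.1 then flatten [seq sort_d (insn k x.1.1, x.1.2) k d.2 | k <- iota 0 5] else [::])
    ++ (if x.2 == d.2 then flatten [seq sort_d (insn k x.1.1, x.1.2) d.1 k | k <- iota 0 5] else [::])).

Definition form_d (W : seq (int * (jet * (nat * nat)))) (d : nat * nat) :=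
  lbind W (fun x : jet * (nat * nat) =>
    [seq t <- [seq (eps e x.2.1 x.2.2 d.1 d.2, (x.1, e)) | e <- iota 0 5] | t.1 != 0]).

Lemma lbind_all (T U : Type) (P : pred U) (l : seq (int * T)) (f : T -> seq (int * U)) :
  (forall x, all (fun t => P t.2) (f x)) -> all (fun t => P t.2) (lbind l f).
Proof. by move=> Pf; rewrite /lbind; elim: l => //= t l IH; rewrite all_cat IH andbT all_map. Qed.

Lemma form_d_wf W d : all (fun t => t.2.2 < 5)%N (form_d W d).
Proof.
apply: (lbind_all (P := fun x : jet * nat => x.2 < 5)%N) => x.
rewrite all_filter all_map; apply/allP => e; rewrite mem_iota => /andP[_ lt_e] /=.
by apply/implyP.
Qed.

Lemma sort_d_wf x k l : (k < 5)%N -> (l < 5)%N -> all (fun t => wfd t.2.2) (sort_d x k l).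
Proof. by move=> lk ll; rewrite /sort_d; case: ltngtP => //= lt; rewrite /wfd /= lt /= ?lk ?ll. Qed.

Lemma field_d_wf F d : wfd d -> all (fun t => wfd t.2.2) (field_d F d).
Proof.
case/andP=> lt12 lt2; have lt1 := ltn_trans lt12 lt2.
apply: (lbind_all (P := fun x : jet * (nat * nat) => wfd x.2)) => x; rewrite all_cat.
by case: (_ == _); case: (_ == _); rewrite /= ?all_cat ?sort_d_wf.
Qed.

Section Jets.
Variable K : numFieldType.
Local Notation D := (@fps_deriv 5 K).
Variable S : nat * nat -> fps 5 K.

Definition jetD (x : jet) : fps 5 K := foldr (fun i f => D (o5 i) f) (S x.2) x.1.

Lemma jetD_insn k J s : jetD (insn k J, s) = D (o5 k) (jetD (J, s)).
Proof.
elim: J => [|j J IH] //=; case: leqP => // _.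
by rewrite /jetD /= in IH *; rewrite IH fps_derivC.
Qed.

Definition dsgn (d : nat * nat) (kl : 'I_5 * 'I_5) : int :=
  (kl == (o5 d.1, o5 d.2))%:Z - (kl == (o5 d.2, o5 d.1))%:Z.

Definition den_field (e : 'I_5) (x : jet * nat) : fps 5 K :=
  if o5 x.2 == e then jetD x.1 else 0.
Definition den_form (kl : 'I_5 * 'I_5) (x : jet * (nat * nat)) : fps 5 K :=
  (dsgn x.2 kl)%:~R *: jetD x.1.

Lemma lc_sort_d kl x k l : lc (den_form kl) (sort_d x k l) = (dsgn (k, l) kl)%:~R *: jetD x.
Proof.
rewrite /sort_d; case: ltngtP => [_|_|->].
- by rewrite lc_seq1 scale1r.
- by rewrite lc_seq1 /den_form /= scalerA -intrM mulN1r /dsgn opprB.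
- by rewrite lc_nil /dsgn subrr scale0r.
Qed.

Lemma mul_fps_const (f : fps 5 K) c : f * fps_const 5 c = c *: f.
Proof.
have -> : fps_const 5 c = (c *: (1 : fps 5 K) : fps 5 K) by apply: fpsP => m; rewrite /= mulrnAr mulr1.
by rewrite fps_mulZr mulr1.
Qed.

Lemma sum_pick (V : lmodType K) (F : 'I_5 -> V) i (b : bool) :
  \sum_a ((a == i) && b)%:R *: F a = F i *+ b.
Proof.
rewrite (bigD1 i) //= eqxx scaler_nat big1 ?addr0 // => a /negPf->.
by rewrite scale0r.
Qed.

Lemma lie_deriv_dform (Y : vfield K) (i j k l : 'I_5) :
  lie_deriv Y (dform K i j) (k, l) =
  D k (Y i) *+ (l == j) - D k (Y j) *+ (l == i) + D l (Y j) *+ (k == i) - D l (Y i) *+ (k == j).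
Proof.
rewrite ffunE.
transitivity (\sum_a (((a == i) && (l == j))%:R *: D k (Y a) - ((a == j) && (l == i))%:R *: D k (Y a)
   + (((a == j) && (k == i))%:R *: D l (Y a) - ((a == i) && (k == j))%:R *: D l (Y a)))).
  apply: eq_bigr => a _; rewrite !ffunE fps_deriv_const mulr0 add0r !mul_fps_const !scalerBl !xpair_eqE.
  by rewrite [(k == i) && _]andbC [(k == j) && _]andbC.
by rewrite big_split /= !sumrB !sum_pick addrA.
Qed.

Lemma field_dE (F : seq (int * (jet * nat))) (Y : vfield K) d kl :
    (forall e, Y e = lc (den_field e) F) -> (d.1 < 5)%N -> (d.2 < 5)%N ->
    all (fun t => t.2.2 < 5)%N F ->
  lie_deriv Y (dform K (o5 d.1) (o5 d.2)) kl = lc (den_form kl) (field_d F d).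
Proof.
case: kl d => k l [i j] /= YE lt_i lt_j wfF.
have DY (a b : 'I_5) (c : bool) : D a (Y b) *+ c = lc (fun x => D a (den_field b x) *+ c) F.
  by rewrite YE lc_linear; case: c => //; rewrite mulr0n /lc big1 // => t _; rewrite scaler0.
have DN (a b : 'I_5) (c : bool) : - (D a (Y b) *+ c) = lc (fun x => - (D a (den_field b x) *+ c)) F.
  by rewrite DY /lc -sumrN; apply: eq_bigr => t _; rewrite scalerN.
rewrite lie_deriv_dform DY DN DY DN !lcD lc_bind.
apply: (eq_lc (P := fun x => x.2 < 5)%N) wfF => -[[J s] e]; cbn [fst snd] => lt_e.
have o5_eq a b : (a < 5)%N -> (b < 5)%N -> (o5 a == o5 b) = (a == b).
  by move=> la lb; rewrite -val_eqE /= !o5K.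
rewrite lc_cat /den_field; cbn [fst snd]; rewrite !o5_eq //.
have sumL (g : 'I_5 -> fps 5 K) : \sum_(a < 5) (dsgn (a : nat, j) (k, l))%:~R *: g a =
    g k *+ (l == o5 j) - g l *+ (k == o5 j).
  rewrite -!sum_pick -sumrB; apply: eq_bigr => a _.
  rewrite -scalerBl /dsgn /= !xpair_eqE /o5 inord_val intrB.
  by rewrite ![_ == a]eq_sym [(k == _) && _]andbC.
have sumR (g : 'I_5 -> fps 5 K) : \sum_(a < 5) (dsgn (i, a : nat) (k, l))%:~R *: g a =
    g l *+ (k == o5 i) - g k *+ (l == o5 i).
  rewrite -!sum_pick -sumrB; apply: eq_bigr => a _.
  rewrite -scalerBl /dsgn /= !xpair_eqE /o5 inord_val intrB.
  by rewrite ![_ == a]eq_sym [(k == _) && _]andbC.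
have sJ (a : 'I_5) : jetD (insn a J, s) = D a (jetD (J, s)).
  by rewrite jetD_insn /o5 inord_val.
have eL : \sum_(a < 5) lc (den_form (k, l)) (sort_d (insn a J, s) a j) =
    D k (jetD (J, s)) *+ (l == o5 j) - D l (jetD (J, s)) *+ (k == o5 j).
  by rewrite -(sumL (fun a => D a (jetD (J, s)))); apply: eq_bigr => a _; rewrite lc_sort_d sJ.
have eR : \sum_(a < 5) lc (den_form (k, l)) (sort_d (insn a J, s) i a) =
    D l (jetD (J, s)) *+ (k == o5 i) - D k (jetD (J, s)) *+ (l == o5 i).
  by rewrite -(sumR (fun a => D a (jetD (J, s)))); apply: eq_bigr => a _; rewrite lc_sort_d sJ.
have D0 a : D a 0 = 0 by exact: linear0.
case: (e == i); case: (e == j); cbn match.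
all: rewrite ?lc_nil ?lc_flatten5 ?eL ?eR ?D0 ?mul0rn; first [exact: lt_e | ring].
Qed.

Lemma form_bracket_dform (w : form2 K) (d : nat * nat) (e : 'I_5) : wfd d ->
  form_bracket w (dform K (o5 d.1) (o5 d.2)) e =
  \sum_(kl : 'I_5 * 'I_5 | (kl.1 < kl.2)%N) w kl *~ eps e kl.1 kl.2 d.1 d.2.
Proof.
case/andP=> lt12 lt2; have lt1 := ltn_trans lt12 lt2.
rewrite form_bracket_eps; apply: eq_bigr => kl _.
rewrite (bigD1 (o5 d.1, o5 d.2)) /=; last by rewrite !o5K.
rewrite big1 ?addr0 => [|[l m] /andP[/= lt_lm ne]].
  rewrite ffunE eqxx !o5K // xpair_eqE -!val_eqE /= !o5K // [d.2 == _]eq_sym.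
  by rewrite (ltn_eqF lt12) andbF subr0 mul_fps_const scale1r.
rewrite ffunE (negPf ne) (_ : ((l, m) == _) = false) ?subrr ?mul_fps_const ?scale0r ?mul0rz //.
apply: contraTF lt_lm; rewrite xpair_eqE => /andP[/eqP-> /eqP->].
by rewrite !o5K // -leqNgt ltnW.
Qed.

Lemma sum_wfd (M : lmodType K) (F : 'I_5 * 'I_5 -> M) d : wfd d ->
  \sum_(kl : 'I_5 * 'I_5 | (kl.1 < kl.2)%N) (dsgn d kl)%:~R *: F kl = F (o5 d.1, o5 d.2).
Proof.
case/andP=> lt12 lt2; have lt1 := ltn_trans lt12 lt2.
rewrite (bigD1 (o5 d.1, o5 d.2)) /=; last by rewrite !o5K.
have neq : ((o5 d.1, o5 d.2) == (o5 d.2, o5 d.1)) = false.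
  by rewrite xpair_eqE -!val_eqE /= !o5K // (ltn_eqF lt12).
rewrite /dsgn eqxx neq scale1r big1 ?addr0 // => -[k l] /andP[/= lt_kl /negPf->].
rewrite (_ : (_ == _) = false) ?scale0r //.
apply: contraTF lt_kl; rewrite xpair_eqE => /andP[/eqP-> /eqP->].
by rewrite !o5K // -leqNgt ltnW.
Qed.

Lemma form_dE (W : seq (int * (jet * (nat * nat)))) (w : form2 K) d e :
    (forall kl, w kl = lc (den_form kl) W) -> wfd d -> all (fun t => wfd t.2.2) W ->
  form_bracket w (dform K (o5 d.1) (o5 d.2)) e = lc (den_field e) (form_d W d).
Proof.
move=> wE wf_d wfW; rewrite form_bracket_dform //.
transitivity (\sum_(kl : 'I_5 * 'I_5 | (kl.1 < kl.2)%N)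
    lc (fun x => den_form kl x *~ eps e kl.1 kl.2 d.1 d.2) W).
  by apply: eq_bigr => kl _; rewrite wE /lc mulrz_suml; apply: eq_bigr => t _; rewrite scalerMzr.
rewrite lc_sum lc_bind; apply: (eq_lc (P := fun x => wfd x.2)) wfW => -[[J s] d'] wf_d'.
under eq_bigr do rewrite /den_form scalerMzr.
rewrite (sum_wfd (fun kl => jetD (J, s) *~ eps e kl.1 kl.2 d.1 d.2)) //.
have /andP[lt12 lt2] := wf_d'; have lt1 := ltn_trans lt12 lt2.
rewrite lc_filter0 lc_map; cbn [fst snd]; rewrite !o5K //.
transitivity (\sum_(a < 5) (eps a d'.1 d'.2 d.1 d.2)%:~R *: den_field e ((J, s), a : nat)).
  rewrite (bigD1 e) //= big1 ?addr0 => [|a /negPf ne_a]; rewrite /den_field /= /o5 inord_val.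
    by rewrite eqxx scaler_int.
  by rewrite ne_a scaler0.
rewrite sum_o5; apply: eq_big_seq => a; rewrite mem_iota => /andP[_ lt_a].
by rewrite o5K.
Qed.
End Jets.

(** * Constant and linear terms of elements of L *)

Section Constants.
Variable K : numFieldType.

Lemma of_even_linear c (X Y : L_even K) :
  of_even (c *: X + Y) = c *: of_even X + of_even Y.
Proof. by rewrite [c *: of_even _]uscaleE [RHS]uaddE; apply/upiP/ueq_even. Qed.

Lemma of_odd_linear c (v w : L_odd K) :
  of_odd (c *: v + w) = c *: of_odd v + of_odd w.
Proof. by rewrite [c *: of_odd _]uscaleE [RHS]uaddE; apply/upiP/ueq_odd. Qed.

HB.instance Definition _ := GRing.isLinear.Build K (L_even K) (UL K) _ (@of_even K) of_even_linear.
HB.instance Definition _ := GRing.isLinear.Build K (L_odd K) (UL K) _ (@of_odd K) of_odd_linear.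

Lemma evenD (X Y : L_even K) e m : (X + Y) e m = X e m + Y e m.
Proof. by rewrite /= ffunE. Qed.
Lemma evenN (X : L_even K) e m : (- X) e m = - X e m.
Proof. by rewrite /= ffunE. Qed.
Lemma evenZ c (X : L_even K) e m : (c *: X) e m = c * X e m.
Proof. by rewrite /= ffunE. Qed.
Lemma oddD (v w : L_odd K) e m : (v + w) e m = v e m + w e m.
Proof. by rewrite /= ffunE. Qed.
Lemma oddN (w : L_odd K) e m : (- w) e m = - w e m.
Proof. by rewrite /= ffunE. Qed.
Lemma oddZ c (w : L_odd K) e m : (c *: w) e m = c * w e m.
Proof. by rewrite /= ffunE. Qed.
Lemma even_sum (I : Type) (r : seq I) (P : pred I) (F : I -> L_even K) e m :
  (\sum_(i <- r | P i) F i) e m = \sum_(i <- r | P i) F i e m.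
Proof.
by elim/big_rec2: _ => [|i x y _ <-]; rewrite ?evenD //= ffunE.
Qed.
Lemma odd_sum (I : Type) (r : seq I) (P : pred I) (F : I -> L_odd K) kl m :
  (\sum_(i <- r | P i) F i) kl m = \sum_(i <- r | P i) F i kl m.
Proof.
by elim/big_rec2: _ => [|i x y _ <-]; rewrite ?oddD //= ffunE.
Qed.
Lemma partialE i e m : partial K i e m = ((e == i) && (m == 0%MM))%:R.
Proof. by rewrite ffunE /=; case: eqP; case: eqP. Qed.
Lemma dformE i j kl m : dform K i j kl m =
  ((kl == (i, j))%:R - (kl == (j, i))%:R) *+ (m == 0%MM).
Proof. by rewrite ffunE. Qed.

Definition even_const (Y : L_even K) := \sum_e Y e 0%MM *: partial K e.
Definition odd_const (w : L_odd K) :=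
  \sum_(kl : 'I_5 * 'I_5 | (kl.1 < kl.2)%N) w kl 0%MM *: dform K kl.1 kl.2.

Lemma even_constE Y e m : even_const Y e m = Y e 0%MM *+ (m == 0%MM).
Proof.
rewrite even_sum (bigD1 e) // big1 ?Monoid.mulm1 => [|a /negPf ne_a].
  by rewrite evenZ partialE eqxx mulr_natr.
by rewrite evenZ partialE eq_sym ne_a mulr0.
Qed.

Lemma odd_constE w kl m : odd_const w kl m = w kl 0%MM *+ (m == 0%MM).
Proof.
have /closed_formP[aw _] := valP w.
have aw0 a b : w (b, a) 0%MM = - w (a, b) 0%MM by rewrite aw.
have lem (k l : 'I_5) : (k < l)%N -> odd_const w (k, l) m = w (k, l) 0%MM *+ (m == 0%MM).
  move=> lt_kl; rewrite odd_sum (bigD1 (k, l)) // big1 ?Monoid.mulm1 => [|[a b] /andP[]]; last first.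
    cbn [fst snd] => lt_ab ne; rewrite oddZ dformE [_ == (a, b)]eq_sym (negPf ne) (_ : (_ == _) = false) ?subrr ?mul0rn ?mulr0 //.
    apply: contraTF lt_ab; rewrite xpair_eqE => /andP[/eqP<- /eqP<-].
    by rewrite -leqNgt ltnW.
  rewrite oddZ dformE eqxx xpair_eqE -[k == l]val_eqE /= (ltn_eqF lt_kl) subr0.
  by rewrite mulrnAr mulr1.
case: kl => k l; case: (ltngtP k l) => [|lt_lk|/val_inj->]; first exact: lem.
  have /closed_formP[ac _] := valP (odd_const w).
  by rewrite (ac l k) fps_coefN lem // aw0 mulNrn.
have /closed_formP[ac _] := valP (odd_const w).
by rewrite !antisym2_diag // !fps_coef0 mul0rn.
Qed.

Lemma even_degs_nconst (Y : L_even K) : even_degs (>= 0) (Y - even_const Y).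
Proof.
move=> e m; rewrite evenD evenN even_constE.
case: (eqVneq m 0%MM) => [->|m0 _]; first by rewrite subrr eqxx.
rewrite -mdeg_eq0 -lt0n in m0; rewrite subr_ge0 lez_nat.
by case: (mdeg m) m0 => // k _; rewrite mulSn.
Qed.

Lemma odd_degs_nconst (w : L_odd K) : odd_degs (>= 0) (w - odd_const w).
Proof.
move=> e m; rewrite oddD oddN odd_constE.
case: (eqVneq m 0%MM) => [->|m0 _]; first by rewrite subrr eqxx.
rewrite -mdeg_eq0 -lt0n in m0; rewrite subr_ge0 lez_nat.
by case: (mdeg m) m0 => // k _; rewrite mulSn.
Qed.

Lemma linear_part_nconst (Y : L_even K) :
  linear_part (Y - even_const Y) = linear_part Y.
Proof.
apply/matrixP => i j; rewrite !mxE evenD evenN even_constE mnm1_eq0 subr0 //.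
Qed.

Lemma fps_deriv0 i (f : fps 5 K) : fps_deriv i f 0%MM = f U_(i)%MM.
Proof. by rewrite /= add0m mnm0E. Qed.

Variable V : g0_module K.

(** Without its constant term, Y lies in L_0 and acts on v through its linear part. *)
Lemma tens_even_split (Y : L_even K) (v : V) :
  tens (of_even Y) v =
  \sum_e Y e 0%MM *: tens (of_even (partial K e)) v + tens 1 (g0_act (linear_part Y) v).
Proof.
rewrite -{1}[Y](subrK (even_const Y)) linearD /= tensDl addrC.
rewrite -[of_even (_ - _)]mul1r tens_even ?linear_part_nconst; last exact: even_degs_nconst.
congr (_ + _); rewrite /even_const linear_sum tens_suml.
by apply: eq_bigr => e _; rewrite linearZ tensZl.
Qed.

Lemma tens_odd_split (w : L_odd K) (v : V) :
  tens (of_odd w) v =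
  \sum_(kl : 'I_5 * 'I_5 | (kl.1 < kl.2)%N) w kl 0%MM *: tens (of_odd (dform K kl.1 kl.2)) v.
Proof.
rewrite -{1}[w](subrK (odd_const w)) linearD /= tensDl.
rewrite -[of_odd (_ - _)]mul1r tens_odd ?add0r; last exact: odd_degs_nconst.
rewrite /odd_const linear_sum tens_suml.
by apply: eq_bigr => e _; rewrite linearZ tensZl.
Qed.
End Constants.

(* (x, (p, w, b)) stands for the value at 0 of the jet x times the element    *)
(* w p \otimes b of a Verma module, for words w in the d_ij and p in the      *)
(* \partial_i.                                                                *)
Definition okey := (jet * (seq nat * seq (nat * nat) * seq nat))%type.

Definition cons_word (d : nat * nat) (x : okey) : okey :=
  (x.1, (x.2.1.1, d :: x.2.1.2, x.2.2)).

Section Expansion.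
(* actT k e b is the action of x_k \partial_e on the vector with code b. *)
Variable actT : nat -> nat -> seq nat -> seq (int * seq nat).

(** A field that has reached the coefficient vector b contributes its value at 0, which leaves ∂_e
    in front of b, and its linear part, which acts on b: [insn k] differentiates the jet once more
    to extract the coefficient of x_k. *)
Definition eval_field (F : seq (int * (jet * nat))) (b : seq nat) : seq (int * okey) :=
  lbind F (fun x : jet * nat => (1, (x.1, ([:: x.2], [::], b))) ::
    flatten [seq [seq (t.1, ((insn k x.1.1, x.1.2), ([::], [::], t.2))) | t <- actT k x.2 b]
            | k <- iota 0 5]).

Definition eval_form (W : seq (int * (jet * (nat * nat)))) (b : seq nat) : seq (int * okey) :=
  [seq (t.1, (t.2.1, ([::], [:: t.2.2], b))) | t <- W].

(* X and w are moved to the right through the word u: X d = d X + [X, d],     *)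
(* w d = - d w + [w, d].                                                      *)
Fixpoint expand_even F (u : seq (nat * nat)) b {struct u} : seq (int * okey) :=
  if u is d :: u then
    [seq (t.1, cons_word d t.2) | t <- expand_even F u b] ++ expand_odd (field_d F d) u b
  else eval_field F b
with expand_odd W (u : seq (nat * nat)) b {struct u} : seq (int * okey) :=
  if u is d :: u then
    [seq (- t.1, cons_word d t.2) | t <- expand_odd W u b] ++ expand_even (form_d W d) u b
  else eval_form W b.

Variables (K : numFieldType) (V : g0_module K) (vec : seq nat -> V).
Hypothesis actP : forall (A : 'M[K]_5) b, g0_act A (vec b) =
  \sum_(k < 5) \sum_(e < 5) A k e *: lc vec (actT k e b).
Variable S : nat * nat -> fps 5 K.

Definition dgen (d : nat * nat) : UL K := of_odd (dform K (o5 d.1) (o5 d.2)).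
Definition pgen (e : nat) : UL K := of_even (partial K (o5 e)).
Definition dword (w : seq (nat * nat)) : UL K := foldr (fun d u => dgen d * u) 1 w.
Definition pword (p : seq nat) : UL K := foldr (fun e u => pgen e * u) 1 p.

Definition den_out (x : okey) : Verma V :=
  jetD S x.1 0%MM *: tens (dword x.2.1.2 * pword x.2.1.1) (vec x.2.2).

Lemma lc_den_cons d l : 
  lc den_out [seq (t.1, cons_word d t.2) | t <- l] = Verma_act (dgen d) (lc den_out l).
Proof.
rewrite (lc_linear (Verma_act (dgen d))) {1}/lc big_map; apply: eq_bigr => t _.
by rewrite /den_out (linearZ_LR (Verma_act (dgen d))) [X in _ = _ *: (_ *: X)]Verma_act_tens mulrA.
Qed.

Lemma lc_den_consN d l : 
  lc den_out [seq (- t.1, cons_word d t.2) | t <- l] = - Verma_act (dgen d) (lc den_out l).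
Proof.
rewrite -lc_den_cons /lc !big_map -sumrN; apply: eq_bigr => t _ /=.
by rewrite intrN scaleNr.
Qed.

Lemma eval_fieldP F (Y : L_even K) b :
    (forall e, Y e = lc (den_field S e) F) -> all (fun t => t.2.2 < 5)%N F ->
  tens (of_even Y) (vec b) = lc den_out (eval_field F b).
Proof.
move=> YE wfF; have coefE (f : jet * nat -> fps 5 K) m (v : Verma V) :
    lc f F m *: v = lc (fun x => f x m *: v) F.
  by rewrite /lc fps_coef_sum scaler_suml; apply: eq_bigr => t _; rewrite fps_coefZ scalerA.
have E2 : tens 1 (g0_act (linear_part Y) (vec b)) =
    \sum_(k < 5) \sum_(e < 5) Y e U_(k)%MM *: tens 1 (lc vec (actT k e b)).
  rewrite actP (linear_sum (@tens K V 1)); apply: eq_bigr => k _.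
  rewrite (linear_sum (@tens K V 1)); apply: eq_bigr => e _.
  by rewrite mxE (linearZ_LR (@tens K V 1)).
rewrite tens_even_split E2 lc_bind.
under eq_bigr do rewrite YE coefE.
under [X in _ + X]eq_bigr => k _.
  under eq_bigr do rewrite YE coefE.
  rewrite lc_sum; over.
rewrite !lc_sum lcD; apply: (eq_lc (P := fun x => x.2 < 5)%N) wfF => -[[J s] e] lt_e.
have pick (m : 'X_{1..5}) (G : 'I_5 -> Verma V) :
    \sum_a den_field S a ((J, s), e) m *: G a = jetD S (J, s) m *: G (o5 e).
  rewrite (bigD1 (o5 e)) // big1 => [|a ne]; rewrite /den_field ?eqxx ?Monoid.mulm1 //.
  by rewrite eq_sym (negPf ne) scale0r.
rewrite lc_cons scale1r lc_flatten5 pick; congr (_ + _).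
  by rewrite /den_out /= mul1r mulr1.
apply: eq_bigr => k _; rewrite (pick _ (fun a => tens 1 (lc vec (actT k a b)))) o5K //.
rewrite (lc_linear (@tens K V 1)) lcZ /lc big_map; apply: eq_bigr => t _.
by rewrite /den_out; cbn [fst snd]; rewrite jetD_insn fps_deriv0 /o5 inord_val /= mulr1.
Qed.

Lemma eval_formP W (w : L_odd K) b :
    (forall kl, w kl = lc (den_form S kl) W) -> all (fun t => wfd t.2.2) W ->
  tens (of_odd w) (vec b) = lc den_out (eval_form W b).
Proof.
move=> wE wfW; rewrite tens_odd_split.
have coefE (f : jet * (nat * nat) -> fps 5 K) m (v : Verma V) :
    lc f W m *: v = lc (fun x => f x m *: v) W.
  by rewrite /lc fps_coef_sum scaler_suml; apply: eq_bigr => t _; rewrite fps_coefZ scalerA.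
under eq_bigr do rewrite wE coefE.
rewrite lc_sum [RHS](_ : _ = lc (fun x => den_out (x.1, ([::], [:: x.2], b))) W); last first.
  by rewrite /lc big_map.
apply: (eq_lc (P := fun x => wfd x.2)) wfW => -[[J s] d]; cbn [fst snd] => wf_d.
transitivity (\sum_(kl : 'I_5 * 'I_5 | (kl.1 < kl.2)%N)
    (dsgn d kl)%:~R *: (jetD S (J, s) 0%MM *: tens (of_odd (dform K kl.1 kl.2)) (vec b))).
  by apply: eq_bigr => kl _; rewrite /den_form fps_coefZ scalerA.
by rewrite (sum_wfd _ wf_d) /den_out /= !mulr1.
Qed.

(** Crossing a letter d turns a field X into the form [X, d] and a form w into the field [w, d], so
    both claims are proved in one induction on the word. *)
Lemma expandP u : all wfd u ->
  (forall F (Y : L_even K) b,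
    (forall e, Y e = lc (den_field S e) F) -> all (fun t => t.2.2 < 5)%N F ->
    tens (of_even Y * dword u) (vec b) = lc den_out (expand_even F u b)) /\
  (forall W (w : L_odd K) b,
    (forall kl, w kl = lc (den_form S kl) W) -> all (fun t => wfd t.2.2) W ->
    tens (of_odd w * dword u) (vec b) = lc den_out (expand_odd W u b)).
Proof.
elim: u => [_|d u IH /= /andP[wf_d /IH[IHe IHo]]].
  by split=> *; rewrite mulr1; [apply: eval_fieldP|apply: eval_formP].
split=> [F Y b YE wfF|W w b wE wfW]; rewrite lc_cat ?lc_den_cons ?lc_den_consN.
  rewrite -(IHe _ Y) // -(IHo _ (even_odd_bracket Y (dform K (o5 d.1) (o5 d.2)))).
  + by rewrite Verma_act_tens -tensDl !mulrA -mulrDl of_even_odd.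
  + have /andP[lt12 lt2] := wf_d.
    by move=> kl; apply: field_dE => //; apply: ltn_trans lt2.
  + exact: field_d_wf.
rewrite -(IHo _ w) // -(IHe _ (odd_bracket w (dform K (o5 d.1) (o5 d.2)))).
+ by rewrite Verma_act_tens -tensNl -tensDl !mulrA -mulNr -mulrDl of_odd_odd.
+ by move=> e; apply: form_dE.
+ exact: form_d_wf.
Qed.
End Expansion.

(** * PBW normal form of words in U_- *)

Definition ltd (a b : nat * nat) :=
  ((a.1 < b.1) || ((a.1 == b.1) && (a.2 < b.2)))%N.

Definition bracket_dd (a b : nat * nat) : seq (int * nat) :=
  [seq t <- [seq (eps r a.1 a.2 b.1 b.2, r) | r <- iota 0 5] | t.1 != 0].

(** Insertion into a sorted word by d_a d_b = - d_b d_a + [d_a, d_b] and d_a^2 = 0. The bracket is a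
    combination of the ∂_i, which are central in U_- and are collected in the first component. *)
Fixpoint insd (a : nat * nat) (u : seq (nat * nat)) : seq (int * (seq nat * seq (nat * nat))) :=
  if u is b :: t then
    if ltd a b then [:: (1, ([::], a :: u))]
    else if a == b then [::]
    else [seq (- x.1, (x.2.1, b :: x.2.2)) | x <- insd a t] ++
         [seq (x.1, ([:: x.2], t)) | x <- bracket_dd a b]
  else [:: (1, ([::], [:: a]))].

Fixpoint sortd (u : seq (nat * nat)) : seq (int * (seq nat * seq (nat * nat))) :=
  if u is a :: t then
    lbind (sortd t) (fun x => [seq (s.1, (s.2.1 ++ x.1, s.2.2)) | s <- insd a x.2])
  else [:: (1, ([::], [::]))].

Definition norm_words (x : okey) : seq (int * okey) :=
  if all wfd x.2.1.2 then
    [seq (y.1, (x.1, (foldr insn [::] (y.2.1 ++ x.2.1.1), y.2.2, x.2.2))) | y <- sortd x.2.1.2]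
  else [:: (1, x)].

Section Words.
Variable K : numFieldType.
Local Notation dgen := (dgen K).
Local Notation pgen := (pgen K).
Local Notation dword := (dword K).
Local Notation pword := (pword K).

Lemma odd_bracket_dd d d' : wfd d -> wfd d' ->
  odd_bracket (dform K (o5 d.1) (o5 d.2)) (dform K (o5 d'.1) (o5 d'.2)) =
  \sum_(r < 5) (eps r d.1 d.2 d'.1 d'.2)%:~R *: partial K r.
Proof.
move=> wf_d wf_d'; apply: val_inj; apply/ffunP => e; rewrite [LHS]form_bracket_dform //.
have /andP[lt12 lt2] := wf_d; have lt1 := ltn_trans lt12 lt2.
transitivity ((1 : fps 5 K) *~ eps e d.1 d.2 d'.1 d'.2).
  transitivity (\sum_(kl : 'I_5 * 'I_5 | (kl.1 < kl.2)%N)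
      (dsgn d kl)%:~R *: ((1 : fps 5 K) *~ eps e kl.1 kl.2 d'.1 d'.2)).
    apply: eq_bigr => kl _; rewrite -scalerMzr; congr (_ *~ _); apply: fpsP => m.
    rewrite fps_coefZ [LHS]dformE /= intrB mulrnAr mulr1 //.
  by rewrite sum_wfd // /= !o5K.
apply: fpsP => m; rewrite [RHS]even_sum (bigD1 e) // big1 ?Monoid.mulm1 => [|a /negPf ne_a].
  by rewrite -scaler_int fps_coefZ evenZ partialE eqxx.
by rewrite evenZ partialE eq_sym ne_a mulr0.
Qed.

Lemma lc_bracket_dd (M : lmodType K) (den : nat -> M) d d' :
  lc den (bracket_dd d d') = \sum_(r < 5) (eps r d.1 d.2 d'.1 d'.2)%:~R *: den r.
Proof.
rewrite lc_filter0 lc_map sum_o5; apply: eq_big_seq => r.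
by rewrite mem_iota => /andP[_ lt_r]; rewrite o5K.
Qed.

Lemma of_even_bracket_dd d d' : wfd d -> wfd d' ->
  of_even (odd_bracket (dform K (o5 d.1) (o5 d.2)) (dform K (o5 d'.1) (o5 d'.2))) =
  lc pgen (bracket_dd d d').
Proof.
move=> wf_d wf_d'; rewrite odd_bracket_dd // lc_bracket_dd linear_sum.
by apply: eq_bigr => r _; rewrite (linearZ_LR (@of_even K)) /pgen /o5 inord_val.
Qed.

Lemma dgen_dgen d d' : wfd d -> wfd d' ->
  dgen d * dgen d' = - (dgen d' * dgen d) + lc pgen (bracket_dd d d').
Proof. by move=> wf_d wf_d'; rewrite /dgen of_odd_odd of_even_bracket_dd. Qed.

(** The defining relation gives 2 d^2 = [d, d], and d ∧ d = 0. *)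
Lemma dgen_sqr d : wfd d -> dgen d * dgen d = 0.
Proof.
move=> wf_d; have : dgen d * dgen d + dgen d * dgen d = 0.
  rewrite {1}dgen_dgen // addrAC addNr add0r lc_bracket_dd big1 // => r _.
  rewrite (_ : eps _ _ _ _ _ = 0) ?scale0r //.
  by rewrite /eps /(cmp_sign d.1 d.1) ltnn !(mulr0, mul0r).
rewrite -mulr2n -scaler_nat => /eqP; rewrite scaler_eq0 pnatr_eq0 /= => /eqP //.
Qed.

Lemma pgen_dgen e d : pgen e * dgen d = dgen d * pgen e.
Proof.
rewrite /pgen /dgen of_even_odd (_ : even_odd_bracket _ _ = 0) ?linear0 ?addr0 //.
apply: val_inj; apply/ffunP => -[k l]; rewrite [LHS]lie_deriv_dform.
by rewrite !ffunE !fps_deriv_const !mul0rn !subr0 addr0.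
Qed.

Lemma pgenC e e' : pgen e * pgen e' = pgen e' * pgen e.
Proof.
rewrite /pgen of_even_even (_ : even_bracket _ _ = 0) ?linear0 ?addr0 //.
apply: val_inj; apply/ffunP => j; rewrite [LHS]ffunE [RHS]ffunE big1 // => i _.
by rewrite !ffunE !fps_deriv_const !mulr0 subr0.
Qed.

Lemma pgen_dword e u : pgen e * dword u = dword u * pgen e.
Proof. by elim: u => [|d u IH] /=; rewrite ?mulr1 ?mul1r // mulrA pgen_dgen -!mulrA IH. Qed.

Lemma pword_cat p q : pword (p ++ q) = pword p * pword q.
Proof. by elim: p => [|e p IH] /=; rewrite ?mul1r // IH mulrA. Qed.

Lemma pword_insn e p : pword (insn e p) = pgen e * pword p.
Proof. by elim: p => [|e' p IH] //=; case: leqP => //= _; rewrite IH !mulrA pgenC. Qed.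

Lemma pword_sort p : pword (foldr insn [::] p) = pword p.
Proof. by elim: p => [|e p IH] //=; rewrite pword_insn IH. Qed.

Definition den_word (x : seq nat * seq (nat * nat)) : UL K := dword x.2 * pword x.1.

Lemma insdP a u : wfd a -> all wfd u -> dgen a * dword u = lc den_word (insd a u).
Proof.
move=> wf_a; elim: u => [_|b u IH /= /andP[wf_b wf_u]] /=.
  by rewrite lc_seq1 scale1r /den_word /= !mulr1.
case: ifP => _; first by rewrite lc_seq1 scale1r /den_word /= !mulr1.
case: eqP => [<-|_]; first by rewrite mulrA dgen_sqr // mul0r lc_nil.
rewrite mulrA dgen_dgen // mulrDl mulNr -mulrA IH // lc_cat; congr (_ + _).
  rewrite /lc big_map mulr_sumr -sumrN; apply: eq_bigr => x _.
  by rewrite intrN scaleNr -scalerAr /den_word /= mulrA.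
rewrite /lc big_map mulr_suml; apply: eq_bigr => x _.
by rewrite -scalerAl /den_word /= mulr1 pgen_dword.
Qed.

Lemma insd_wf a u x : wfd a -> all wfd u -> x \in insd a u -> all wfd x.2.2.
Proof.
move=> wf_a; elim: u x => [x _|b u IH x /= /andP[wf_b wf_u]] /=.
  by rewrite inE => /eqP->; rewrite /= wf_a.
case: ifP => _; first by rewrite inE => /eqP->; rewrite /= wf_a wf_b.
case: ifP => _ //; rewrite mem_cat => /orP[]/mapP[y yin ->] //=.
by rewrite wf_b IH.
Qed.

Lemma sortd_wf u x : all wfd u -> x \in sortd u -> all wfd x.2.2.
Proof.
elim: u x => [x _|a u IH x /= /andP[wf_a wf_u]] /=; first by rewrite inE => /eqP->.
case/flatten_mapP => y yin /mapP[z /mapP[s sin ->] ->] /=.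
exact: insd_wf wf_a (IH _ wf_u yin) sin.
Qed.

Lemma sortdP u : all wfd u -> dword u = lc den_word (sortd u).
Proof.
elim: u => [_|a u IH /= /andP[wf_a wf_u]]; first by rewrite lc_seq1 scale1r /den_word /= !mulr1.
rewrite /= IH // lc_bind /lc mulr_sumr big_seq [RHS]big_seq; apply: eq_bigr => t tin.
rewrite -scalerAr; congr (_ *: _); rewrite {1}/den_word mulrA insdP //; last exact: sortd_wf tin.
rewrite /lc mulr_suml big_map; apply: eq_bigr => s _.
by rewrite -scalerAl /den_word /= pword_cat mulrA.
Qed.

Variables (V : g0_module K) (vec : seq nat -> V) (S : nat * nat -> fps 5 K).

Lemma norm_wordsP x : den_out vec S x = lc (den_out vec S) (norm_words x).
Proof.
rewrite /norm_words; case: ifP => [wf|_]; last by rewrite lc_seq1 scale1r.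
rewrite /den_out sortdP // [lc den_word _]/lc mulr_suml tens_suml scaler_sumr /lc big_map.
apply: eq_bigr => t _ /=.
by rewrite pword_sort pword_cat -scalerAl tensZl /den_word mulrA !scalerA mulrC.
Qed.

End Words.

(* Normal forms of jets. For a closed form w, D_i w_kl = D_k w_il - D_l w_ik   *)
(* is used when i < k; for X divergence free, D_1 X_1 = - \sum_(e > 1) D_e X_e. *)
(* Jets of w of order 0 and jets of X of order less than d are assumed to be 0. *)
Definition close_odd (x : jet) : seq (int * jet) :=
  if x.1 is i :: J then
    if (i < x.2.1)%N then
      [:: (1, (insn x.2.1 J, (i, x.2.2))); (-1, (insn x.2.2 J, (i, x.2.1)))]
    else [:: (1, x)]
  else [::].

Definition close_even (d : nat) (x : jet) : seq (int * jet) :=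
  if (size x.1 < d)%N then [::] else
  if x.1 is i :: J then
    if (i == 0)%N && (x.2.1 == 0)%N then
      [seq (-1, (insn e J, (e, 0%N))) | e <- [:: 1; 2; 3; 4]%N]
    else [:: (1, x)]
  else [:: (1, x)].

Definition norm_out (close : jet -> seq (int * jet)) (x : okey) : seq (int * okey) :=
  lbind (close x.1) (fun j => norm_words (j, x.2)).

(* The sizes make the code injective, so that sorting the codes brings equal  *)
(* keys together.                                                             *)
Definition okey_code (x : okey) : seq nat :=
  flatten [seq [:: d.1; d.2] | d <- x.2.1.2] ++ x.1.1 ++ x.2.2 ++ x.2.1.1 ++
  [:: x.1.2.1; x.1.2.2; size x.2.1.1; size x.2.1.2].

Fixpoint lex_le (s t : seq nat) : bool :=
  match s, t with
  | [::], _ => true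
  | _ :: _, [::] => false
  | x :: s, y :: t =>
    match Nat.compare x y with Lt => true | Eq => lex_le s t | Gt => false end
  end.

Definition zero_out (l : seq (int * okey)) : bool :=
  zero_sum (fun s t : seq nat * okey => lex_le s.1 t.1) [seq (t.1, (okey_code t.2, t.2)) | t <- l].

Definition field0 : seq (int * (jet * nat)) :=
  [seq (1, (([::], (e, 0%N)), e)) | e <- iota 0 5].
Definition form0 : seq (int * (jet * (nat * nat))) :=
  flatten [seq [seq (1, (([::], (k, l)), (k, l))) | l <- iota k.+1 (4 - k)] | k <- iota 0 5].

(** * The symbolic test that a vector is killed *)

Definition expr := seq (int * (seq (nat * nat) * seq nat)).

Section Check.
Variable actT : nat -> nat -> seq nat -> seq (int * seq nat).

(** [field0] is the undetermined field, its components being jets of order 0. After normalization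
    the remaining jets count as independent unknowns, and the integer coefficient of every key (jet,
    word, vector) has to cancel. *)
Definition check_even (d : nat) (P : expr) : bool :=
  all (fun t => all wfd t.2.1) P &&
  zero_out (lbind (lbind P (fun x => expand_even actT field0 x.1 x.2)) (norm_out (close_even d))).

Definition check_odd (P : expr) : bool :=
  all (fun t => all wfd t.2.1) P &&
  zero_out (lbind (lbind P (fun x => expand_odd actT form0 x.1 x.2)) (norm_out close_odd)).

Variables (K : numFieldType) (V : g0_module K) (vec : seq nat -> V).
Hypothesis actP : forall (A : 'M[K]_5) b, g0_act A (vec b) =
  \sum_(k < 5) \sum_(e < 5) A k e *: lc vec (actT k e b).
Local Notation D := (@fps_deriv 5 K).

Definition den_expr (x : seq (nat * nat) * seq nat) : Verma V := tens (dword K x.1) (vec x.2).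

Lemma zero_outP S l : zero_out l -> lc (den_out vec S) l = 0.
Proof.
move/(zero_sumP (fun x => den_out vec S x.2)) => <-.
by rewrite /lc big_map.
Qed.

Lemma norm_outP S close x :
    (forall j, jetD S j 0%MM = \sum_(t <- close j) t.1%:~R * jetD S t.2 0%MM) ->
  den_out vec S x = lc (den_out vec S) (norm_out close x).
Proof.
move=> closeP; rewrite /den_out closeP scaler_suml lc_bind; apply: eq_bigr => t _.
by rewrite -norm_wordsP /den_out scalerA.
Qed.

Definition diffs (J : seq nat) (f : fps 5 K) : fps 5 K := foldr (fun i f => D (o5 i) f) f J.

Fact diffs_linear J : linear (diffs J).
Proof. by elim: J => [|i J IH] //= c f g; rewrite /diffs /= -!/(diffs J _) IH linearP. Qed.

HB.instance Definition _ J := GRing.isLinear.Build K (fps 5 K) (fps 5 K) _ (diffs J) (diffs_linear J).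

Lemma diffs_deriv i J f : D i (diffs J f) = diffs J (D i f).
Proof. by elim: J => //= j J IH; rewrite fps_derivC IH. Qed.

Lemma jetD_insn_diffs S i J s : jetD S (insn i J, s) = diffs J (D (o5 i) (S s)).
Proof. by rewrite jetD_insn -diffs_deriv. Qed.

Lemma jetD_cons_diffs S i J s : jetD S (i :: J, s) = diffs J (D (o5 i) (S s)).
Proof. by rewrite -diffs_deriv. Qed.

Lemma o5E : (o5 0 = i1) * (o5 1 = i2) * (o5 2 = i3) * (o5 3 = i4) * (o5 4 = i5).
Proof. by do !split; apply: val_inj; rewrite /= inordK. Qed.

Lemma form0P (w : form2 K) kl : antisym2 w ->
  w kl = lc (den_form (fun s => w (o5 s.1, o5 s.2)) kl) form0.
Proof.
move=> aw; have Aw := antisym2_sort aw; case: kl => k l.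
rewrite /lc /form0 /= /den_form /dsgn /jetD !big_cons big_nil /= !o5E.
move: k l; apply: ord5_ind; apply: ord5_ind; rewrite ?Aw /= ?scale1r ?subrr ?subr0 ?sub0r ?scale0r ?scale1r ?add0r ?addr0.
all: by rewrite ?(intrN, scaleNr, scale1r).
Qed.

Lemma diffs_vanish J (f : fps 5 K) d m : (forall m, (mdeg m < d)%N -> f m = 0) ->
  (mdeg m + size J < d)%N -> diffs J f m = 0.
Proof.
move=> f0; elim: J m => [|i J IH] m /=; first by rewrite addn0; apply: f0.
by rewrite addnS => lt_d; rewrite IH ?mul0rn // mdegD mdeg1 addn1 addSn.
Qed.

Lemma check_evenP d P (X : L_even K) : check_even d P ->
    (forall e m, (mdeg m < d)%N -> X e m = 0) ->
  Verma_act (of_even X) (lc den_expr P) = 0.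
Proof.
case/andP=> wfP zP X0; pose S (s : nat * nat) := X (o5 s.1).
rewrite (lc_linear (Verma_act (of_even X))) -[RHS](zero_outP S zP) !lc_bind.
apply: (eq_lc (P := fun x => all wfd x.1)) wfP => -[u b] wf_u.
rewrite [LHS]Verma_act_tens (proj1 (expandP actP S wf_u) field0 X) //; last first.
  move=> e; rewrite /lc /field0 big_map -(sum_o5 (fun a => 1 *: (if a == e then X a else 0))).
  by rewrite (bigD1 e) //= eqxx scale1r big1 ?addr0 // => a /negPf->; rewrite scaler0.
apply: eq_lcT => x; apply: norm_outP => -[J [e e']]; rewrite /close_even; cbn [fst snd].
case: ltnP => [lt_d|_].
  by rewrite big_nil [jetD _ _](_ : _ = diffs J (S (e, e'))) // (diffs_vanish (X0 _)) // mdeg0.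
case: J => [|i J]; first by rewrite big_seq1 mul1r.
case: ifP => [/andP[/eqP-> /eqP->]|_]; last by rewrite big_seq1 mul1r.
have div0 : D (o5 0) (X (o5 0)) = - \sum_(j <- [:: 1; 2; 3; 4]%N) D (o5 j) (X (o5 j)).
  have /eqP div0 : divergence X = 0 by exact/eqP/(valP X).
  by move: div0; rewrite /divergence sum_o5 big_cons addr_eq0 => /eqP.
rewrite jetD_cons_diffs /S div0 linearN linear_sum fps_coefN fps_coef_sum -sumrN big_map.
by apply: eq_bigr => a _; rewrite jetD_insn_diffs mulN1r.
Qed.

Lemma check_oddP P (w : L_odd K) : check_odd P -> (forall kl, w kl 0%MM = 0) ->
  Verma_act (of_odd w) (lc den_expr P) = 0.
Proof.
case/andP=> wfP zP w0; pose S (s : nat * nat) := w (o5 s.1, o5 s.2).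
rewrite (lc_linear (Verma_act (of_odd w))) -[RHS](zero_outP S zP) !lc_bind.
apply: (eq_lc (P := fun x => all wfd x.1)) wfP => -[u b] wf_u.
rewrite [LHS]Verma_act_tens (proj2 (expandP actP S wf_u) form0 w) //; last first.
  by move=> kl; apply: form0P; have /closed_formP[] := valP w.
apply: eq_lcT => x; apply: norm_outP => -[[|i J] [k l]]; first by rewrite big_nil /jetD /= w0.
rewrite /close_odd; cbn [fst snd]; case: ifP => _; last by rewrite big_seq1 mul1r.
have /closed_formP[aw cw] := valP w.
rewrite !big_cons big_nil addr0 mul1r mulN1r; cbn [fst snd].
rewrite jetD_cons_diffs !jetD_insn_diffs -fps_coefN -fps_coefD -linearB.
congr (diffs J _ _); apply/eqP; rewrite /S -subr_eq0 opprB addrA addrAC; apply/eqP.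
rewrite -[RHS](cw (o5 i) (o5 k) (o5 l)) (aw (o5 i) (o5 l)) linearN /= //.
Qed.
End Check.

(** * Functionals on Verma modules *)

Section DetInfinitesimal.
Variables (R : comNzRingType) (n : nat).
Implicit Types M B : 'M[R]_n.

Definition set_row M r (v : 'rV[R]_n) : 'M[R]_n :=
  \matrix_(i, j) if i == r then v 0 j else M i j.

(** The derivative of det(M(1 + tB)) at t = 0. Expanding each determinant along its changed row
    turns the sum into the trace of M B adj(M). *)
Lemma det_infinitesimal M B :
  \sum_r \det (set_row M r (row r (M *m B))) = \tr B * \det M.
Proof.
transitivity (\tr (M *m B *m \adj M)).
  apply: eq_bigr => r _; rewrite (expand_det_row _ r) mxE; apply: eq_bigr => s _.
  rewrite !mxE eqxx; congr (_ * _); rewrite /cofactor; congr (_ * \det _).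
  apply/matrixP => i j; rewrite !mxE; case: eqP => // e; by case/eqP: (neq_lift r i).
by rewrite mxtrace_mulC mulmxA mul_adj_mx mul_scalar_mx mxtraceZ mulrC.
Qed.
End DetInfinitesimal.

Section Omega.
Variable K : numFieldType.
Local Notation L := (Lsuper K).

Definition cv (y : L) : 'rV[K]_5 := \row_j y.1 j 0%MM.

Fact cv_linear : linear cv.
Proof. by move=> c x y; apply/rowP => j; rewrite !mxE fst_linear evenD evenZ. Qed.

HB.instance Definition _ := GRing.isLinear.Build K L 'rV[K]_5 _ cv cv_linear.

Lemma fps_coefM0 (f g : fps 5 K) : (f * g) 0%MM = f 0%MM * g 0%MM.
Proof.
rewrite (fps_coefM (p := (f 0%MM)%:MP) (q := (g 0%MM)%:MP)).
- by rewrite -mpolyCM mcoeffC eqxx mulr1.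
- by move=> k; rewrite mdeg0 leqn0 mdeg_eq0 => /eqP->; rewrite mcoeffC eqxx mulr1.
- by move=> k; rewrite mdeg0 leqn0 mdeg_eq0 => /eqP->; rewrite mcoeffC eqxx mulr1.
Qed.

(** At 0 only the part of -[X, z] in which X is differentiated survives. *)
Lemma cv_even (X : L_even K) z : (forall e, X e 0%MM = 0) ->
  cv (coad_even X z) = cv z *m linear_part X.
Proof.
move=> X0; apply/rowP => j; rewrite !mxE evenN.
rewrite [even_bracket X z.1 j]ffunE fps_coef_sum -sumrN; apply: eq_bigr => i _.
by rewrite fps_coefD fps_coefN !fps_coefM0 X0 mul0r sub0r opprK fps_deriv0 !mxE.
Qed.

Lemma cv_odd (w : L_odd K) z : (forall kl, w kl 0%MM = 0) -> cv (coad_odd w z) = 0.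
Proof.
move=> w0; apply/rowP => j; rewrite !mxE evenN [odd_bracket _ _ j]ffunE fps_coef_sum.
rewrite big1 ?oppr0 // => s _; rewrite mulr_sign.
have v0 : (w (s i2, s i3) * z.2 (s i4, s i5)) 0%MM = 0 by rewrite fps_coefM0 w0 mul0r.
by case: (odd_perm s); rewrite ?fps_coefN v0 ?oppr0.
Qed.

Definition rows5 (a b c d e : 'rV[K]_5) : 'M[K]_5 := \matrix_(r < 5) nth 0 [:: a; b; c; d; e] r.

(* As functions of (x, y, z, t), the omega i are a basis of a g_0-module of   *)
(* type F(0, 0, 0, 1) killed by L_+.                                          *)
Definition omega (i : 'I_5) (x y z t : L) : K :=
  \det (rows5 (delta_mx 0 i) (cv x) (cv y) (cv z) (cv t)).

Lemma set_row_rows5 a b c d e v :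
  (set_row (rows5 a b c d e) i1 v = rows5 v b c d e) *
  (set_row (rows5 a b c d e) i2 v = rows5 a v c d e) *
  (set_row (rows5 a b c d e) i3 v = rows5 a b v d e) *
  (set_row (rows5 a b c d e) i4 v = rows5 a b c v e) *
  (set_row (rows5 a b c d e) i5 v = rows5 a b c d v).
Proof. by do !split; apply/matrixP; apply: ord5_ind => j; rewrite !mxE. Qed.

Lemma det_set_row_linear (M : 'M[K]_5) r c u v :
  \det (set_row M r (c *: u + v)) = c * \det (set_row M r u) + \det (set_row M r v).
Proof.
rewrite -[\det (set_row M r v)]mul1r; apply: (determinant_multilinear (i0 := r)).
- by apply/rowP => j; rewrite !mxE eqxx mul1r.
- by apply/matrixP => i j; rewrite !mxE eq_sym (negPf (neq_lift r i)).
- by apply/matrixP => i j; rewrite !mxE eq_sym (negPf (neq_lift r i)).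
Qed.

Lemma rows5_linear c u v a b d e :
  (\det (rows5 (c *: u + v) a b d e) = c * \det (rows5 u a b d e) + \det (rows5 v a b d e)) *
  (\det (rows5 a (c *: u + v) b d e) = c * \det (rows5 a u b d e) + \det (rows5 a v b d e)) *
  (\det (rows5 a b (c *: u + v) d e) = c * \det (rows5 a b u d e) + \det (rows5 a b v d e)) *
  (\det (rows5 a b d (c *: u + v) e) = c * \det (rows5 a b d u e) + \det (rows5 a b d v e)) *
  (\det (rows5 a b d e (c *: u + v)) = c * \det (rows5 a b d e u) + \det (rows5 a b d e v)).
Proof.
do !split.
- by have := det_set_row_linear (rows5 0 a b d e) i1 c u v; rewrite !set_row_rows5.
- by have := det_set_row_linear (rows5 a 0 b d e) i2 c u v; rewrite !set_row_rows5.
- by have := det_set_row_linear (rows5 a b 0 d e) i3 c u v; rewrite !set_row_rows5.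
- by have := det_set_row_linear (rows5 a b d 0 e) i4 c u v; rewrite !set_row_rows5.
- by have := det_set_row_linear (rows5 a b d e 0) i5 c u v; rewrite !set_row_rows5.
Qed.

(** As tr A = 0, the variations of all five rows add up to 0 by [det_infinitesimal]; the variation
    of the fixed row e_i is the sum of A_ik omega_k and is moved to the other side. *)
Lemma omega_even (A : 'M[K]_5) i x y z t : \tr A = 0 ->
  \det (rows5 (delta_mx 0 i) (cv x *m A) (cv y) (cv z) (cv t)) +
  \det (rows5 (delta_mx 0 i) (cv x) (cv y *m A) (cv z) (cv t)) +
  \det (rows5 (delta_mx 0 i) (cv x) (cv y) (cv z *m A) (cv t)) +
  \det (rows5 (delta_mx 0 i) (cv x) (cv y) (cv z) (cv t *m A)) =
  - \sum_k A i k * omega k x y z t.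
Proof.
move=> trA; set M := rows5 (delta_mx 0 i) (cv x) (cv y) (cv z) (cv t).
have := det_infinitesimal M A; rewrite trA mul0r sum5 !set_row_rows5 !row_mul.
have rE r : row r M = nth 0 [:: delta_mx 0 i; cv x; cv y; cv z; cv t] r by rewrite rowK.
rewrite !rE /=; move/eqP; rewrite -!addrA addr_eq0 => /eqP e.
apply: oppr_inj; rewrite -e opprK -rowE.
have -> : row i A = \sum_k A i k *: delta_mx 0 k by rewrite [LHS]row_sum_delta; apply: eq_bigr => k _; rewrite mxE.
pose g v := \det (rows5 v (cv x) (cv y) (cv z) (cv t)).
have gl c u v : g (c *: u + v) = c * g u + g v by rewrite /g rows5_linear.
have g0 : g 0 = 0 by have := gl (-1) 0 0; rewrite scaler0 addr0 mulN1r addNr.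
rewrite -/(g _) (big_morph g (id1 := 0) (op1 := +%R)) //; last first.
  by move=> u v; rewrite -[u]scale1r gl scale1r mul1r.
by apply: eq_bigr => k _; rewrite -[A i k *: _]addr0 gl g0 addr0.
Qed.

Lemma tensor_act_sum (a s : L -> L) (c : 'I_5 -> K) (f : 'I_5 -> seq L -> K) l :
  tensor_act a s (fun t => \sum_i c i * f i t) l = \sum_i c i * tensor_act a s (f i) l.
Proof.
elim: l f => [|x l IH] f /=; first by rewrite big1 // => i _; rewrite mulr0.
rewrite (IH (fun i t => f i (x :: t))) -big_split.
by apply: eq_bigr => i _; rewrite mulrDr.
Qed.

Definition leaf (c : K) (l : seq L) : K := if l is [::] then c else 0.

(** The sum of the omega_i ⊗ g_i: four entries are fed to omega_i, the others to g_i. Together with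
    [leaf], which ends the list, this builds tensors in the omega_i. *)
Definition blk (g : 'I_5 -> seq L -> K) (l : seq L) : K :=
  if l is [:: x, y, z, u & t] then \sum_i omega i x y z u * g i t else 0.

Lemma multilinear_leaf c : multilinear (leaf c).
Proof. by move=> l t a x y; case: l => *; rewrite /leaf /= mulr0 addr0. Qed.

Lemma multilinear_blk g : (forall i, multilinear (g i)) -> multilinear (blk g).
Proof.
move=> gl l t c x y.
have lin (F G H : 'I_5 -> K) : (forall i, F i = c * G i + H i) ->
    \sum_i F i = c * (\sum_i G i) + \sum_i H i.
  by move=> e; rewrite mulr_sumr -big_split; apply: eq_bigr => i _; apply: e.
case: l => [|a1 [|a2 [|a3 [|a4 l]]]] /=; last first.
- by apply: lin => i; rewrite gl mulrDr mulrCA.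
- by apply: lin => i; rewrite /omega linearP rows5_linear mulrDl mulrA.
- case: t => [|b1 t]; rewrite ?mulr0 ?addr0 //.
  by apply: lin => i; rewrite /omega linearP rows5_linear mulrDl mulrA.
- case: t => [|b1 [|b2 t]]; rewrite ?mulr0 ?addr0 //.
  by apply: lin => i; rewrite /omega linearP rows5_linear mulrDl mulrA.
- case: t => [|b1 [|b2 [|b3 t]]]; rewrite ?mulr0 ?addr0 //.
  by apply: lin => i; rewrite /omega linearP rows5_linear mulrDl mulrA.
Qed.

Lemma leaf_act a s c l : tensor_act a s (leaf c) l = 0.
Proof.
case: l => // x l; rewrite /= add0r.
by elim: l {c x} => //= y l ->; rewrite addr0.
Qed.

Lemma trace_linear_part (X : L_even K) : \tr (linear_part X) = 0.
Proof.
have /(congr1 (fun f : fps 5 K => f 0%MM)) : divergence X = 0 by exact/eqP/(valP X).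
rewrite /divergence fps_coef_sum fps_coef0 => <-.
by apply: eq_bigr => i _; rewrite fps_deriv0 mxE.
Qed.

Lemma blk_even (X : L_even K) g l : (forall e, X e 0%MM = 0) ->
  tensor_act (coad_even X) id (blk g) l =
  blk (fun k t => tensor_act (coad_even X) id (g k) t -
                  \sum_i linear_part X i k * g i t) l.
Proof.
move=> X0; case: l => [|x [|y [|z [|u t]]]] //=; rewrite ?addr0 // !map_id.
rewrite (tensor_act_sum _ _ (fun i => omega i x y z u)) /= !addrA -!big_split /=.
under [RHS]eq_bigr do rewrite mulrBr.
rewrite sumrB big_split /= addrC; congr (_ + _).
transitivity (\sum_i (- \sum_k linear_part X i k * omega k x y z u) * g i t).
  apply: eq_bigr => i _; rewrite -(omega_even _ _ _ _ _ (trace_linear_part X)) !mulrDl.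
  by rewrite /omega !cv_even.
transitivity (- \sum_i \sum_k linear_part X i k * omega k x y z u * g i t).
  by rewrite -sumrN; apply: eq_bigr => i _; rewrite mulNr mulr_suml.
rewrite exchange_big; congr (- _).
by apply: eq_bigr => k _; rewrite mulr_sumr; apply: eq_bigr => i _; rewrite mulrAC mulrC.
Qed.

Lemma omega0 i x y z u :
  [|| cv x == 0, cv y == 0, cv z == 0 | cv u == 0] -> omega i x y z u = 0.
Proof.
have lem (v : 'rV[K]_5) : v == 0 -> v = (-1) *: v + v by rewrite scaleN1r addNr => /eqP.
by rewrite /omega; case/or4P => /lem->; rewrite rows5_linear mulN1r addNr.
Qed.

Lemma blk_odd (w : L_odd K) g l : (forall kl, w kl 0%MM = 0) ->
  tensor_act (coad_odd w) (@parity K) (blk g) l =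
  blk (fun k => tensor_act (coad_odd w) (@parity K) (g k)) l.
Proof.
move=> w0; case: l => [|x [|y [|z [|u t]]]] //=; rewrite ?addr0 //.
rewrite (tensor_act_sum _ _ (fun i => omega i x y z u)) /=.
have o0 (F : 'I_5 -> K) (G : 'I_5 -> seq L -> K) t' : (forall i, F i = 0) ->
    \sum_i F i * G i t' = 0.
  by move=> F0; rewrite big1 // => i _; rewrite F0 mul0r.
by rewrite !o0 ?add0r // => i; rewrite omega0 // cv_odd // eqxx ?orbT.
Qed.
End Omega.

(** * Equivariant families of functions and linear forms on Verma modules *)

Section Functional.
Variable K : numFieldType.
Local Notation L := (Lsuper K).

Lemma even_degs_at0 (X : L_even K) e : even_degs (>= 0) X -> X e 0%MM = 0.
Proof. by move=> X0; apply/eqP; apply: contraT => /X0; rewrite mdeg0. Qed.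

Lemma odd_degs_at0 (w : L_odd K) kl : odd_degs (>= 0) w -> w kl 0%MM = 0.
Proof. by move=> w0; apply/eqP; apply: contraT => /w0; rewrite mdeg0. Qed.

Lemma U_act0 (u : UL K) : U_act u (fun _ : seq L => 0) = fun=> 0.
Proof.
have e : (fun _ : seq L => 0 * 0) = (fun=> 0) :> (seq L -> K).
  by apply/funext => l; rewrite mul0r.
have := uterm_actZ (generic_quotient.repr u) 0 (fun _ : seq L => 0); rewrite e.
by rewrite /U_act => ->; apply/funext => l; rewrite mul0r.
Qed.

Lemma blk_sum (c : 'I_5 -> K) (g : 'I_5 -> 'I_5 -> seq L -> K) l :
  \sum_i c i * blk (g i) l = blk (fun j t => \sum_i c i * g i j t) l.
Proof.
case: l => [|x [|y [|z [|u t]]]] /=; try by rewrite big1 // => i _; rewrite mulr0.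
under eq_bigr do rewrite mulr_sumr; rewrite exchange_big; apply: eq_bigr => j _ /=.
by rewrite mulr_sumr; apply: eq_bigr => i _; rewrite mulrCA.
Qed.

Lemma blkB (g h : 'I_5 -> seq L -> K) l :
  blk g l - blk h l = blk (fun j t => g j t - h j t) l.
Proof.
case: l => [|x [|y [|z [|u t]]]] /=; rewrite ?subr0 //.
by rewrite -sumrB; apply: eq_bigr => j _; rewrite mulrBr.
Qed.

Lemma blk_linear (c : K) (g h : 'I_5 -> seq L -> K) l :
  c * blk g l + blk h l = blk (fun j t => c * g j t + h j t) l.
Proof.
case: l => [|x [|y [|z [|u t]]]] /=; rewrite ?mulr0 ?addr0 //.
by rewrite mulr_sumr -big_split; apply: eq_bigr => j _; rewrite mulrDr mulrCA.
Qed.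

Lemma eq_blk (g h : 'I_5 -> seq L -> K) l : (forall i, g i =1 h i) -> blk g l = blk h l.
Proof. by move=> e; congr (blk _ l); apply/funext => i; apply/funext. Qed.

Lemma blk0 l : blk (fun _ _ => 0 : K) l = 0.
Proof.
case: l => [|x [|y [|z [|u t]]]] //=.
by rewrite big1 // => i _; rewrite mulr0.
Qed.

Definition wedge_form (s : 'M[K]_5) : seq L -> K := blk (fun i => blk (fun j => leaf (s i j))).

(** For p homogeneous of degree n this is the sum of the constants ∂_i1 ... ∂_in p times omega_i1 ⊗
    ... ⊗ omega_in, which is n! times the polarization of p. *)
Fixpoint poly_form n (p : {mpoly K[5]}) : seq L -> K :=
  if n is n.+1 then blk (fun i => poly_form n p^`M(i)) else leaf p@_0.

Lemma leaf_sum (c f : 'I_5 -> K) (l : seq L) :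
  \sum_i c i * leaf (f i) l = leaf (\sum_i c i * f i) l.
Proof. by case: l => //= *; rewrite big1 // => i _; rewrite mulr0. Qed.

Lemma leaf_linear c a b (l : seq L) : c * leaf a l + leaf b l = leaf (c * a + b) l.
Proof. by case: l => //= *; rewrite mulr0 addr0. Qed.

Lemma wedge_form_even (X : L_even K) s l : (forall e, X e 0%MM = 0) ->
  tensor_act (coad_even X) id (wedge_form s) l =
  wedge_form (- ((linear_part X)^T *m s + s *m linear_part X)) l.
Proof.
move=> X0; rewrite [LHS]blk_even //; apply: eq_blk => k t.
rewrite blk_even // blk_sum blkB; apply: eq_blk => j t'.
rewrite leaf_act !leaf_sum sub0r; case: t' => [|? ?] /=; last by rewrite oppr0 addr0.
rewrite !mxE opprD addrC; congr (- _ - _); last by apply: eq_bigr => i _; rewrite mulrC.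
by apply: eq_bigr => i _; rewrite !mxE.
Qed.

Lemma wedge_form_odd (w : L_odd K) s l : (forall kl, w kl 0%MM = 0) ->
  tensor_act (coad_odd w) (@parity K) (wedge_form s) l = 0.
Proof.
move=> w0; rewrite [LHS]blk_odd // -[RHS](blk0 l); apply: eq_blk => k t.
rewrite blk_odd // -[RHS](blk0 t); apply: eq_blk => j t'; exact: leaf_act.
Qed.

Lemma poly_act_deriv (A : 'M[K]_5) p k :
  (poly_act A p)^`M(k) = poly_act A p^`M(k) + \sum_j A k j *: p^`M(j).
Proof.
rewrite /poly_act linear_sum (bigD1 k) //= [in RHS](bigD1 k) //= -addrA [_ + \sum_j _]addrC addrA.
congr (_ + _); last first.
  apply: eq_bigr => i /negPf ne_i; rewrite linear_sum; apply: eq_bigr => j _ /=.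
  by rewrite linearZ /= mderivM mderivX1 ne_i mul0r add0r mderiv_comm.
rewrite linear_sum -big_split; apply: eq_bigr => j _ /=.
by rewrite linearZ /= mderivM mderivX1 eqxx mul1r addrC scalerDr mderiv_comm.
Qed.

Lemma poly_act_coef0 (A : 'M[K]_5) p : (poly_act A p)@_0 = 0.
Proof.
rewrite /poly_act raddf_sum big1 // => i _; rewrite raddf_sum big1 // => j _.
by rewrite /= mcoeffZ rmorphM /= mcoeffX mnm1_eq0 mul0r mulr0.
Qed.

Lemma poly_form_linear n c p q l :
  poly_form n (c *: p + q) l = c * poly_form n p l + poly_form n q l.
Proof.
elim: n p q l => [|n IH] p q l /=; first by rewrite leaf_linear mcoeffD mcoeffZ.
by rewrite blk_linear; apply: eq_blk => i t; rewrite linearP IH.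
Qed.

Lemma poly_formN n p l : poly_form n (- p) l = - poly_form n p l.
Proof.
have p0 : poly_form n 0 l = 0.
  by have := poly_form_linear n (-1) 0 0 l; rewrite scaler0 addr0 mulN1r addNr.
by have := poly_form_linear n (-1) p 0 l; rewrite addr0 scaleN1r p0 addr0 mulN1r.
Qed.

Lemma poly_form_sum n (I : Type) (r : seq I) (c : I -> K) (p : I -> {mpoly K[5]}) l :
  poly_form n (\sum_(i <- r) c i *: p i) l = \sum_(i <- r) c i * poly_form n (p i) l.
Proof.
have p0 : poly_form n 0 l = 0.
  by have := poly_form_linear n (-1) 0 0 l; rewrite scaler0 addr0 mulN1r addNr.
by elim/big_rec2: _ => // i x y _ <-; rewrite poly_form_linear.
Qed.

Lemma multilinear_poly_form n p : multilinear (poly_form n p).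
Proof.
elim: n p => [|n IH] p; first exact: multilinear_leaf.
by apply: multilinear_blk => i; apply: IH.
Qed.

Lemma multilinear_wedge_form s : multilinear (wedge_form s).
Proof. by do 2!apply: multilinear_blk => ?; apply: multilinear_leaf. Qed.

(** The action on the factors omega_i is passed to the coefficients by [blk_even], where it becomes
    the twist A -> -A^T, the action on F(0,0,0,n). *)
Lemma poly_form_even n (X : L_even K) p l : (forall e, X e 0%MM = 0) ->
  tensor_act (coad_even X) id (poly_form n p) l =
  poly_form n (poly_act (- (linear_part X)^T) p) l.
Proof.
move=> X0; elim: n p l => [|n IH] p l; rewrite [poly_form _ _]/=.
  by rewrite leaf_act /= poly_act_coef0; case: l.
rewrite [LHS]blk_even //; apply: eq_blk => k t; rewrite IH poly_act_deriv.
rewrite -[X in _ - X]poly_form_sum -poly_formN -[X in X + _]mul1r -poly_form_linear scale1r.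
congr (poly_form n (_ + _) t); rewrite -sumrN.
by apply: eq_bigr => i _; rewrite !mxE scaleNr.
Qed.

Lemma poly_form_odd n (w : L_odd K) p l : (forall kl, w kl 0%MM = 0) ->
  tensor_act (coad_odd w) (@parity K) (poly_form n p) l = 0.
Proof.
move=> w0; elim: n p l => [|n IH] p l; first exact: leaf_act.
by rewrite [LHS]blk_odd // -[RHS](blk0 l); apply: eq_blk => k t; apply: IH.
Qed.

Section TestFunctional.
Variables (V : g0_module K) (f : V -> seq L -> K) (ys : seq L).
Hypothesis f_multilinear : forall v, multilinear (f v).
Hypothesis f_linear : forall c v v' l, f (c *: v + v') l = c * f v l + f v' l.
Hypothesis f_even : forall (X : L_even K) v l, (forall e, X e 0%MM = 0) ->
  tensor_act (coad_even X) id (f v) l = f (g0_act (linear_part X) v) l.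
Hypothesis f_odd : forall (w : L_odd K) v l, (forall kl, w kl 0%MM = 0) ->
  tensor_act (coad_odd w) (@parity K) (f v) l = 0.

(** The hypotheses make v -> f v equivariant under L_0, so that (u, v) -> (u f_v)(ys) is balanced
    over U(L_0). *)
Lemma test_functional : exists F : {linear Verma V -> K^o},
  forall u v, F (tens u v) = U_act u (f v) ys.
Proof.
pose T (u : UL K) v : K^o := U_act u (f v) ys.
have Tl c u u' v : T (c *: u + u') v = c *: T u v + T u' v by rewrite /T U_act_linearl.
have Tr u : linear (T u).
  move=> c v v'; rewrite /T.
  by rewrite (_ : f _ = fun l => c * f v l + f v' l) ?U_act_linear //; apply/funext.
have Te u X v : even_degs (>= 0) X -> T (u * of_even X) v = T u (g0_act (linear_part X) v).
  move=> X0; rewrite /T U_actM // U_act_even //; congr (U_act u _ ys); apply/funext => l.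
  by apply: f_even => e; apply: even_degs_at0.
have To u w v : odd_degs (>= 0) w -> T (u * of_odd w) v = 0.
  move=> w0; rewrite /T U_actM // U_act_odd // (_ : tensor_act _ _ _ = fun=> 0) ?U_act0 //.
  by apply/funext => l; rewrite f_odd // => kl; apply: odd_degs_at0.
pose F := GRing.isLinear.Build K (Verma V) K^o _ (Verma_lift T) (Verma_lift_linear Tl Tr Te To).
pose G : {linear Verma V -> K^o} := HB.pack (Verma_lift T) F.
by exists G => u v; apply: Verma_lift_tens.
Qed.
End TestFunctional.

End Functional.

(* A list of these stands for an element of a tensor power of L: (true, d)    *)
(* for d_ij, (false, (k, _)) for \partial_k.                                  *)
Definition Lcode := (bool * (nat * nat))%type.

Definition wf_Lcode (y : Lcode) := if y.1 then wfd y.2 else (y.2.1 < 5)%N.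

Definition code_sign (ys : seq Lcode) : int := (-1) ^+ odd (count fst ys).

(** A constant form d annihilates the entries ∂_k and replaces an entry d_lm by -[d, d_lm]. The
    Koszul rule contributes the parity of the odd entries that follow. *)
Fixpoint act_d (d : nat * nat) (ys : seq Lcode) : seq (int * seq Lcode) :=
  if ys is y :: t then
    (if y.1 then [seq (- (code_sign t * x.1), (false, (x.2, 0%N)) :: t) | x <- bracket_dd d y.2]
     else [::]) ++ [seq (x.1, y :: x.2) | x <- act_d d t]
  else [::].

Fixpoint act_word (u : seq (nat * nat)) (ys : seq Lcode) : seq (int * seq Lcode) :=
  if u is d :: u then lbind (act_d d ys) (act_word u) else [:: (1, ys)].

(** The value of omega_i on four coded elements; odd ones have vector field component 0. *)
Definition block_eps (i : nat) (ys : seq Lcode) : int :=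
  if ys is [:: x; y; z; t] then
    if [|| x.1, y.1, z.1 | t.1] then 0 else eps i x.2.1 y.2.1 z.2.1 t.2.1
  else 0.

Fixpoint eval_poly (n : nat) (b : seq nat) (ys : seq Lcode) : int :=
  if n is n.+1 then
    foldr (fun t a => block_eps (nth 0%N b t) (take 4 ys) *
                      eval_poly n (take t b ++ drop t.+1 b) (drop 4 ys) + a)
          0 (iota 0 (size b))
  else ((b == [::]) && (ys == [::]))%:Z.

Definition eval_wedge (b : seq nat) (ys : seq Lcode) : int :=
  if b is [:: i; j] then
    if size ys == 8%N then
      block_eps i (take 4 ys) * block_eps j (drop 4 ys) -
      block_eps j (take 4 ys) * block_eps i (drop 4 ys)
    else 0
  else 0.

Lemma eq_lc_in (K : numFieldType) (M : lmodType K) (T : eqType) (den den' : T -> M)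
    (l : seq (int * T)) :
  (forall x, x \in l -> den x.2 = den' x.2) -> lc den l = lc den' l.
Proof.
by move=> e; rewrite /lc big_seq [RHS]big_seq; apply: eq_bigr => t /e->.
Qed.

(** * Evaluation of the linear forms on coded tuples *)

Section CodeSemantics.
Variable K : numFieldType.
Local Notation L := (Lsuper K).

Definition Lelem (y : Lcode) : L :=
  if y.1 then (0, dform K (o5 y.2.1) (o5 y.2.2)) else (partial K (o5 y.2.1), 0).

Lemma act_d_wf d ys x : all wf_Lcode ys -> x \in act_d d ys -> all wf_Lcode x.2.
Proof.
elim: ys x => //= y t IH x /andP[wf_y wf_t]; rewrite mem_cat => /orP[|/mapP[z zin ->]].
  case: (y.1) => // /mapP[z]; rewrite mem_filter => /andP[_ /mapP[r]].
  by rewrite mem_iota => /andP[_ lt_r] -> -> /=; rewrite wf_t andbT.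
by rewrite /= wf_y IH.
Qed.

Lemma act_word_wf u ys x : all wf_Lcode ys -> x \in act_word u ys -> all wf_Lcode x.2.
Proof.
elim: u ys x => [|d u IH] ys x wf_ys /=; first by rewrite inE => /eqP->.
case/flatten_mapP => y yin /mapP[z zin ->] /=.
by apply: IH zin; apply: act_d_wf yin.
Qed.

Lemma multilinear_map_parity (f : seq L -> K) ys : multilinear f ->
  f (map (@parity K) (map Lelem ys)) = (code_sign ys)%:~R * f (map Lelem ys).
Proof.
rewrite /code_sign; elim: ys f => [|y t IH] f fl; first by rewrite mul1r.
rewrite [LHS]/= (IH (fun t => f (_ :: t))); last exact: multilinear_cons.
case: y => [[] d] /=; rewrite /Lelem /=; last by rewrite /parity /= oppr0.
have -> : parity (0, dform K (o5 d.1) (o5 d.2)) = (-1) ^+ true *: (0, dform K (o5 d.1) (o5 d.2)) :> L.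
  by rewrite expr1 scaleN1r; apply: Lsuper_eq; rewrite /= ?fst_opp ?snd_opp ?oppr0.
rewrite (multilinear_sign true [::]) // !rmorph_sign.
by case: (odd _); rewrite /= ?expr1 ?expr0 ?mulrA ?mulrNN ?mul1r.
Qed.

Lemma act_dP (f : seq L -> K) d ys : multilinear f -> wfd d -> all wf_Lcode ys ->
  U_act (dgen K d) f (map Lelem ys) =
  lc (fun x => f (map Lelem x) : K^o) (act_d d ys).
Proof.
move=> + wf_d; rewrite /dgen => + /[dup]; move=> fl wf _; move: wf.
rewrite U_act_odd //; elim: ys f fl => [|y t IH] f fl /=; first by rewrite lc_nil.
case/andP=> wf_y wf_t; rewrite lc_cat (IH (fun t => f (_ :: t))) //; last exact: multilinear_cons.
congr (_ + _); last by rewrite /lc big_map.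
rewrite (multilinear_map_parity (f := fun t => f (_ :: t))); last exact: multilinear_cons.
case: y wf_y => [[] e] /= wf_e; last first.
  rewrite lc_nil /Lelem /= (_ : coad_odd _ _ = 0); last first.
    apply: Lsuper_eq; rewrite /= ?linear0 ?oppr0 //.
    apply/eqP; rewrite oppr_eq0; apply/eqP; apply: val_inj; apply/ffunP => -[k l].
    rewrite [LHS]lie_deriv_dform !ffunE !fps_deriv_const !mul0rn !subr0 addr0 //.
  have f0 : f (0 :: map Lelem t) = 0.
    have := multilinear_head (map Lelem t) (-1) 0 0 fl.
    by rewrite scaler0 addr0 mulN1r addNr.
  by rewrite f0 mulr0.
rewrite /lc big_map /Lelem /=.
have -> : coad_odd (dform K (o5 d.1) (o5 d.2)) (0, dform K (o5 e.1) (o5 e.2)) =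
    \sum_(x <- bracket_dd d e) (- x.1%:~R : K) *: (partial K (o5 x.2), 0) :> L.
  apply: Lsuper_eq; rewrite (big_morph _ (@fst_add K) (erefl _), big_morph _ (@snd_add K) (erefl _)) /=.
    have -> : odd_bracket (dform K (o5 d.1) (o5 d.2)) (dform K (o5 e.1) (o5 e.2)) =
        lc (fun r => partial K (o5 r)) (bracket_dd d e).
      rewrite odd_bracket_dd // lc_bracket_dd; apply: eq_bigr => r _.
      by rewrite /o5 inord_val.
    by rewrite /lc -sumrN; apply: eq_bigr => x _; rewrite scaleNr.
  rewrite big1 => [|x _]; last by rewrite scaler0.
  have := even_odd_bracket_linearl (-1) 0 0 (dform K (o5 d.1) (o5 d.2)).
  by rewrite scaler0 addr0 scaleN1r addNr => ->; rewrite oppr0.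
elim: (bracket_dd d e) => [|x s IHs].
  rewrite !big_nil; have := multilinear_head (map Lelem t) (-1) 0 0 fl.
  by rewrite scaler0 addr0 mulN1r addNr => ->; rewrite mulr0.
rewrite !big_cons multilinear_head // mulrDr IHs; congr (_ + _).
by rewrite intrN intrM mulNr mulrN scaleNr -scalerA.
Qed.

Lemma act_wordP (f : seq L -> K) u ys : multilinear f -> all wfd u -> all wf_Lcode ys ->
  U_act (dword K u) f (map Lelem ys) =
  lc (fun x => f (map Lelem x) : K^o) (act_word u ys).
Proof.
move=> fl; elim: u ys => [|d u IH] ys /=.
  by move=> _ _; rewrite U_act1 // lc_seq1 scale1r.
case/andP=> wf_d wf_u wf_ys; rewrite U_actM // act_dP //; last exact: U_act_multilinear.
rewrite lc_bind; apply: (@eq_lc_in K K^o) => x xin.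
by rewrite IH //; apply: act_d_wf xin.
Qed.

Lemma eps_det (a b c d e : 'I_5) :
  \det (rows5 (delta_mx 0 a) (delta_mx 0 b) (delta_mx 0 c) (delta_mx 0 d) (delta_mx 0 e))
  = (eps a b c d e)%:~R :> K.
Proof.
set M := rows5 _ _ _ _ _.
have rM r : row r M = delta_mx 0 (nth a [:: a; b; c; d; e] r).
  by elim/ord5_ind: r; rewrite rowK.
have [eps0|] := eqVneq (eps a b c d e) 0.
  have [r [s [ne_rs eq_rs]]] : exists r s : 'I_5, r != s /\
      nth a [:: a; b; c; d; e] r = nth a [:: a; b; c; d; e] s.
    have cs0 (x y : 'I_5) : cmp_sign x y == 0 -> x = y.
      by rewrite cmp_signE sgz_eq0 subr_eq0 => /eqP[] /val_inj.
    move/eqP: eps0; rewrite /eps !mulf_eq0 -!orbA => h.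
    case/or4P: h => [/cs0 e1|/cs0 e1|/cs0 e1|/or4P[/cs0 e1|/cs0 e1|/cs0 e1|/or4P[/cs0 e1|/cs0 e1|/cs0 e1|/cs0 e1]]].
    + by exists i1, i2. + by exists i1, i3. + by exists i1, i4. + by exists i1, i5.
    + by exists i2, i3. + by exists i2, i4. + by exists i2, i5. + by exists i3, i4.
    + by exists i3, i5. + by exists i4, i5.
  rewrite eps0; apply: (determinant_alternate ne_rs) => j.
  by have := congr1 (fun v : 'rV_5 => v 0 j) (rM r); rewrite eq_rs -rM !mxE.
case/eps_inj=> s [s1 s2 s3 s4 s5].
have -> : M = perm_mx s.
  apply/matrixP => r j; have := congr1 (fun v : 'rV_5 => v 0 j) (rM r).
  rewrite mxE => ->; rewrite !mxE eqxx eq_sym; congr (_ == _)%:R.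
  by elim/ord5_ind: r; rewrite ?s1 ?s2 ?s3 ?s4 ?s5.
by rewrite det_perm -s1 -s2 -s3 -s4 -s5 -eps_perm rmorph_sign.
Qed.

Lemma block_epsP i x y z t : (i < 5)%N -> all wf_Lcode [:: x; y; z; t] ->
  omega (o5 i) (Lelem x) (Lelem y) (Lelem z) (Lelem t) = (block_eps i [:: x; y; z; t])%:~R :> K.
Proof.
move=> lt_i wf; rewrite /block_eps; case: ifP => [odd1|/negbT].
  rewrite omega0 //.
  have cv0 (u : Lcode) : u.1 -> cv (Lelem u) == 0.
    by rewrite /Lelem => ->; apply/eqP/rowP => j; rewrite !mxE /= ffunE.
  by case/or4P: odd1 => /cv0->; rewrite ?orbT.
case: x y z t wf => [[] x] [[] y] [[] z] [[] t] //=; rewrite /wf_Lcode /= !andbT.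
case/and4P=> lx ly lz lt _; rewrite -[RHS]/((eps i x.1 y.1 z.1 t.1)%:~R).
have cvE k : cv (Lelem (false, k)) = delta_mx 0 (o5 k.1).
  by apply/rowP => j; rewrite !mxE /Lelem /= ffunE /= eqxx mulr1n.
by rewrite /omega !cvE eps_det !o5K.
Qed.

End CodeSemantics.


Section Monomials.
Variable K : numFieldType.
Local Notation L := (Lsuper K).

Definition pmon (b : seq nat) : {mpoly K[5]} := \prod_(i <- b) 'X_(o5 i).

Definition del_nth (t : nat) (b : seq nat) := take t b ++ drop t.+1 b.

Lemma pmon_cons i b : pmon (i :: b) = 'X_(o5 i) * pmon b.
Proof. exact: big_cons. Qed.

Lemma pmon_deriv b k : (pmon b)^`M(k) =
  \sum_(t <- iota 0 (size b)) (o5 (nth 0%N b t) == k)%:R *: pmon (del_nth t b).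
Proof.
elim: b => [|i b IH]; first by rewrite /pmon big_nil mderivC big_nil.
rewrite pmon_cons mderivM mderivX1 IH.
rewrite (_ : iota 0 (size (i :: b)) = 0%N :: [seq t.+1 | t <- iota 0 (size b)]); last first.
  by rewrite /= (iotaDl 1 0).
rewrite big_cons; congr (_ + _).
  by rewrite /del_nth /= drop0 scaler_nat mulr_natl.
rewrite big_map mulr_sumr; apply: eq_bigr => t _.
by rewrite -scalerAr -pmon_cons.
Qed.

Lemma pmon_coef0 b : (pmon b)@_0 = (b == [::])%:R.
Proof.
case: b => [|i b]; first by rewrite /pmon big_nil mcoeff1 eqxx.
by rewrite pmon_cons rmorphM /= mcoeffX mnm1_eq0 mul0r.
Qed.

Lemma blk_codes (g : 'I_5 -> seq L -> K) ys : all wf_Lcode ys -> 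
  blk g (map (Lelem K) ys) =
  \sum_(i <- iota 0 5) (block_eps i (take 4 ys))%:~R * g (o5 i) (map (Lelem K) (drop 4 ys)).
Proof.
case: ys => [|x [|y [|z [|t ys]]]] wf.
- by rewrite big1 // => i _; rewrite mul0r.
- by rewrite big1 // => i _; rewrite mul0r.
- by rewrite big1 // => i _; rewrite mul0r.
- by rewrite big1 // => i _; rewrite mul0r.
have -> : take 4 [:: x, y, z, t & ys] = [:: x; y; z; t] by rewrite /= take0.
have -> : drop 4 [:: x, y, z, t & ys] = ys by rewrite /= drop0.
rewrite [LHS]/= sum_o5; apply: eq_big_seq => i; rewrite mem_iota => /andP[_ lt_i].
rewrite -(block_epsP K lt_i) //.
by move: wf; rewrite /= => /and5P[-> -> -> ->].
Qed.

Lemma eval_polyP n b ys : all (fun i => i < 5)%N b -> all wf_Lcode ys ->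
  poly_form n (pmon b) (map (Lelem K) ys) = (eval_poly n b ys)%:~R.
Proof.
elim: n b ys => [|n IH] b ys wf_b wf_ys.
  by rewrite /= pmon_coef0; case: ys wf_ys => [|y ys] _; case: eqP.
transitivity (blk (fun i => poly_form n (pmon b)^`M(i)) (map (Lelem K) ys)); first by [].
rewrite blk_codes //.
have eF : eval_poly n.+1 b ys = \sum_(t <- iota 0 (size b))
    block_eps (nth 0%N b t) (take 4 ys) * eval_poly n (del_nth t b) (drop 4 ys).
  by rewrite unlock /=.
rewrite eF rmorph_sum /=.
under eq_bigr do rewrite pmon_deriv poly_form_sum mulr_sumr.
rewrite exchange_big; apply: eq_big_seq => t; rewrite mem_iota => /andP[_ lt_t].
have lt_bt : (nth 0 b t < 5)%N by apply: (allP wf_b); apply: mem_nth.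
have in_bt : nth 0%N b t \in iota 0 5 by rewrite mem_iota.
rewrite (bigD1_seq _ in_bt (iota_uniq 0 5)) big1_seq; last first.
  move=> i /andP[ne_i]; rewrite mem_iota => /andP[_ lt_i].
  by rewrite -val_eqE /= !o5K // eq_sym (negPf ne_i) mul0r mulr0.
rewrite Monoid.mulm1 eqxx mul1r.
rewrite rmorphM IH //; last by apply/allP => y /mem_drop; apply/allP.
by apply/allP => y; rewrite mem_cat => h; apply: (allP wf_b); case/orP: h => [/mem_take|/mem_drop].
Qed.

Lemma block_eps_size i ys : size ys != 4%N -> block_eps i ys = 0.
Proof. by case: ys => [|? [|? [|? [|? [|? ?]]]]]. Qed.

Lemma eval_wedgeP i j ys : (i < 5)%N -> (j < 5)%N -> all wf_Lcode ys ->
  wedge_form (x_ K (o5 i) (o5 j)) (map (Lelem K) ys) = (eval_wedge [:: i; j] ys)%:~R.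
Proof.
move=> lt_i lt_j wf_ys; rewrite [LHS]blk_codes //.
have wf_d : all wf_Lcode (drop 4 ys) by apply/allP => y /mem_drop; apply/allP.
under eq_bigr do rewrite blk_codes // drop_drop.
rewrite /eval_wedge; case: ltngtP => [lt8|gt8|eq8].
- rewrite big1 // => a _; rewrite big1 ?mulr0 // => b _; rewrite block_eps_size ?mul0r //.
  by rewrite size_take size_drop; move: (size ys) lt8 => [|[|[|[|[|[|[|[|?]]]]]]]].
- have ne : drop (4 + 4) ys != [::] by rewrite -size_eq0 size_drop subn_eq0 -ltnNge.
  rewrite big1 // => a _; rewrite big1 ?mulr0 // => b _.
  by case: (drop _ ys) ne => //= *; rewrite mulr0.
have -> : drop (4 + 4) ys = [::] by apply: drop_oversize; rewrite eq8.
have -> : take 4 (drop 4 ys) = drop 4 ys by apply: take_oversize; rewrite size_drop eq8.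
have pick2 (F : nat -> nat -> K) p q : (p < 5)%N -> (q < 5)%N ->
    \sum_(a <- iota 0 5) \sum_(b <- iota 0 5) F a b * ((o5 a == o5 p) && (o5 b == o5 q))%:R = F p q.
  move=> lt_p lt_q.
  have o5_eq a b : (a < 5)%N -> (b < 5)%N -> (o5 a == o5 b) = (a == b).
    by move=> la lb; rewrite -val_eqE /= !o5K.
  have in5 a : (a < 5)%N -> a \in iota 0 5 by rewrite mem_iota.
  rewrite (bigD1_seq _ (in5 _ lt_p) (iota_uniq 0 5)) (bigD1_seq _ (in5 _ lt_q) (iota_uniq 0 5)).
  rewrite !big1_seq ?Monoid.mulm1 ?eqxx ?mulr1 // => a /andP[ne_a]; rewrite mem_iota => /andP[_ lt_a].
    by rewrite big1 // => b _; rewrite o5_eq // (negPf ne_a) mulr0.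
  by rewrite o5_eq // (negPf ne_a) mulr0.
pose G a b := (block_eps a (take 4 ys))%:~R * (block_eps b (drop 4 ys))%:~R : K.
rewrite intrB !intrM -/(G i j) -/(G j i) -(pick2 G i j) // -(pick2 G j i) // -sumrB.
apply: eq_bigr => a _; rewrite mulr_sumr -sumrB; apply: eq_bigr => b _.
by rewrite /= !mxE mulrBr mulrBr !mulrA.
Qed.

End Monomials.

(** * Singular vectors *)

Section Collapse.
Variable T : eqType.

Fixpoint add_term (c : int) (x : T) (l : seq (int * T)) : seq (int * T) :=
  if l is (c', y) :: l' then
    if y == x then (c + c', y) :: l' else (c', y) :: add_term c x l'
  else [:: (c, x)].

Definition collapse (l : seq (int * T)) : seq (int * T) :=
  [seq t <- foldr (fun t => add_term t.1 t.2) [::] l | t.1 != 0].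

Lemma collapseP (K : numFieldType) (M : lmodType K) (den : T -> M) l :
  lc den (collapse l) = lc den l.
Proof.
rewrite lc_filter0; elim: l => // -[c x] l IH; rewrite lc_cons -IH /=.
elim: (foldr _ _ l) {IH} => [|[c' y] l' IH] /=; first by rewrite lc_cons.
case: eqP => [->|_]; rewrite !lc_cons; first by rewrite intrD scalerDl addrA.
by rewrite IH addrCA.
Qed.
End Collapse.

Definition word := seq (nat * nat).

Definition dsort (i j : nat) : seq (int * (nat * nat)) :=
  if (i < j)%N then [:: (1, (i, j))] else if (j < i)%N then [:: (-1, (j, i))] else [::].

(* ad (x_p \partial_1); indices of words start at 0. *)
Fixpoint ad_word (p : nat) (w : word) : seq (int * word) :=
  if w is d :: t then
    (if d.1 == 0%N then [seq (x.1, x.2 :: t) | x <- dsort p d.2] else [::]) ++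
    [seq (x.1, d :: x.2) | x <- ad_word p t]
  else [::].

Definition hw_word : word := [:: (0, 1); (0, 2); (0, 3); (0, 4)]%N.

Fixpoint raised (s : seq nat) : seq (int * word) :=
  if s is p :: s then lbind (raised s) (ad_word p) else [:: (1, hw_word)].

(* x_p \partial_1 maps z_1^k z^a to k z_1^(k-1) z_p z^a, so that raised s is   *)
(* 3! / (3 - r)! iota (z_1^(3-r) z^s) for s of size r <= 3: the coefficient   *)
(* (3 - r)! turns it into 6 iota.                                             *)
Definition iota_words (b : seq nat) : seq (int * word) :=
  let s := [seq i <- b | i != 0%N] in
  [seq (nth 1 [:: 6; 2] (size s) * t.1, t.2) | t <- raised s].

Definition triples : seq (seq nat) :=
  flatten [seq flatten [seq [seq [:: i; j; k] | k <- iota 0 5] | j <- iota 0 5] | i <- iota 0 5].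

Definition sort_nat (s : seq nat) : seq nat := foldr insn [::] s.

(* 6 \sum_a u_a \otimes z^a, the image of 6 under t_BC. *)
Definition BC_expr : expr :=
  collapse (flatten [seq [seq (t.1, (t.2, sort_nat b)) | t <- iota_words b] | b <- triples]).

(** The index that [o5] gives to n. With it the formulas [actSP] and [actWP] hold for every code,
    which is the form of the hypothesis [actP]. *)
Definition clip5 (n : nat) := if (n < 5)%N then n else 0%N.

(** In the dual module x_k ∂_e sends z_k^* to minus z_e^* and kills the other generators; by Leibniz
    each occurrence is replaced in turn. *)
Definition actS (k e : nat) (b : seq nat) : seq (int * seq nat) :=
  [seq (-1, insn e (del_nth t b)) | t <- iota 0 (size b) & clip5 (nth 0%N b t) == k].

Definition actW (k e : nat) (b : seq nat) : seq (int * seq nat) :=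
  if b is [:: i; j] then
    (if clip5 i == k then [seq (- x.1, [:: x.2.1; x.2.2]) | x <- dsort e (clip5 j)] else [::]) ++
    (if clip5 j == k then [seq (- x.1, [:: x.2.1; x.2.2]) | x <- dsort (clip5 i) e] else [::])
  else [::].

Definition act0 (k e : nat) (b : seq nat) : seq (int * seq nat) := [::].

Definition dpairs : seq (nat * nat) :=
  flatten [seq [seq (k, l) | l <- iota k.+1 (4 - k)] | k <- iota 0 5].
Definition C_expr : expr := [seq (1, ([:: d], [:: d.1; d.2])) | d <- dpairs].
Definition hw_expr : expr := [:: (1, (hw_word, [::]))].

(** Order 1 is tested for [BC_expr] and [C_expr]: their morphisms start from the trivial module, so
    linear fields must kill them as well. For the highest weight vector order 2 is enough, since g_0
    acts on N by ad. *)
Lemma BC_expr_even : check_even actS 1 BC_expr. Proof. by vm_compute. Qed.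
Lemma BC_expr_odd : check_odd actS BC_expr. Proof. by vm_compute. Qed.
Lemma C_expr_even : check_even actW 1 C_expr. Proof. by vm_compute. Qed.
Lemma C_expr_odd : check_odd actW C_expr. Proof. by vm_compute. Qed.
Lemma hw_expr_even : check_even act0 2 hw_expr. Proof. by vm_compute. Qed.
Lemma hw_expr_odd : check_odd act0 hw_expr. Proof. by vm_compute. Qed.

(** * Coded vectors of the coefficient modules *)

Section CoefficientModules.
Variable K : numFieldType.

Lemma clip5E n : o5 n = clip5 n :> nat.
Proof. by rewrite /clip5; case: ltnP => [/o5K//|le5n]; rewrite /o5 /inord /insubd insubN // -leqNgt. Qed.

Lemma o5_eq n (k : 'I_5) : (clip5 n == k) = (o5 n == k).
Proof. by rewrite -val_eqE /= clip5E. Qed.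

Definition mon (b : seq nat) : 'X_{1..5} := (\sum_(i <- b) U_(o5 i))%MM.

Lemma pmonE b : pmon K b = 'X_[mon b].
Proof.
elim: b => [|i b IH]; first by rewrite /pmon /mon !big_nil mpolyX0.
by rewrite pmon_cons /mon big_cons mpolyXD IH.
Qed.

Lemma mdeg_mon b : mdeg (mon b) = size b.
Proof. by rewrite mdeg_sum (eq_bigr (fun=> 1%N)) => [|i _]; rewrite ?mdeg1 // sum1_size. Qed.

Lemma pmon_homog n b : (pmon K b \is n.-homog) = (size b == n).
Proof. by rewrite pmonE dhomogX /= mdeg_mon. Qed.

Definition symv n (b : seq nat) : dhomog 5 K n := ['dhomog_n (pmon K b)].

Lemma symvE n b : symv n b = (if size b == n then pmon K b else 0) :> {mpoly K[5]}.
Proof.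
rewrite /symv /indhomog -pmon_homog; case: ifP => h; first exact: (insubdK _ h).
by rewrite /insubd insubN ?h.
Qed.

Lemma insn_perm e s : perm_eq (insn e s) (e :: s).
Proof.
elim: s => //= x s IH; case: leqP => // _.
by rewrite -(perm_cons x) in IH; apply: perm_trans IH _; rewrite (perm_catCA [:: x] [:: e]).
Qed.

Lemma pmon_perm s t : perm_eq s t -> pmon K s = pmon K t.
Proof. exact: perm_big. Qed.

Lemma size_insn e s : size (insn e s) = (size s).+1.
Proof. exact: perm_size (insn_perm e s). Qed.

Lemma size_del_nth t (b : seq nat) : (t < size b)%N -> size (del_nth t b) = (size b).-1.
Proof.
move=> lt_t; rewrite size_cat size_drop size_takel ?(ltnW lt_t) //.
by rewrite addnBA // subnS addKn.
Qed.

Lemma actSP n (A : 'M[K]_5) b : g0_act A (symv n b : SymDual K n) =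
  \sum_(k < 5) \sum_(e < 5) A k e *: lc (symv n) (actS k e b).
Proof.
apply: val_inj; rewrite [LHS]/= /poly_act exchange_big [RHS](linear_sum (@mpoly_of_dhomog 5 K n)).
apply: eq_bigr => k _; rewrite (linear_sum (@mpoly_of_dhomog 5 K n)); apply: eq_bigr => e _.
rewrite !mxE (linearZ_LR (@mpoly_of_dhomog 5 K n)) scaleNr -scalerN; congr (_ *: _).
rewrite (lc_linear (@mpoly_of_dhomog 5 K n)) /lc /actS big_map big_filter symvE.
have [eq_n|ne_n] := eqVneq (size b) n; last first.
  rewrite linear0 mulr0 oppr0 big_seq_cond big1 // => t /andP[]; rewrite mem_iota => /andP[_ lt_t] _.
  by rewrite /= symvE size_insn size_del_nth // prednK ?(negPf ne_n) ?scaler0 //; apply: leq_ltn_trans (leq0n t) lt_t.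
rewrite pmon_deriv mulr_sumr -sumrN [RHS]big_mkcond; apply: eq_big_seq => t.
rewrite mem_iota => /andP[_ lt_t]; rewrite o5_eq; case: ifP => _; last first.
  by rewrite scale0r mulr0 oppr0.
rewrite /= symvE size_insn size_del_nth // prednK ?eq_n ?eqxx; last by rewrite -eq_n; apply: leq_ltn_trans (leq0n t) lt_t.
by rewrite scale1r scaleN1r (pmon_perm (insn_perm _ _)) pmon_cons /o5 inord_val.
Qed.

Lemma z_E n a : mdeg a = n -> z_ K n a = 'X_[a] :> {mpoly K[5]}.
Proof.
move=> deg_a; have h : ('X_[a] : {mpoly K[5]}) \is n.-homog by rewrite dhomogX /= deg_a.
exact: (insubdK _ h).
Qed.

Definition wedgev (b : seq nat) : wedge2 K := if b is [:: i; j] then x_ K (o5 i) (o5 j) else 0.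

Lemma x_C i j : x_ K i j = - x_ K j i.
Proof. by apply: val_inj; rewrite /= opprB. Qed.

Lemma lc_dsort (i j : 'I_5) :
  lc wedgev [seq (- x.1, [:: x.2.1; x.2.2]) | x <- dsort i j] = - x_ K i j.
Proof.
rewrite /dsort; case: ltngtP => [_|_|/val_inj->]; rewrite ?lc_seq1 ?lc_nil /= /o5 ?inord_val ?scaleN1r //.
  by rewrite opprK scale1r x_C.
by apply: val_inj; rewrite /= subrr oppr0.
Qed.

Lemma mul_delta (A : 'M[K]_5) i j :
  (A^T *m delta_mx i j = \sum_e A i e *: delta_mx e j) *
  (delta_mx i j *m A = \sum_e A j e *: delta_mx i e).
Proof.
split; apply/matrixP => a b; rewrite mxE summxE.
  rewrite (bigD1 i) //= big1 ?addr0 => [|k /negPf ne]; last by rewrite !mxE ne mulr0.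
  rewrite (bigD1 a) //= big1 ?addr0 => [|k /negPf ne]; last by rewrite !mxE eq_sym ne mulr0.
  by rewrite !mxE !eqxx.
rewrite (bigD1 j) //= big1 ?addr0 => [|k /negPf ne]; last by rewrite !mxE ne andbF mul0r.
rewrite (bigD1 b) //= big1 ?addr0 => [|k /negPf ne]; last by rewrite !mxE [b == _]eq_sym ne andbF mulr0.
by rewrite !mxE !eqxx !andbT mulrC.
Qed.

Lemma actWP (A : 'M[K]_5) b : g0_act A (wedgev b : WedgeDual K) =
  \sum_(k < 5) \sum_(e < 5) A k e *: lc wedgev (actW k e b).
Proof.
have sum0 : \sum_(k < 5) \sum_(e < 5) A k e *: lc wedgev [::] = 0.
  by rewrite big1 // => k _; rewrite big1 // => e _; rewrite lc_nil scaler0.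
have act0 : wedge2_act (- A^T) 0 = 0 by apply: val_inj; rewrite /= mulmx0 mul0mx addr0.
case: b => [|i [|j [|l b]]]; [exact: etrans act0 (esym sum0)|exact: etrans act0 (esym sum0)| |exact: etrans act0 (esym sum0)].
transitivity (\sum_k (\sum_e A k e *: - ((o5 i == k)%:R *: x_ K e (o5 j))
                     + \sum_e A k e *: - ((o5 j == k)%:R *: x_ K (o5 i) e))); last first.
  apply: eq_bigr => k _; rewrite -big_split; apply: eq_bigr => e _.
  rewrite [LHS](esym (scalerDr _ _ _)) /actW lc_cat !o5_eq -!clip5E; congr (_ *: (_ + _)).
    by case: eqP; rewrite ?lc_dsort ?lc_nil ?scale1r ?scale0r ?oppr0.
  by case: eqP; rewrite ?lc_dsort ?lc_nil ?scale1r ?scale0r ?oppr0.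
have pick (G : 'I_5 -> 'I_5 -> wedge2 K) a :
    \sum_k \sum_e A k e *: - ((a == k)%:R *: G k e) = - \sum_e A a e *: G a e.
  rewrite (bigD1 a) //= [X in _ + X]big1 ?addr0 => [|k ne].
    by rewrite -sumrN; apply: eq_bigr => e _; rewrite eqxx scale1r scalerN.
  by rewrite big1 // => e _; rewrite eq_sym (negPf ne) scale0r oppr0 scaler0.
rewrite big_split (pick (fun _ e => x_ K e (o5 j))) (pick (fun _ e => x_ K (o5 i) e)).
apply: val_inj; rewrite [LHS]/= linearN /= trmxK mulNmx mulmxN.
rewrite -opprD -[RHS]opprD; congr (- _).
have valS (F : 'I_5 -> wedge2 K) : wedge2_mx (\sum_e F e) = \sum_e wedge2_mx (F e).
  by apply: (big_morph (@wedge2_mx K)).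
have sumB (c : 'I_5 -> K) (F G : 'I_5 -> 'M[K]_5) :
    \sum_e c e *: (F e - G e) = \sum_e c e *: F e - \sum_e c e *: G e.
  by rewrite -sumrB; apply: eq_bigr => e _; rewrite scalerBr.
rewrite (valS (fun e => A (o5 i) e *: _)) (valS (fun e => A (o5 j) e *: _)) /= !sumB.
rewrite mulmxBr mulmxBl !mul_delta addrACA [X in _ + X]addrC.
by rewrite [RHS]addrACA.
Qed.
End CoefficientModules.

(** * Linear vector fields and orders of vanishing at 0 *)

Section LinearFields.
Variable K : numFieldType.
Local Notation D := (@fps_deriv 5 K).

Definition fps_var (i : 'I_5) : fps 5 K := FPS (fun m => (m == U_(i)%MM)%:R).

Lemma fps_deriv_var i j : D i (fps_var j) = fps_const 5 (i == j)%:R.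
Proof.
apply: fpsP => m /=; have [->|m0] := eqVneq m 0%MM.
  by rewrite add0m mnm0E mulr1n eq_mnm1 eq_sym.
rewrite mulr0n (_ : (_ == _) = false) ?mul0rn //; apply: contraNF m0 => /eqP e.
have := congr1 mdeg e; rewrite mdegD !mdeg1 addn1 => -[/eqP].
by rewrite mdeg_eq0.
Qed.

Definition lin_field (A : 'M[K]_5) : vfield K := [ffun j => \sum_i A i j *: fps_var i].

Lemma deriv_lin_field A k j : D k (lin_field A j) = fps_const 5 (A k j).
Proof.
rewrite ffunE linear_sum (bigD1 k) //= big1 ?addr0 => [|i ne_i].
  by rewrite linearZ /= fps_deriv_var eqxx; apply: fpsP => m; rewrite /= mulrnAr mulr1.
rewrite linearZ /= fps_deriv_var eq_sym (negPf ne_i).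
by apply: fpsP => m; rewrite /= mul0rn mulr0.
Qed.

Lemma lin_field_divfree A : \tr A = 0 -> lin_field A \in @divfree K.
Proof.
move=> trA; apply/eqP; rewrite /divergence; under eq_bigr do rewrite deriv_lin_field.
apply: fpsP => m; rewrite fps_coef_sum /= sumrMnl.
by rewrite -[X in X *+ _]/(\tr A) trA mul0rn.
Qed.

Lemma lin_fieldE A j m : lin_field A j m = \sum_i A i j * (m == U_(i)%MM)%:R.
Proof. by rewrite ffunE fps_coef_sum. Qed.

Lemma linear_part_lin A (trA : \tr A = 0) : linear_part (LEven (lin_field_divfree trA)) = A.
Proof.
apply/matrixP => i j; rewrite mxE [LHS]lin_fieldE (bigD1 i) //= eqxx mulr1 big1 ?addr0 // => k ne.
by rewrite eq_mnm1 eq_sym (negPf ne) mulr0.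
Qed.

Lemma lin_field_coef A j m : mdeg m != 1 -> lin_field A j m = 0.
Proof.
move=> m1; rewrite lin_fieldE big1 // => i _; case: eqP => [e|_]; last exact: mulr0.
by rewrite e mdeg1 eqxx in m1.
Qed.

Lemma lin_field_degs A (trA : \tr A = 0) : even_degs (pred1 0) (LEven (lin_field_divfree trA)).
Proof.
move=> e m; apply: contraR => m1; rewrite [X in X == 0]/= lin_field_coef //.
by apply: contra m1 => /eqP->.
Qed.

Lemma even_bracket_lin A (trA : \tr A = 0) i :
  even_bracket (LEven (lin_field_divfree trA)) (partial K i) =
  \sum_j (- A i j) *: partial K j.
Proof.
apply: val_inj; apply/ffunP => j; apply: fpsP => m.
rewrite [RHS]even_sum [LHS](_ : _ = vf_bracket (lin_field A) (partial K i) j m) //.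
have pE a b : partial K b a = fps_const 5 (a == b)%:R :> fps 5 K by rewrite ffunE.
have c0 : fps_const 5 0 = 0 :> fps 5 K by apply: fpsP => k; rewrite /= mul0rn.
have c1 : fps_const 5 1 = 1 :> fps 5 K by [].
rewrite ffunE; under eq_bigr do rewrite !pE !fps_deriv_const mulr0 sub0r.
rewrite (bigD1 i) // big1 => [|a ne]; last by rewrite (negPf ne) c0 mul0r oppr0.
rewrite Monoid.mulm1 eqxx c1 mul1r deriv_lin_field (bigD1 j) // big1 => [|a ne]; last first.
  by rewrite evenZ partialE eq_sym (negPf ne) mulr0.
rewrite Monoid.mulm1 evenZ partialE eqxx /=.
by case: (m == _); rewrite ?mulr1 ?mulr0 ?oppr0.
Qed.

Lemma lie_deriv_lin A i j (trA : \tr A = 0) :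
  even_odd_bracket (LEven (lin_field_divfree trA)) (dform K i j) =
  \sum_k (A k i *: dform K k j + A k j *: dform K i k).
Proof.
apply: val_inj; apply/ffunP => -[k l]; apply: fpsP => m.
rewrite [LHS](congr1 (fun f : fps 5 K => f m) (lie_deriv_dform _ _ _ _ _)) [RHS]odd_sum.
under [RHS]eq_bigr do rewrite oddD !oddZ !dformE.
have cE (c : K) : fps_const 5 c m = c *+ (m == 0%MM) by [].
rewrite !deriv_lin_field !(fps_coefD, fps_coefN, fps_coefMn) !cE.
have [_|_] := eqVneq m 0%MM; last first.
  rewrite !(mulr0n, mul0rn, oppr0, addr0) big1 // => a _.
  by rewrite !mulr0n !mulr0 addr0.
pose G a : K^o := ((a == k) && (l == j))%:R *: (A a i : K^o) - ((a == l) && (k == j))%:R *: (A a i : K^o)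
  + (((a == l) && (k == i))%:R *: (A a j : K^o) - ((a == k) && (l == i))%:R *: (A a j : K^o)).
transitivity (\sum_a G a); last first.
  apply: eq_bigr => a _; rewrite /G !xpair_eqE !mulr1n !mulrBr !(mulrC (A a _)).
  by rewrite ![a == _]eq_sym [(k == j) && _]andbC [(k == i) && _]andbC.
rewrite big_split !sumrB !sum_pick !mulr1n.
rewrite -[RHS]/(_ - _ + (_ - _) : K); ring.
Qed.

End LinearFields.

Section Orders.
Variable K : numFieldType.
Local Notation D := (@fps_deriv 5 K).

Definition ord_ge (n : nat) (f : fps 5 K) := forall m, (mdeg m < n)%N -> f m = 0.

Lemma ord_geD n f g : ord_ge n f -> ord_ge n g -> ord_ge n (f + g).
Proof. by move=> f0 g0 m lt_m; rewrite fps_coefD f0 ?g0 ?addr0. Qed.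

Lemma ord_geN n f : ord_ge n f -> ord_ge n (- f).
Proof. by move=> f0 m lt_m; rewrite fps_coefN f0 ?oppr0. Qed.

Lemma ord_ge_sum n (I : Type) (r : seq I) (P : pred I) (F : I -> fps 5 K) :
  (forall i, P i -> ord_ge n (F i)) -> ord_ge n (\sum_(i <- r | P i) F i).
Proof. by move=> F0 m lt_m; rewrite fps_coef_sum big1 // => i Pi; apply: F0. Qed.

Lemma ord_geM a b n f g : ord_ge a f -> ord_ge b g -> (n <= a + b)%N -> ord_ge n (f * g).
Proof.
move=> f0 g0 le_n m lt_m; rewrite [LHS]/= /fps_mul /= big1 // => k /eqP def_m.
have : (mdeg (bmnm k.1) + mdeg (bmnm k.2) < a + b)%N by rewrite -mdegD -def_m; apply: leq_trans le_n.
case: (ltnP (mdeg (bmnm k.1)) a) => [/f0->|le_a]; first by rewrite mul0r.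
case: (ltnP (mdeg (bmnm k.2)) b) => [/g0->|le_b]; first by rewrite mulr0.
by rewrite ltnNge leq_add.
Qed.

Lemma ord_ge_deriv n i f : ord_ge n.+1 f -> ord_ge n (D i f).
Proof. by move=> f0 m lt_m; rewrite /= f0 ?mul0rn // mdegD mdeg1 addn1. Qed.

Lemma ord_ge0 f : ord_ge 0 f. Proof. by []. Qed.

Lemma ord_vf_bracket (X Y : vfield K) : (forall e, ord_ge 2 (X e)) -> (forall e, ord_ge 1 (Y e)) ->
  forall e, ord_ge 2 (vf_bracket X Y e).
Proof.
move=> X2 Y1 e; rewrite ffunE; apply: ord_ge_sum => i _; apply: ord_geD.
  exact: (ord_geM (X2 i) (ord_ge0 _)).
by apply: ord_geN; apply: ord_geM (Y1 i) (ord_ge_deriv i (X2 e)) _.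
Qed.

Lemma ord_lie_deriv (Y : vfield K) (w : form2 K) : (forall e, ord_ge 1 (Y e)) ->
  (forall kl, ord_ge 1 (w kl)) -> forall kl, ord_ge 1 (lie_deriv Y w kl).
Proof.
move=> Y1 w1 kl; rewrite ffunE; apply: ord_ge_sum => i _; apply: ord_geD; first apply: ord_geD.
- exact: (ord_geM (Y1 i) (ord_ge0 _)).
- exact: (ord_geM (ord_ge0 _) (w1 _)).
- exact: (ord_geM (ord_ge0 _) (w1 _)).
Qed.

Lemma ord1P (f : fps 5 K) : ord_ge 1 f <-> f 0%MM = 0.
Proof.
by split=> [f1|f0 m]; [rewrite f1 ?mdeg0|rewrite ltnS leqn0 mdeg_eq0 => /eqP->].
Qed.

Lemma even_degs0_ord (Y : L_even K) : even_degs (pred1 0) Y -> forall e, ord_ge 1 (Y e).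
Proof.
by move=> Y0 e; apply/ord1P; apply/eqP; apply: contraT => /Y0; rewrite /= mdeg0.
Qed.

Lemma even_degs_ge0 (Y : L_even K) : even_degs (pred1 0) Y -> even_degs (>= 0) Y.
Proof. by move=> Y0 e m /Y0 /eqP->. Qed.

Definition lin_of (X : L_even K) : L_even K := LEven (lin_field_divfree (trace_linear_part X)).

Lemma ord_nlin (X : L_even K) : even_degs (>= 0) X -> forall e, ord_ge 2 ((X - lin_of X) e).
Proof.
move=> X0 e m; rewrite evenD evenN ltnS leq_eqVlt ltnS leqn0 mdeg_eq0 => /orP[/mdeg1P[i /eqP->]|/eqP->].
  have := congr1 (fun M : 'M_5 => M i e) (linear_part_lin (trace_linear_part X)).
  by rewrite !mxE => ->; rewrite subrr.
by rewrite (even_degs_at0 _ X0) [X in _ - X]lin_field_coef ?mdeg0 ?subrr.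
Qed.

Lemma lin_of_homog (X : L_even K) : even_degs (pred1 0) X -> lin_of X = X.
Proof.
move=> X0; apply: val_inj; apply/ffunP => e; apply: fpsP => m.
have [m1|m1] := eqVneq (mdeg m) 1%N; last first.
  rewrite [LHS]lin_field_coef //; apply/esym/eqP; apply: contraR m1 => /X0 /=.
  by case: (mdeg m) => [|[|k]] //; rewrite !mulSn.
have := ord_nlin (even_degs_ge0 X0) e; move/(_ m); rewrite m1 => /(_ isT) /eqP.
by rewrite evenD evenN subr_eq0 => /eqP.
Qed.
End Orders.

(** * Morphisms with a trivial module as source or target *)

Section AdjointAction.
Variable K : numFieldType.
Implicit Types (X Y : L_even K) (w : L_odd K) (u v : UL K).

Fact ad_linear X : linear (ad X).
Proof.
move=> c u v; rewrite /ad mulrDr mulrDl -scalerAr -scalerAl scalerBr opprD.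
by rewrite addrACA.
Qed.

HB.instance Definition _ X := GRing.isLinear.Build K (UL K) (UL K) _ (ad X) (ad_linear X).

Lemma adM X u v : ad X (u * v) = ad X u * v + u * ad X v.
Proof. by rewrite /ad mulrBl mulrBr !mulrA addrA subrK. Qed.

Lemma ad1 X : ad X 1 = 0.
Proof. by rewrite /ad mulr1 mul1r subrr. Qed.

Lemma ad_odd X w : ad X (of_odd w) = of_odd (even_odd_bracket X w).
Proof. by rewrite /ad of_even_odd addrC addKr. Qed.

Lemma ad_even X Y : ad X (of_even Y) = of_even (even_bracket X Y).
Proof. by rewrite /ad of_even_even addrC addKr. Qed.

Lemma even_at0_degs X : (forall e, X e 0%MM = 0) -> even_degs (>= 0) X.
Proof.
move=> X0 e m; case: (eqVneq m 0%MM) => [->|m0 _]; first by rewrite X0 eqxx.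
rewrite -mdeg_eq0 -lt0n in m0; rewrite subr_ge0 lez_nat.
by case: (mdeg m) m0 => // k _; rewrite mulSn.
Qed.

Lemma odd_at0_degs w : (forall kl, w kl 0%MM = 0) -> odd_degs (>= 0) w.
Proof.
move=> w0 e m; case: (eqVneq m 0%MM) => [->|m0 _]; first by rewrite w0 eqxx.
rewrite -mdeg_eq0 -lt0n in m0; rewrite subr_ge0 lez_nat.
by case: (mdeg m) m0 => // k _; rewrite mulSn.
Qed.

Section Modules.
Variables A B : g0_module K.

Lemma tens_ad X u (b : B) :
  tens (of_even X * u) b = tens (ad X u) b + tens (u * of_even X) b.
Proof. by rewrite -tensDl /ad subrK. Qed.

Lemma scalar_source (lam : A -> K) (Phi : Verma B) :
    (forall c a a', lam (c *: a + a') = c * lam a + lam a') ->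
    (forall M a, \tr M = 0 -> lam (g0_act M a) = 0) ->
    (forall X, (forall e, X e 0%MM = 0) -> Verma_act (of_even X) Phi = 0) ->
    (forall w, (forall kl, w kl 0%MM = 0) -> Verma_act (of_odd w) Phi = 0) ->
  exists phi : Verma A -> Verma B,
    L_morphism phi /\ forall u a, phi (tens u a) = lam a *: Verma_act u Phi.
Proof.
move=> lamL lam0 PhiE PhiO.
have [| | |phi [Lphi phiE]] := @Verma_morphism K A B (fun a => lam a *: Phi).
- by move=> c a a'; rewrite lamL scalerDl scalerA.
- move=> X a X0; rewrite lam0 ?trace_linear_part // scale0r.
  by rewrite (linearZ_LR (Verma_act (of_even X))) /= PhiE ?scaler0 // => e; apply: even_degs_at0.
- move=> w a w0; rewrite (linearZ_LR (Verma_act (of_odd w))) /= PhiO ?scaler0 // => kl.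
  exact: odd_degs_at0.
- by exists phi; split=> // u a; rewrite phiE (linearZ_LR (Verma_act u)).
Qed.

Variable b : B.
Hypothesis b0 : forall M, g0_act M b = 0.

Lemma tens_even0 u X : even_degs (>= 0) X -> tens (u * of_even X) b = 0.
Proof. by move=> X0; rewrite tens_even // b0 (linear0 (@tens K B u)). Qed.

(** Fields are required to vanish to order 2: the linear ones are handled by equivariance, and this
    restriction makes the property stable under ad g_0. *)
Definition killed u :=
  (forall X, (forall e, ord_ge 2 (X e)) -> tens (of_even X * u) b = 0) /\
  (forall w, (forall kl, w kl 0%MM = 0) -> tens (of_odd w * u) b = 0).

Lemma killed_linear c u v : killed u -> killed v -> killed (c *: u + v).
Proof.
move=> [uE uO] [vE vO]; split=> [X X2|w w0].
  by rewrite mulrDr -scalerAr tensDl tensZl uE ?vE ?scaler0 ?addr0.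
by rewrite mulrDr -scalerAr tensDl tensZl uO ?vO ?scaler0 ?addr0.
Qed.

Lemma killed0 : killed 0.
Proof. by split=> *; rewrite mulr0 tens0l. Qed.

Lemma killed_sum (I : finType) (F : I -> UL K) : (forall i, killed (F i)) -> killed (\sum_i F i).
Proof.
move=> Fk; apply: big_rec => [|i u _ uk]; first exact: killed0.
by rewrite -[F i]scale1r; apply: killed_linear.
Qed.

(** X ad(Y)(u) = Y X u + [X, Y] u - X u Y, where [X, Y] again vanishes to order 2 and Y kills b;
    likewise for a form w. *)
Lemma killed_ad Y u : even_degs (pred1 0) Y -> killed u -> killed (ad Y u).
Proof.
move=> Y0 [uE uO]; have Yge := even_degs_ge0 Y0.
have actY v : tens v b = 0 -> tens (of_even Y * v) b = 0.
  by move=> v0; rewrite -Verma_act_tens v0 (linear0 (Verma_act (of_even Y))).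
split=> [X X2|w w0]; rewrite /ad mulrBr tensDl tensNl !mulrA (tens_even0 _ Yge) subr0.
  rewrite of_even_even mulrDl tensDl -mulrA actY ?uE ?add0r // => e.
  exact: ord_vf_bracket X2 (even_degs0_ord Y0) e.
have -> : of_odd w * of_even Y = of_even Y * of_odd w - of_odd (even_odd_bracket Y w).
  by rewrite of_even_odd addrK.
rewrite mulrBl tensDl tensNl -mulrA actY ?uO ?subrr // => kl; apply/ord1P.
by apply: ord_lie_deriv (even_degs0_ord Y0) _ kl => kl'; apply/ord1P.
Qed.

(** An even element of L_0 is its linear part plus a field of order 2. The latter kills T(a) ⊗ b;
    the former kills b, hence acts on T(a) by ad. *)
Lemma scalar_target (T : A -> UL K) :
    linear T ->
    (forall X a, even_degs (pred1 0) X -> T (g0_act (linear_part X) a) = ad X (T a)) ->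
    (forall a, killed (T a)) ->
  exists phi : Verma A -> Verma B,
    L_morphism phi /\ forall u a, phi (tens u a) = tens (u * T a) b.
Proof.
move=> TL Tad Tk.
have [| | |phi [Lphi phiE]] := @Verma_morphism K A B (fun a => tens (T a) b).
- by move=> c a a'; rewrite TL tensDl tensZl.
- move=> X a X0; pose Y := lin_of X.
  have Y0 : even_degs (pred1 0) Y by apply: lin_field_degs.
  have -> : linear_part X = linear_part Y by rewrite linear_part_lin.
  rewrite (Tad Y) // Verma_act_tens -{1}(subrK Y X) linearD mulrDl tensDl.
  rewrite (proj1 (Tk a)) ?add0r; last exact: ord_nlin.
  by rewrite tens_ad (tens_even0 _ (even_degs_ge0 Y0)) addr0.
- by move=> w a w0; rewrite Verma_act_tens (proj2 (Tk a)) // => kl; apply: odd_degs_at0.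
- by exists phi; split=> // u a; rewrite phiE Verma_act_tens.
Qed.
End Modules.
End AdjointAction.

(** * The module N and the map iota *)

Section HighestWeightModule.
Variable K : numFieldType.

Lemma hw_vectorE : hw_vector K = dword K hw_word.
Proof. by rewrite /hw_vector /dword /= /dgen !o5E mulr1 !mulrA. Qed.

Lemma hw_killed (B : g0_module K) (b : B) : (forall M, g0_act M b = 0) -> killed b (hw_vector K).
Proof.
(* As b is invariant, the constant family [fun=> b] with the empty action [act0] is an instance of
   the symbolic calculus. *)
move=> b0; have actP (M : 'M[K]_5) (s : seq nat) : g0_act M b =
    \sum_(k < 5) \sum_(e < 5) M k e *: lc (fun=> b) (act0 k e s).
  by rewrite b0 big1 // => k _; rewrite big1 // => e _; rewrite lc_nil scaler0.
have den_hw : lc (den_expr (fun _ : seq nat => b)) hw_expr = tens (hw_vector K) b.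
  by rewrite lc_seq1 scale1r hw_vectorE.
split=> [X X2|w w0].
  by rewrite -Verma_act_tens -den_hw (check_evenP actP hw_expr_even) // => e m; apply: X2.
by rewrite -Verma_act_tens -den_hw (check_oddP actP hw_expr_odd).
Qed.

Lemma in_N_killed (B : g0_module K) (b : B) u : (forall M, g0_act M b = 0) -> in_N u -> killed b u.
Proof.
move=> b0; elim=> {u} [|c u v _ uk _ vk|X u X0 _ uk].
- exact: hw_killed.
- exact: killed_linear.
- exact: killed_ad.
Qed.

Lemma trace_delta (p : 'I_5) : p != i1 -> \tr (delta_mx p i1 : 'M[K]_5) = 0.
Proof.
move=> ne; rewrite /mxtrace big1 // => i _; rewrite mxE.
by case: eqP => // ->; rewrite (negPf ne).
Qed.

(** The field x_p ∂_1, which replaces an index 1 by p. Such fields lead from the highest weight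
    vector to all monomial images in N. *)
Definition raise (p : 'I_5) (ne : p != i1) : L_even K := LEven (lin_field_divfree (trace_delta ne)).

Lemma dformC i j : dform K j i = - dform K i j.
Proof.
apply: val_inj; apply/ffunP => kl; apply: fpsP => m.
by rewrite [LHS]dformE [RHS]oddN dformE -[RHS]mulNrn opprB.
Qed.

Lemma dform_diag i : dform K i i = 0.
Proof.
apply: val_inj; apply/ffunP => kl; apply: fpsP => m.
by rewrite [LHS]dformE subrr mul0rn ffunE.
Qed.

Lemma raise_dform p (ne : p != i1) i j : even_odd_bracket (raise ne) (dform K i j) =
  (i == i1)%:R *: dform K p j + (j == i1)%:R *: dform K i p.
Proof.
rewrite lie_deriv_lin (bigD1 p) //= big1 ?addr0 => [|k ne_k].
  by rewrite !mxE !eqxx.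
by rewrite !mxE (negPf ne_k) !scale0r addr0.
Qed.

Lemma dsortP (i j : nat) : (i < 5)%N -> (j < 5)%N ->
  of_odd (dform K (o5 i) (o5 j)) = lc (dgen K) (dsort i j).
Proof.
move=> lt_i lt_j; rewrite /dsort; case: ltngtP => [_|_|->].
- by rewrite lc_seq1 scale1r.
- by rewrite lc_seq1 dformC linearN scaleN1r.
- by rewrite lc_nil dform_diag linear0.
Qed.

Lemma dsort_wf i j x : (i < 5)%N -> (j < 5)%N -> x \in dsort i j -> wfd x.2.
Proof.
move=> lt_i lt_j; rewrite /dsort; case: ltngtP => // lt.
  by rewrite inE => /eqP->; rewrite /wfd /= lt.
by rewrite inE => /eqP->; rewrite /wfd /= lt.
Qed.

Lemma o5_neq0 p : (0 < p < 5)%N -> o5 p != i1.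
Proof. by case/andP=> p0 lt_p; rewrite -val_eqE /= o5K // -lt0n. Qed.

Lemma ad_wordP p (wf_p : (0 < p < 5)%N) w : all wfd w ->
  ad (raise (o5_neq0 wf_p)) (dword K w) = lc (dword K) (ad_word p w).
Proof.
elim: w => [|d w IH] /=; first by rewrite ad1 lc_nil.
case/andP=> /andP[lt12 lt2] wf_w; have lt1 := ltn_trans lt12 lt2.
rewrite adM IH // lc_cat ad_odd raise_dform.
have -> : (o5 d.2 == i1) = false by apply: negbTE; apply: o5_neq0; rewrite (leq_ltn_trans (leq0n _) lt12).
rewrite scale0r addr0; congr (_ + _).
  rewrite -val_eqE /= o5K //; case: eqP => _; last by rewrite scale0r linear0 mul0r lc_nil.
  have /andP[_ lt_p] := wf_p.
  by rewrite scale1r dsortP // /lc big_map mulr_suml; apply: eq_bigr => x _; rewrite -scalerAl.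
by rewrite /lc big_map mulr_sumr; apply: eq_bigr => x _; rewrite -scalerAr.
Qed.

Lemma ad_word_wf p w x : (p < 5)%N -> all wfd w -> x \in ad_word p w -> all wfd x.2.
Proof.
move=> lt_p; elim: w x => //= d w IH x /andP[/andP[lt12 lt2] wf_w].
rewrite mem_cat => /orP[|/mapP[y yin ->]]; last by rewrite /= IH // andbT /wfd lt12.
by case: eqP => // _ /mapP[y yin ->] /=; rewrite wf_w andbT; apply: dsort_wf yin.
Qed.

Lemma raised_wf s x : all (fun p => p < 5)%N s -> x \in raised s -> all wfd x.2.
Proof.
elim: s x => [|p s IH] x /=; first by rewrite inE => _ /eqP->.
case/andP=> lt_p wf_s /flatten_mapP[y yin /mapP[z zin ->]] /=.
exact: ad_word_wf lt_p (IH _ wf_s yin) zin.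
Qed.

Lemma raisedP p (wf_p : (0 < p < 5)%N) s : all (fun p => p < 5)%N s ->
  lc (dword K) (raised (p :: s)) = ad (raise (o5_neq0 wf_p)) (lc (dword K) (raised s)).
Proof.
move=> wf_s; rewrite lc_bind (lc_linear (ad _)); apply: eq_lc_in => x xin.
by rewrite [RHS]ad_wordP //; apply: raised_wf xin.
Qed.

End HighestWeightModule.

Section Iota.
Variables (K : numFieldType) (iota : Sym K 3 -> UL K).
Hypothesis iotaP : is_iota iota.

Lemma iotaD c (s t : dhomog 5 K 3) : iota (c *: s + t) = c *: iota s + iota t.
Proof. by have [iL _ _ _ _] := iotaP; apply: iL. Qed.

Definition iota_lin : {linear dhomog 5 K 3 -> UL K} :=
  HB.pack (iota : dhomog 5 K 3 -> UL K)
    (GRing.isLinear.Build K (dhomog 5 K 3) (UL K) _ (iota : dhomog 5 K 3 -> UL K) iotaD).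

Lemma iotaZ c (s : dhomog 5 K 3) : iota (c *: s) = c *: iota s.
Proof. exact: (linearZ_LR iota_lin). Qed.

Lemma iota_sum (I : Type) (r : seq I) (P : pred I) (F : I -> dhomog 5 K 3) :
  iota (\sum_(i <- r | P i) F i) = \sum_(i <- r | P i) iota (F i).
Proof. exact: (linear_sum iota_lin). Qed.

Lemma poly_act_raise (p : 'I_5) (q : {mpoly K[5]}) : poly_act (delta_mx p i1) q = 'X_p * q^`M(i1).
Proof.
rewrite /poly_act (bigD1 p) //= [X in _ + X]big1 ?addr0 => [|i ne]; last first.
  by rewrite big1 // => j _; rewrite mxE (negPf ne) scale0r.
rewrite (bigD1 i1) //= big1 ?addr0 => [|j ne]; first by rewrite mxE !eqxx scale1r.
by rewrite mxE (negPf ne) andbF scale0r.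
Qed.

Lemma pmon_cat s t : pmon K (s ++ t) = pmon K s * pmon K t.
Proof. exact: big_cat. Qed.

Lemma deriv_pmon_zeros s n : all (fun p => 0 < p < 5)%N s ->
  (pmon K (s ++ nseq n 0%N))^`M(i1) = n%:R *: pmon K (s ++ nseq n.-1 0%N).
Proof.
move=> wf_s; rewrite pmon_cat mderivM (_ : (pmon K s)^`M(i1) = 0) ?mul0r ?add0r.
  rewrite pmon_cat scalerAr; congr (_ * _).
  elim: n => [|n IH]; first by rewrite /pmon big_nil mderivC scale0r.
  rewrite [nseq _ _]/= pmon_cons mderivM mderivX1 o5E eqxx mul1r IH -scalerAr -[i1 in 'X_i1](o5E.1.1.1.1) -pmon_cons.
  case: n {IH} => [|n]; first by rewrite scale0r addr0 scale1r.
  by rewrite [n.+2%:R]mulrS scalerDl scale1r.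
rewrite pmon_deriv big_seq big1 // => t; rewrite mem_iota => /andP[_ lt_t].
have /(allP wf_s) /o5_neq0 /negPf-> := mem_nth 0%N lt_t.
by rewrite scale0r.
Qed.

(** By equivariance of iota, ad(x_p ∂_1) on N is z_p d/dz_1 on cubic forms. Starting from z_1^3, the
    successive exponents of z_1 multiply to the falling factorial. *)
Lemma raised_iota s : all (fun p => 0 < p < 5)%N s -> (size s <= 3)%N ->
  lc (dword K) (raised s) = (3 ^_ (size s))%:R *: iota (symv K 3 (s ++ nseq (3 - size s) 0%N)).
Proof.
have wf5 t : all (fun p => 0 < p < 5)%N t -> all (fun p => p < 5)%N t.
  by apply: sub_all => p /andP[].
have [_ iota_ad _ _ iota_hw] := iotaP.
elim: s => [|p s IH] /=.
  move=> _ _; rewrite lc_seq1 -hw_vectorE -iota_hw ffactn0 !scale1r; congr iota.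
  apply: val_inj; rewrite /= symvE /= z_E; last by rewrite mdegMn mdeg1.
  by rewrite /pmon /= !big_cons big_nil mulr1 o5E -!mpolyXD; congr 'X_[_].
case/andP=> wf_p wf_s lt_s; rewrite raisedP ?wf5 // IH ?(ltnW lt_s) //.
rewrite (linearZ_LR (ad _)) /= -iota_ad ?lin_field_degs; last exact: lin_field_degs.
rewrite linear_part_lin ffactnSr natrM -scalerA; congr (_ *: _).
rewrite -iotaZ; congr iota; apply: val_inj.
rewrite /= !symvE size_cat size_nseq subnKC ?(ltnW lt_s) // eqxx /= size_cat size_nseq -addSn subnKC // eqxx.
by rewrite poly_act_raise deriv_pmon_zeros // -scalerAr -pmon_cons subnS.
Qed.
End Iota.

Section Multinomial.
Variables (K : numFieldType) (n : nat).

(** Differentiating the power of the sum by a variable that occurs in a gives k + 1 times the next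
    lower power; comparing coefficients lowers that exponent of a by one. *)
Lemma coef_sum_var_exp k (a : 'X_{1..n}) : mdeg a = k ->
  ((\sum_i 'X_i : {mpoly K[n]}) ^+ k)@_a * (\prod_i (a i)`!)%:R = k`!%:R.
Proof.
elim: k a => [|k IH] a deg_a.
  have -> : a = 0%MM by apply/eqP; rewrite -mdeg_eq0 deg_a.
  by rewrite expr0 mcoeff1 eqxx mul1r big1 // => i _; rewrite mnm0E.
have [i ai] : exists i, (0 < a i)%N.
  apply/existsP; apply: contraT; rewrite negb_exists => /forallP a0.
  have : a = 0%MM by apply/mnmP => i; apply/eqP; rewrite mnm0E -leqn0 leqNgt.
  by move=> a00; rewrite a00 mdeg0 in deg_a.
have [m def_a] : exists m, a = (m + U_(i))%MM.
  by exists (a - U_(i))%MM; rewrite submK // lep1mP -lt0n.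
have dS : (\sum_j 'X_j : {mpoly K[n]})^`M(i) = 1.
  rewrite linear_sum (bigD1 i) //= mderivX1 eqxx big1 ?addr0 // => j ne.
  by rewrite mderivX1 (negPf ne).
have dSk l : ((\sum_j 'X_j : {mpoly K[n]}) ^+ l.+1)^`M(i) = l.+1%:R *: (\sum_j 'X_j) ^+ l.
  elim: l => [|l IHl]; first by rewrite expr1 dS expr0 scale1r.
  rewrite exprS mderivM dS mul1r IHl -scalerAr -exprS.
  by rewrite [l.+2%:R]mulrS scalerDl scale1r.
have := congr1 (fun p => p@_m) (dSk k); rewrite mcoeff_deriv mcoeffZ -def_a => e.
have deg_m : mdeg m = k by move: deg_a; rewrite def_a mdegD mdeg1 addn1 => -[].
have fact_a : (\prod_j (a j)`! = (m i).+1 * \prod_j (m j)`!)%N.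
  rewrite (bigD1 i) //= [in RHS](bigD1 i) //= mulnA; congr (_ * _)%N.
    by rewrite def_a mnmDE mnm1E eqxx addn1 factS.
  by apply: eq_bigr => j ne; rewrite def_a mnmDE mnm1E eq_sym (negPf ne) addn0.
by rewrite fact_a natrM mulrA [_ * (m i).+1%:R]mulr_natr e -mulrA IH // factS natrM.
Qed.
End Multinomial.

Section IotaWords.
Variables (K : numFieldType) (iota : Sym K 3 -> UL K).
Hypothesis iotaP : is_iota iota.

Lemma iota_wordsP b : all (fun i => i < 5)%N b -> size b = 3%N ->
  lc (dword K) (iota_words b) = 6 *: iota (symv K 3 b).
Proof.
move=> wf_b sz_b; rewrite /iota_words; set s := [seq i <- b | i != 0%N].
have wf_s : all (fun p => 0 < p < 5)%N s.
  by apply/allP => i; rewrite mem_filter lt0n => /andP[-> /(allP wf_b)].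
have perm_b : perm_eq (s ++ nseq (3 - size s) 0%N) b.
  have p1 := permEl (perm_filterC (fun i => i != 0%N) b).
  apply: perm_trans p1; rewrite perm_cat2l; set z := filter _ _.
  have sz : (size s + size z)%N = 3%N.
    by rewrite -size_cat -sz_b; apply: (perm_size (permEl (perm_filterC _ b))).
  have /all_pred1P -> : all (pred1 0%N) z.
    by apply/allP => x; rewrite mem_filter /= negbK => /andP[].
  by rewrite -sz addKn.
have le_s : (size s <= 3)%N by rewrite -sz_b size_filter count_size.
(* For r = size s, [nth] gives (3 - r)!, its default 1 covering r = 2 and r = 3; times the falling
   factorial [3 ^_ r] this is always 6. *)
rewrite [LHS](_ : _ = (nth 1 [:: 6; 2] (size s) : int)%:~R *: lc (dword K) (raised s)).
  rewrite (raised_iota iotaP wf_s le_s) scalerA; congr (_ *: iota _).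
    rewrite -[(3 ^_ _)%:R]/(((3 ^_ size s)%:Z)%:~R) -intrM -[RHS]/((6%:Z)%:~R); congr _%:~R.
    by case: (size s) le_s => [|[|[|[|?]]]].
  apply: val_inj; rewrite /= !symvE (perm_size perm_b) sz_b; exact: pmon_perm.
rewrite lcZ /lc big_map; apply: eq_bigr => t _.
by rewrite intrM scalerA mulrC.
Qed.

Lemma wf_triples b : b \in triples -> all (fun i => i < 5)%N b && (size b == 3%N).
Proof. by apply/allP: b; vm_compute. Qed.

Lemma lc_BC_expr : lc (den_expr (symv K 3 : seq nat -> SymDual K 3)) BC_expr =
  6 *: \sum_(b <- triples) tens (iota (symv K 3 b)) (symv K 3 b : SymDual K 3).
Proof.
rewrite collapseP /lc big_flatten big_map scaler_sumr; apply: eq_big_seq => b /wf_triples/andP[wf_b /eqP sz_b].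
rewrite big_map -tensZl -(iota_wordsP wf_b sz_b) [lc _ _]/lc tens_suml; apply: eq_bigr => t _.
rewrite tensZl /den_expr /=; congr (_ *: tens _ _).
apply: val_inj; rewrite /= !symvE.
have perm_b : perm_eq (sort_nat b) b.
  elim: b {wf_b sz_b} => // x b IH; apply: perm_trans (insn_perm _ _) _.
  by rewrite perm_cons.
by rewrite (perm_size perm_b) (pmon_perm K perm_b).
Qed.

(** The monomial a arises from 3!/a! ordered triples, its coefficient in the cube of the sum of the
    variables. This turns the sum of iota(z^b) ⊗ z^b over triples b into the sum of u_a ⊗ z^a. *)
Lemma sum_triples (M : lmodType K) (f : 'X_{1..5} -> M) :
  \sum_(b <- triples) f (mon b) =
  \sum_(a : 'X_{1..5 < 4} | mdeg a == 3%N) (3`!%:R / (\prod_i (a i)`!)%:R) *: f a.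
Proof.
have pick (b : seq nat) : size b = 3%N -> f (mon b) =
    \sum_(a : 'X_{1..5 < 4} | mdeg a == 3%N) ('X_[mon b] : {mpoly K[5]})@_a *: f a.
  move=> sz_b; have lt4 : (mdeg (mon b) < 4)%N by rewrite mdeg_mon sz_b.
  rewrite (bigD1 (BMultinom lt4)) /=; last by rewrite mdeg_mon sz_b.
  rewrite mcoeffX eqxx scale1r big1 ?addr0 // => a /andP[_ ne].
  rewrite mcoeffX; case: eqP => [e|_]; last by rewrite scale0r.
  by case/eqP: ne; apply: val_inj.
transitivity (\sum_(b <- triples) \sum_(a : 'X_{1..5 < 4} | mdeg a == 3%N)
    ('X_[mon b] : {mpoly K[5]})@_a *: f a).
  by apply: eq_big_seq => b /wf_triples/andP[_ /eqP]; apply: pick.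
rewrite exchange_big; apply: eq_bigr => a /eqP deg_a.
rewrite -scaler_suml; congr (_ *: _).
have n0 : ((\prod_i (a i)`!)%:R : K) != 0.
  by rewrite pnatr_eq0 -lt0n prodn_gt0 // => i; apply: fact_gt0.
apply: (mulIf n0); rewrite divfK // -(coef_sum_var_exp K deg_a); congr (_ * _).
rewrite -raddf_sum; congr (_@_a).
rewrite exprS expr2 /triples big_flatten big_map sum_o5 mulr_suml; apply: eq_bigr => i _.
rewrite big_flatten big_map mulr_suml mulr_sumr; apply: eq_bigr => j _.
rewrite big_map !mulr_sumr; apply: eq_bigr => k _.
by rewrite -pmonE /pmon !big_cons big_nil mulr1.
Qed.

End IotaWords.

(** * The four morphisms *)

Section FourMorphisms.
Variable K : numFieldType.
Local Notation d_ i j := (of_odd (dform K i j)).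
Local Notation z0 := (z_ K 0 0%MM).

Lemma z0E : z0 = 1 :> {mpoly K[5]}.
Proof. by rewrite z_E ?mdeg0 // mpolyX0. Qed.

Lemma dhomog0E (s : dhomog 5 K 0) : s = s@_0 *: z0.
Proof.
apply: val_inj; apply/mpolyP => m; rewrite [RHS]/= z0E mcoeffZ mcoeff1.
have [->|m0] := eqVneq m 0%MM; first by rewrite mulr1.
rewrite mulr0; apply: (dhomog_nemf_coeff (dhomog_is_dhomog s)).
by rewrite /= mdeg_eq0.
Qed.

Lemma sym0_act M (s : dhomog 5 K 0) : Sym_act M s = 0.
Proof.
apply: val_inj; rewrite (dhomog0E s) /= z0E /poly_act big1 // => i _; rewrite big1 // => j _.
by rewrite linearZ /= mderivC scaler0 mulr0 scaler0.
Qed.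

Lemma Sym0_act M (s : Sym K 0) : g0_act M s = 0. Proof. exact: sym0_act. Qed.
Lemma SymDual0_act M (s : SymDual K 0) : g0_act M s = 0. Proof. exact: sym0_act. Qed.

Lemma sum_sym_pairs (V : nmodType) (F : 'I_5 -> 'I_5 -> V) :
    (forall i j, F j i = F i j) -> (forall i, F i i = 0) ->
  \sum_i \sum_j F i j = (\sum_(d <- dpairs) F (o5 d.1) (o5 d.2)) *+ 2.
Proof.
move=> FC F0; pose G (d : nat * nat) := F (o5 d.1) (o5 d.2).
pose ord_pair (d : nat * nat) := if (d.1 < d.2)%N then d else (d.2, d.1).
pose L := [seq (i, j) | i <- iota 0 5, j <- iota 0 5].
have -> : \sum_i \sum_j F i j = \sum_(d <- L) G d.
  rewrite big_allpairs sum_o5; apply: eq_bigr => i _; exact: sum_o5.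
rewrite (bigID (fun d => d.1 == d.2)) /= big1 ?add0r => [|[i j] /= /eqP->]; last exact: F0.
transitivity (\sum_(d <- [seq ord_pair d | d <- L & d.1 != d.2]) G d).
  rewrite big_map big_filter; apply: eq_bigr => -[i j] _.
  by rewrite /G /ord_pair; case: ifP => //= _; rewrite FC.
rewrite mulr2n -big_cat /=; apply: perm_big; by vm_compute.
Qed.

Definition Phi_C : Verma (WedgeDual K) := \sum_i \sum_j tens (d_ i j) (x_ K i j : WedgeDual K).

Lemma Phi_CE : Phi_C = 2 *: lc (den_expr (wedgev K : seq nat -> WedgeDual K)) C_expr.
Proof.
rewrite /Phi_C sum_sym_pairs => [|i j|i].
- rewrite scaler_nat /lc big_map; congr (_ *+ 2); apply: eq_bigr => d _.
  by rewrite scale1r /den_expr /= mulr1.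
- rewrite dformC x_C (linearN (@of_odd K)) tensNl.
  by rewrite [X in - X](linearN (@tens K (WedgeDual K) (d_ i j))) opprK.
- by rewrite dform_diag linear0 tens0l.
Qed.

Lemma nabla_C_exists : exists phi : Verma (Sym K 0) -> Verma (WedgeDual K),
  [/\ is_nabla_C phi, L_morphism phi & forall u, phi (tens u (z0 : Sym K 0)) = Verma_act u Phi_C].
Proof.
have [| | | |phi [Lphi phiE]] := @scalar_source K (Sym K 0) (WedgeDual K)
    (fun s : dhomog 5 K 0 => s@_0) Phi_C.
- by move=> c s t; rewrite mcoeffD mcoeffZ.
- by move=> M s _; apply: poly_act_coef0.
- move=> X X0; rewrite Phi_CE (linearZ_LR (Verma_act (of_even X))) /=.
  rewrite (check_evenP (@actWP K) C_expr_even) ?scaler0 // => e m.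
  by rewrite ltnS leqn0 mdeg_eq0 => /eqP->.
- move=> w w0; rewrite Phi_CE (linearZ_LR (Verma_act (of_odd w))) /=.
  by rewrite (check_oddP (@actWP K) C_expr_odd) ?scaler0.
have phi1 u : phi (tens u (z0 : Sym K 0)) = Verma_act u Phi_C.
  by rewrite phiE z0E mcoeff1 eqxx scale1r.
exists phi; split=> //; split=> [|u]; first by case: Lphi.
rewrite phi1 (linear_sum (Verma_act u)); apply: eq_bigr => i _.
rewrite (linear_sum (Verma_act u)); apply: eq_bigr => j _.
by rewrite /= Verma_act_tens.
Qed.

Definition wedge_odd (s : wedge2 K) : UL K := \sum_i \sum_j s i j *: d_ i j.

Lemma wedge_odd_linear : linear (wedge_odd : Wedge K -> UL K).
Proof.
move=> c s t; rewrite /wedge_odd scaler_sumr -big_split; apply: eq_bigr => i _ /=.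
rewrite scaler_sumr -big_split; apply: eq_bigr => j _ /=.
by rewrite !mxE scalerDl scalerA.
Qed.

Lemma wedge_odd_ad X (s : Wedge K) : even_degs (pred1 0) X ->
  wedge_odd (g0_act (linear_part X) s) = ad X (wedge_odd s).
Proof.
move=> X0; rewrite -{2}(lin_of_homog X0); set A := linear_part X.
have adE i j : ad (lin_of X) (d_ i j) = \sum_k A k i *: d_ k j + \sum_k A k j *: d_ i k.
  rewrite ad_odd lie_deriv_lin linear_sum -big_split; apply: eq_bigr => k _ /=.
  by rewrite linearD !linearZ.
have -> : ad (lin_of X) (wedge_odd s) =
    \sum_i \sum_j s i j *: (\sum_k A k i *: d_ k j) + \sum_i \sum_j s i j *: (\sum_k A k j *: d_ i k).
  rewrite /wedge_odd (linear_sum (ad _)) -big_split; apply: eq_bigr => i _ /=.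
  rewrite (linear_sum (ad _)) -big_split; apply: eq_bigr => j _ /=.
  by rewrite linearZ /= adE scalerDr.
have -> : wedge_odd (g0_act A s) =
    \sum_k \sum_j (A *m s) k j *: d_ k j + \sum_i \sum_k (s *m A^T) i k *: d_ i k.
  rewrite /wedge_odd -big_split; apply: eq_bigr => i _ /=.
  by rewrite -big_split; apply: eq_bigr => j _ /=; rewrite mxE scalerDl.
congr (_ + _).
  rewrite exchange_big [RHS]exchange_big; apply: eq_bigr => j _ /=.
  under [RHS]eq_bigr do rewrite scaler_sumr.
  rewrite [RHS]exchange_big; apply: eq_bigr => k _; rewrite mxE scaler_suml.
  by apply: eq_bigr => i _; rewrite scalerA mulrC.
apply: eq_bigr => i _; under [RHS]eq_bigr do rewrite scaler_sumr.
rewrite [RHS]exchange_big; apply: eq_bigr => k _; rewrite mxE scaler_suml.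
by apply: eq_bigr => j _; rewrite !mxE scalerA.
Qed.

(** [X, d_ij] vanishes at 0 if X has order 2, and [w, d_ij] does if w vanishes at 0. So both lie in
    L_0 and kill the invariant vector b. *)
Lemma dform_killed (B : g0_module K) (b : B) i j :
  (forall M, g0_act M b = 0) -> killed b (d_ i j).
Proof.
move=> b0; split=> [X X2|w w0].
  rewrite tens_ad ad_odd (tens_even0 b0); last by apply: even_at0_degs => e; rewrite X2 ?mdeg0.
  rewrite addr0 -[of_odd _]mul1r tens_odd //; apply: odd_at0_degs => kl.
  case: kl => k l; rewrite [LHS](congr1 (fun f : fps 5 K => f 0%MM) (lie_deriv_dform _ _ _ _ _)) !(fps_coefD, fps_coefN, fps_coefMn) !fps_deriv0.
  by rewrite !(X2, mul0rn, oppr0, addr0) ?mdeg1.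
rewrite of_odd_odd tensDl tensNl tens_odd; last exact: odd_at0_degs.
rewrite oppr0 add0r -[of_even _]mul1r (tens_even0 b0) //; apply: even_at0_degs => e.
have /rowP/(_ e) := cv_odd (0, dform K i j) w0.
by rewrite !mxE evenN => /eqP; rewrite oppr_eq0 => /eqP.
Qed.

Lemma nabla_A_exists : exists phi : Verma (Wedge K) -> Verma (SymDual K 0),
  [/\ is_nabla_A phi, L_morphism phi &
      forall u s, phi (tens u s) = tens (u * wedge_odd s) (z0 : SymDual K 0)].
Proof.
have b0 M : g0_act M (z0 : SymDual K 0) = 0 by apply: SymDual0_act.
have [| |phi [Lphi phiE]] := scalar_target b0 wedge_odd_linear.
- by move=> X a; apply: wedge_odd_ad.
- move=> s; apply: killed_sum => i; apply: killed_sum => j.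
  by rewrite -[_ *: _]addr0; apply: killed_linear (killed0 _); apply: dform_killed.
exists phi; split=> //; split=> [|u s]; first by case: Lphi.
rewrite phiE mulr_sumr tens_suml; apply: eq_bigr => i _.
rewrite mulr_sumr tens_suml; apply: eq_bigr => j _.
by rewrite -scalerAr tensZl (linearZ_LR (@tens K (SymDual K 0) _)).
Qed.

End FourMorphisms.

Section DegreeFourMorphisms.
Variables (K : numFieldType) (iota : Sym K 3 -> UL K).
Hypothesis iotaP : is_iota iota.
Local Notation z0 := (z_ K 0 0%MM).

Lemma iota_in_N p : in_N (iota p).
Proof. by have [_ _ _ iN _] := iotaP; apply/iN; exists p. Qed.

Lemma indhomogK n (s : dhomog 5 K n) : ['dhomog_n (s : {mpoly K[5]})] = s.
Proof. exact: valKd. Qed.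

Lemma mderivm_homog n (s : dhomog 5 K n) (a : 'X_{1..5}) : mdeg a = n ->
  ['dhomog_0 s^`M[a]] = (s@_a * (\prod_i (a i)`!)%:R) *: z0.
Proof.
move=> deg_a; rewrite -[RHS]indhomogK; congr indhomog; apply/mpolyP => m.
rewrite mcoeff_mderivm [RHS]mcoeffZ /= z0E mcoeff1; have [->|m0] := eqVneq m 0%MM.
  rewrite mulr1 addm0 mulr_natr; congr (_ *+ _); apply: eq_bigr => i _; exact: ffactnn.
rewrite mulr0 (dhomog_nemf_coeff (dhomog_is_dhomog s)) ?mul0rn //=.
by rewrite mdegD deg_a -{2}[n]addn0 eqn_add2l mdeg_eq0.
Qed.

Lemma dhomog3E (s : dhomog 5 K 3) :
  s = \sum_(a : 'X_{1..5 < 4} | mdeg a == 3%N) s@_a *: z_ K 3 a.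
Proof.
apply: val_inj; rewrite [RHS](linear_sum (@mpoly_of_dhomog 5 K 3)).
transitivity (\sum_(a : 'X_{1..5 < 4} | mdeg a == 3%N) s@_a *: 'X_[a] : {mpoly K[5]}); last first.
  by apply: eq_bigr => a /eqP deg_a; rewrite /= z_E.
apply/mpolyP => m; rewrite raddf_sum /=.
have [deg_m|deg_m] := eqVneq (mdeg m) 3%N; last first.
  rewrite (dhomog_nemf_coeff (dhomog_is_dhomog s)) // big1 // => a /eqP deg_a.
  rewrite mcoeffZ mcoeffX; case: eqP => [e|_]; last exact: mulr0.
  by rewrite -e deg_a eqxx in deg_m.
have lt4 : (mdeg m < 4)%N by rewrite deg_m.
rewrite (bigD1 (BMultinom lt4)) /= ?deg_m // mcoeffZ mcoeffX eqxx mulr1 big1 ?addr0 // => a /andP[_ ne].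
rewrite mcoeffZ mcoeffX; case: eqP => [e|_]; last exact: mulr0.
by case/eqP: ne; apply: val_inj.
Qed.

(** For s of degree 3 the constant ∂^a s is a! times the coefficient of s at a, which cancels the a!
    in u_a; the defining sum is iota(6 s). *)
Lemma t_AB_exists : exists phi : Verma (Sym K 3) -> Verma (Sym K 0),
  [/\ is_t_AB iota phi, L_morphism phi &
      forall u (s : Sym K 3), phi (tens u s) = tens (u * iota (6 *: s)) (z0 : Sym K 0)].
Proof.
have [_ iota_ad _ _ _] := iotaP.
have b0 M : g0_act M (z0 : Sym K 0) = 0 by apply: Sym0_act.
have [| | |phi [Lphi phiE]] := @scalar_target K (Sym K 3) (Sym K 0) z0 b0 (fun s => iota (6 *: s)).
- by move=> c s t; rewrite scalerDr scalerA mulrC -scalerA (iotaD iotaP).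
- by move=> X s X0; rewrite !(iotaZ iotaP) (linearZ_LR (ad X)) /= iota_ad.
- by move=> s; apply: in_N_killed => //; apply: iota_in_N.
exists phi; split=> //; split=> [|u s]; first by case: Lphi.
rewrite phiE {1}(dhomog3E s) scaler_sumr (iota_sum iotaP) mulr_sumr tens_suml.
apply: eq_bigr => a /eqP deg_a.
transitivity ((s@_a * (\prod_i (a i)`!)%:R) *: tens (u * u_ iota a) (z0 : Sym K 0)); last first.
  by rewrite mderivm_homog // (linearZ_LR (@tens K (Sym K 0) _)).
have n0 : ((\prod_i (a i)`!)%:R : K) != 0.
  by rewrite pnatr_eq0 -lt0n prodn_gt0 // => i; apply: fact_gt0.
have -> : tens (u * u_ iota a) (z0 : Sym K 0) =
    (3`!%:R / (\prod_i (a i)`!)%:R) *: tens (u * iota (z_ K 3 a)) (z0 : Sym K 0).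
  by rewrite /u_ -scalerAr tensZl.
rewrite !(iotaZ iotaP) -!scalerAr !tensZl !scalerA; congr (_ *: _).
by rewrite [RHS]mulrCA mulfK.
Qed.

Definition Phi_BC : Verma (SymDual K 3) :=
  \sum_(b <- triples) tens (iota (symv K 3 b)) (symv K 3 b : SymDual K 3).

Lemma Phi_BCE : Phi_BC = 6^-1 *: lc (den_expr (symv K 3 : seq nat -> SymDual K 3)) BC_expr.
Proof. by rewrite (lc_BC_expr iotaP) scalerA mulVf ?scale1r // pnatr_eq0. Qed.

Lemma t_BC_exists : exists phi : Verma (SymDual K 0) -> Verma (SymDual K 3),
  [/\ is_t_BC iota phi, L_morphism phi &
      forall u (s : dhomog 5 K 0), phi (tens u (s : SymDual K 0)) = s@_0 *: Verma_act u Phi_BC].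
Proof.
have [| | | |phi [Lphi phiE]] := @scalar_source K (SymDual K 0) (SymDual K 3)
    (fun s : dhomog 5 K 0 => s@_0) Phi_BC.
- by move=> c s t; rewrite mcoeffD mcoeffZ.
- by move=> M s _; apply: poly_act_coef0.
- move=> X X0; rewrite Phi_BCE (linearZ_LR (Verma_act (of_even X))) /=.
  rewrite (check_evenP (@actSP K 3) BC_expr_even) ?scaler0 // => e m.
  by rewrite ltnS leqn0 mdeg_eq0 => /eqP->.
- move=> w w0; rewrite Phi_BCE (linearZ_LR (Verma_act (of_odd w))) /=.
  by rewrite (check_oddP (@actSP K 3) BC_expr_odd) ?scaler0.
exists phi; split=> //; split=> [|u s]; first by case: Lphi.
rewrite phiE /Phi_BC (linear_sum (Verma_act u)) scaler_sumr.
pose f (a : 'X_{1..5}) : Verma (SymDual K 3) :=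
  s@_0 *: tens (u * iota (z_ K 3 a)) (z_ K 3 a : SymDual K 3).
transitivity (\sum_(b <- triples) f (mon b)).
  by apply: eq_bigr => b _; rewrite /= Verma_act_tens /symv pmonE.
rewrite sum_triples; apply: eq_bigr => a /eqP deg_a.
have -> : ['dhomog_3 ('X_[a] * s)] = s@_0 *: z_ K 3 a.
  rewrite -[RHS]indhomogK; congr indhomog.
  by rewrite [in LHS](dhomog0E s) /= z0E z_E // -scalerAr mulr1.
rewrite /f /u_ -scalerAr tensZl (linearZ_LR (@tens K (SymDual K 3) _)).
by rewrite /= !scalerA.
Qed.

End DegreeFourMorphisms.

(** * Degrees *)

Section Degrees.
Variable K : numFieldType.
Local Notation d_ i j := (of_odd (dform K i j)).

Lemma Uminus_deg0 k : Uminus_deg k (0 : UL K).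
Proof.
have [u uk] : exists u : UL K, Uminus_deg k u.
  elim: k => [|k [u uk]]; first by exists 1; apply: Uminus_one.
  by exists (d_ i1 i2 * u); apply: Uminus_dform.
by rewrite -[0](addNr u) -scaleN1r; apply: Uminus_linear.
Qed.

Lemma Uminus_degZ k c (u : UL K) : Uminus_deg k u -> Uminus_deg k (c *: u).
Proof. by move=> uk; rewrite -[_ *: _]addr0; apply: Uminus_linear (Uminus_deg0 k). Qed.

Lemma Uminus_degD k (u v : UL K) : Uminus_deg k u -> Uminus_deg k v -> Uminus_deg k (u + v).
Proof. by move=> uk vk; rewrite -[u]scale1r; apply: Uminus_linear. Qed.

Lemma Uminus_deg_sum k (I : finType) (F : I -> UL K) :
  (forall i, Uminus_deg k (F i)) -> Uminus_deg k (\sum_i F i).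
Proof. by move=> Fk; apply: big_ind => [|u v|i _]; [apply: Uminus_deg0|apply: Uminus_degD|apply: Fk]. Qed.

Lemma Uminus_degM j k (u v : UL K) : Uminus_deg j u -> Uminus_deg k v -> Uminus_deg (j + k) (u * v).
Proof.
move=> uj vk; elim: uj => {j u} [|j a b u _ IH|j a u _ IH|j c u u' _ IH _ IH'].
- by rewrite mul1r.
- by rewrite -mulrA; apply: Uminus_dform.
- by rewrite -mulrA; apply: Uminus_partial.
- by rewrite mulrDl -scalerAl; apply: Uminus_linear.
Qed.

(** A linear field maps the span of the d_ij and the span of the ∂_i into themselves. *)
Lemma Uminus_deg_ad X k (u : UL K) : even_degs (pred1 0) X -> Uminus_deg k u -> Uminus_deg k (ad X u).
Proof.
move=> X0; rewrite -(lin_of_homog X0); elim=> {k u} [|k i j u uk IH|k i u uk IH|k c u v _ IHu _ IHv].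
- by rewrite ad1; apply: Uminus_deg0.
- rewrite adM ad_odd lie_deriv_lin linear_sum mulr_suml; apply: Uminus_degD; last exact: Uminus_dform.
  apply: Uminus_deg_sum => a; rewrite linearD !linearZ /= mulrDl -!scalerAl.
  by apply: Uminus_linear; [|apply: Uminus_degZ]; apply: Uminus_dform.
- rewrite adM ad_even even_bracket_lin linear_sum mulr_suml; apply: Uminus_degD; last exact: Uminus_partial.
  apply: Uminus_deg_sum => a; rewrite linearZ -scalerAl.
  by apply: Uminus_degZ; apply: Uminus_partial.
- by rewrite linearP; apply: Uminus_linear.
Qed.

Lemma in_N_deg (u : UL K) : in_N u -> Uminus_deg 4 u.
Proof.
elim=> {u} [|c u v _ uk _ vk|X u X0 _ uk]; last exact: Uminus_deg_ad.
  by rewrite /hw_vector -!mulrA -[d_ i1 i5]mulr1; do 4!apply: Uminus_dform; apply: Uminus_one.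
exact: Uminus_linear.
Qed.

Lemma has_degree_fin k (A B : g0_module K) (phi : Verma A -> Verma B) (I : finType)
    (u : I -> UL K) (l : I -> A -> B) :
    (forall i, Uminus_deg k (u i)) -> (forall i, linear (l i)) ->
    (forall a, phi (tens 1 a) = \sum_i tens (u i) (l i a)) ->
  has_degree k phi.
Proof.
move=> uk lL phiE.
pose L i : {linear A -> B} := HB.pack (l i) (GRing.isLinear.Build K A B _ (l i) (lL i)).
exists #|I|, (fun i => u (enum_val i)), (fun i => L (enum_val i)); split=> // a.
rewrite phiE -(big_enum_val (A := I) (fun i => tens (u i) (l i a))).
by apply: eq_bigl.
Qed.

Variable iota : Sym K 3 -> UL K.
Hypothesis iotaP : is_iota iota.

Lemma dhomog3E_total (s : dhomog 5 K 3) : s = \sum_(a : 'X_{1..5 < 4}) s@_a *: z_ K 3 a.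
Proof.
rewrite {1}(dhomog3E s) big_mkcond; apply: eq_bigr => a _; case: ifP => // /negbT ne.
by rewrite (dhomog_nemf_coeff (dhomog_is_dhomog s) ne) scale0r.
Qed.

Lemma has_degree_CAB (phi : Verma (Sym K 3) -> Verma (WedgeDual K)) :
    (forall s : Sym K 3, phi (tens 1 s) = Verma_act (iota (6 *: s)) (Phi_C K)) ->
  has_degree 5 phi.
Proof.
(* The family is indexed by all monomials of degree below 4, a finite type; coefficients of s at
   monomials of degree other than 3 are 0. *)
move=> phiE; pose I := ('X_{1..5 < 4} * ('I_5 * 'I_5))%type.
pose u (t : I) := iota (z_ K 3 t.1) * d_ t.2.1 t.2.2.
pose l (t : I) (s : dhomog 5 K 3) : WedgeDual K := (6 * s@_t.1) *: x_ K t.2.1 t.2.2.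
apply: (@has_degree_fin _ (Sym K 3) _ _ I u l).
- move=> t; apply: (@Uminus_degM 4 1); first by apply: in_N_deg; apply: iota_in_N.
  by rewrite -[d_ _ _]mulr1; apply/Uminus_dform/Uminus_one.
- by move=> t c s s1; rewrite /l mcoeffD mcoeffZ mulrDr scalerDl mulrCA scalerA.
- move=> s; transitivity (\sum_(a : 'X_{1..5 < 4}) \sum_(p : 'I_5 * 'I_5) tens (u (a, p)) (l (a, p) s)).
    rewrite phiE {1}(dhomog3E_total s) scaler_sumr (iota_sum iotaP) /Phi_C.
    rewrite (pair_bigA _ (fun i j => tens (d_ i j) (x_ K i j : WedgeDual K))) /=.
    rewrite (linear_sum (Verma_act _)) exchange_big; apply: eq_bigr => p _ /=.
    rewrite Verma_act_tens mulr_suml tens_suml; apply: eq_bigr => a _.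
    rewrite /l (linearZ_LR (@tens K (WedgeDual K) (u (a, p)))) !(iotaZ iotaP) scalerA.
    by rewrite -scalerAl tensZl.
  rewrite pair_bigA /=. by apply: eq_bigr => -[a p].
Qed.

Lemma has_degree_BCA (phi : Verma (Wedge K) -> Verma (SymDual K 3)) :
    (forall s : Wedge K, phi (tens 1 s) = Verma_act (wedge_odd s) (Phi_BC iota)) ->
  has_degree 5 phi.
Proof.
move=> phiE; pose I := ('I_(size triples) * ('I_5 * 'I_5))%type.
pose b (k : 'I_(size triples)) := tnth (in_tuple triples) k.
pose u (t : I) := d_ t.2.1 t.2.2 * iota (symv K 3 (b t.1)).
pose l (t : I) (s : wedge2 K) : SymDual K 3 := s t.2.1 t.2.2 *: symv K 3 (b t.1).
apply: (@has_degree_fin _ (Wedge K) _ _ I u l).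
- move=> t; apply: (@Uminus_degM 1 4); last by apply: in_N_deg; apply: iota_in_N.
  by rewrite -[d_ _ _]mulr1; apply/Uminus_dform/Uminus_one.
- by move=> t c s s'; rewrite /l !mxE scalerDl scalerA.
- move=> s; transitivity (\sum_k \sum_(p : 'I_5 * 'I_5) tens (u (k, p)) (l (k, p) s)).
    rewrite phiE /Phi_BC (linear_sum (Verma_act _)) big_tnth; apply: eq_bigr => k _ /=.
    rewrite Verma_act_tens /wedge_odd (pair_bigA _ (fun i j => s i j *: d_ i j)) /=.
    rewrite mulr_suml tens_suml; apply: eq_bigr => p _.
    by rewrite /l (linearZ_LR (@tens K (SymDual K 3) (u (k, p)))) -scalerAl tensZl.
  by rewrite pair_bigA /=; apply: eq_bigr => -[k p].
Qed.
End Degrees.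

(** * Nonvanishing *)

Section Evaluation.
Variables (K : numFieldType) (V : g0_module K) (vec : seq nat -> V).
Variables (f : V -> seq (Lsuper K) -> K) (ev : seq nat -> seq Lcode -> int).
Variable wf : pred (seq nat).
Hypothesis f_multilinear : forall v, multilinear (f v).
Hypothesis evP : forall b ys, wf b -> all wf_Lcode ys ->
  f (vec b) (map (Lelem K) ys) = (ev b ys)%:~R.

Definition eval_expr (P : expr) (ys : seq Lcode) : int :=
  foldr (fun t a => t.1 * foldr (fun x c => x.1 * ev t.2.2 x.2 + c) 0 (act_word t.2.1 ys) + a) 0 P.

Lemma eval_exprP (F : {linear Verma V -> K^o}) (P : expr) ys :
    (forall u v, F (tens u v) = U_act u (f v) (map (Lelem K) ys)) ->
    all (fun t => all wfd t.2.1 && wf t.2.2) P -> all wf_Lcode ys ->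
  F (lc (den_expr vec) P) = (eval_expr P ys)%:~R.
Proof.
move=> FE wfP wf_ys; rewrite (lc_linear F) /lc.
elim: P wfP => [_|[c [u b]] P IH /= /andP[/andP[wf_u wf_b] wfP]]; first by rewrite big_nil.
rewrite big_cons IH // intrD intrM; congr (_ * _ + _).
rewrite FE act_wordP //.
have := fun x => @act_word_wf u ys x wf_ys; rewrite /lc.
elim: (act_word u ys) => [|[d zs] l IHl] wf_l; first by rewrite big_nil.
rewrite big_cons IHl => [|x xin]; last by apply: wf_l; rewrite inE xin orbT.
rewrite [in RHS]/= intrD intrM evP //.
by have := wf_l (d, zs); rewrite inE eqxx; apply.
Qed.
End Evaluation.

Definition prefix_expr (w : word) (P : expr) : expr := [seq (t.1, (w ++ t.2.1, t.2.2)) | t <- P].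

(* The two test tuples were found by a random search. *)
Definition wedge_test : seq Lcode :=
  [:: (false, (0, 0)); (false, (1, 0)); (true, (2, 3)); (true, (1, 4));
      (false, (0, 0)); (true, (0, 1)); (true, (1, 4)); (true, (2, 3))]%N.

Definition poly_test : seq Lcode :=
  [:: (false, (0, 0)); (false, (2, 0)); (true, (1, 2)); (true, (2, 4));
      (false, (3, 0)); (false, (1, 0)); (false, (0, 0)); (true, (0, 4));
      (false, (4, 0)); (false, (2, 0)); (true, (0, 3)); (true, (2, 3))]%N.

Definition wf_pair (b : seq nat) := (size b == 2%N) && all (fun i => i < 5)%N b.
Definition wf_triple (b : seq nat) := (size b == 3%N) && all (fun i => i < 5)%N b.

(** Each letter of a word turns one entry d_kl into a combination of the ∂_i, and [block_eps] is 0
    unless all entries are ∂_i. Hence both test tuples contain five entries d_kl, as many as the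
    words have letters. *)
Lemma eval_wedge_test :
  let P := prefix_expr hw_word C_expr in
  [&& all (fun t => all wfd t.2.1 && wf_pair t.2.2) P, all wf_Lcode wedge_test &
      eval_expr eval_wedge P wedge_test == 4].
Proof. by vm_compute. Qed.

Lemma eval_poly_test :
  let P := prefix_expr [:: (0, 1)%N] BC_expr in
  [&& all (fun t => all wfd t.2.1 && wf_triple t.2.2) P, all wf_Lcode poly_test &
      eval_expr (eval_poly 3) P poly_test == 6].
Proof. by vm_compute. Qed.

Section Nonvanishing.
Variable K : numFieldType.
Local Notation d_ i j := (of_odd (dform K i j)).

Lemma dword_cat u v : dword K (u ++ v) = dword K u * dword K v.
Proof. by elim: u => [|d u IH] /=; rewrite ?mul1r // IH mulrA. Qed.

Lemma lc_prefix (V : g0_module K) (vec : seq nat -> V) w P :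
  lc (den_expr vec) (prefix_expr w P) = Verma_act (dword K w) (lc (den_expr vec) P).
Proof.
rewrite (lc_linear (Verma_act _)) /lc big_map; apply: eq_bigr => t _ /=.
by rewrite /den_expr /= Verma_act_tens dword_cat.
Qed.

Lemma hw_Phi_C_neq0 : Verma_act (hw_vector K) (Phi_C K) != 0.
Proof.
have /and3P[wfP wf_ys /eqP ev4] := eval_wedge_test.
have [| | | |F FE] := @test_functional K (WedgeDual K) (fun s : wedge2 K => wedge_form s) (map (Lelem K) wedge_test).
- by move=> s; apply: multilinear_wedge_form.
- move=> c s t l; rewrite /wedge_form blk_linear; apply: eq_blk => i l'.
  rewrite blk_linear; apply: eq_blk => j l''.
  by rewrite leaf_linear !mxE.
- move=> X s l X0; rewrite wedge_form_even //; congr (wedge_form _ l).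
  by rewrite /= linearN /= trmxK mulNmx mulmxN opprD.
- by move=> w s l w0; apply: wedge_form_odd.
have evP b ys : wf_pair b -> all wf_Lcode ys ->
    wedge_form (wedgev K b) (map (Lelem K) ys) = (eval_wedge b ys)%:~R.
  case: b => [|i [|j [|? ?]]] // /and4P[_ lt_i lt_j _]; exact: eval_wedgeP.
have := @eval_exprP K (WedgeDual K) (wedgev K) (fun s : wedge2 K => wedge_form s) _ _
  (fun s : wedge2 K => multilinear_wedge_form s) evP F _ _ FE wfP wf_ys.
rewrite ev4 lc_prefix -hw_vectorE => F4.
apply/eqP; rewrite Phi_CE (linearZ_LR (Verma_act _)) => /(congr1 F).
rewrite (linearZ_LR F) linear0 F4 => /eqP.
by rewrite -[_ *: _]/(_ * _) mulf_eq0 intr_eq0 pnatr_eq0.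
Qed.

Lemma wedge_odd_x12 : wedge_odd (x_ K i1 i2) = 2 *: dgen K (0, 1)%N.
Proof.
rewrite /wedge_odd sum_sym_pairs => [|i j|i].
- rewrite scaler_nat; congr (_ *+ 2); rewrite /dpairs /= !big_cons big_nil /= !o5E !mxE.
  by rewrite !(eqxx, subr0, subrr, scale0r, addr0, scale1r) /= ?(subr0, subrr, scale0r, addr0, scale1r) /dgen !o5E.
- by rewrite dformC linearN !mxE scalerN -scaleNr opprB [(i == _) && _]andbC [(i == _) && _]andbC.
- by rewrite dform_diag linear0 scaler0.
Qed.

Variable iota : Sym K 3 -> UL K.
Hypothesis iotaP : is_iota iota.

Lemma d12_Phi_BC_neq0 : Verma_act (dgen K (0, 1)%N) (Phi_BC iota) != 0.
Proof.
have /and3P[wfP wf_ys /eqP ev6] := eval_poly_test.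
have [| | | |F FE] := @test_functional K (SymDual K 3) (fun s : dhomog 5 K 3 => poly_form 3 s) (map (Lelem K) poly_test).
- by move=> s; apply: multilinear_poly_form.
- by move=> c s t l; apply: poly_form_linear.
- by move=> X s l X0; rewrite poly_form_even.
- by move=> w s l w0; apply: poly_form_odd.
have evP b ys : wf_triple b -> all wf_Lcode ys ->
    poly_form 3 (symv K 3 b) (map (Lelem K) ys) = (eval_poly 3 b ys)%:~R.
  by case/andP=> sz_b wf_b wf_zs; rewrite symvE sz_b eval_polyP.
have := @eval_exprP K (SymDual K 3) (symv K 3) (fun s : dhomog 5 K 3 => poly_form 3 s) _ _
  (fun s : dhomog 5 K 3 => multilinear_poly_form 3 s) evP F _ _ FE wfP wf_ys.
rewrite ev6 lc_prefix /= mulr1 => F6.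
apply/eqP; rewrite (Phi_BCE iotaP) (linearZ_LR (Verma_act _)) => /(congr1 F).
rewrite (linearZ_LR F) linear0 F6 => /eqP.
by rewrite -[_ *: _]/(_ * _) mulf_eq0 intr_eq0 invr_eq0 pnatr_eq0.
Qed.
End Nonvanishing.

Local Open Scope complex_scope.

Theorem proposition6p3 (R : realType)
    (iota : Sym R[i] 3 -> UL R[i]) (iotaP : is_iota iota) :
  (exists (t_AB : Verma (Sym R[i] 3) -> Verma (Sym R[i] 0))
          (nabla_C : Verma (Sym R[i] 0) -> Verma (WedgeDual R[i])),
     [/\ is_t_AB iota t_AB,
         is_nabla_C nabla_C,
         L_morphism (nabla_C \o t_AB),
         has_degree 5 (nabla_C \o t_AB) &
         exists m, (nabla_C \o t_AB) m != 0]) /\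
  (exists (nabla_A : Verma (Wedge R[i]) -> Verma (SymDual R[i] 0))
          (t_BC : Verma (SymDual R[i] 0) -> Verma (SymDual R[i] 3)),
     [/\ is_nabla_A nabla_A,
         is_t_BC iota t_BC,
         L_morphism (t_BC \o nabla_A),
         has_degree 5 (t_BC \o nabla_A) &
         exists m, (t_BC \o nabla_A) m != 0]).
Proof.
split.
  have [t_AB [AB_spec AB_mor AB_E]] := t_AB_exists iotaP.
  have [nabla_C [C_spec C_mor C_E]] := nabla_C_exists R[i].
  exists t_AB, nabla_C; have CAB_E u s : (nabla_C \o t_AB) (tens u s) =
      Verma_act (u * iota (6 *: s)) (Phi_C R[i]) by rewrite /= AB_E C_E.
  split=> //; first exact: L_morphism_comp.
    by apply: (has_degree_CAB iotaP) => s; rewrite CAB_E mul1r.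
  (* This vector goes to 6 times the highest weight vector of N applied to [Phi_C]. *)
  exists (tens 1 (z_ R[i] 3 (U_(i1) *+ 3)%MM : Sym R[i] 3)).
  have [_ _ _ _ iota_hw] := iotaP.
  rewrite CAB_E mul1r (iotaZ iotaP) iota_hw Verma_actZl.
  by rewrite scaler_eq0 pnatr_eq0 hw_Phi_C_neq0.
have [nabla_A [A_spec A_mor A_E]] := nabla_A_exists R[i].
have [t_BC [BC_spec BC_mor BC_E]] := t_BC_exists iotaP.
exists nabla_A, t_BC; have BCA_E u s : (t_BC \o nabla_A) (tens u s) =
    Verma_act (u * wedge_odd s) (Phi_BC iota).
  by rewrite /= A_E BC_E z0E mcoeff1 eqxx scale1r.
split=> //; first exact: L_morphism_comp.
  by apply: (has_degree_BCA iotaP) => s; rewrite BCA_E mul1r.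
(* This vector goes to 2 d_12 applied to [Phi_BC]; the 2 comes from the ordered pairs (1, 2) and (2,
   1). *)
exists (tens 1 (x_ R[i] i1 i2 : Wedge R[i])).
rewrite BCA_E mul1r wedge_odd_x12 Verma_actZl.
by rewrite scaler_eq0 pnatr_eq0 d12_Phi_BC_neq0.
Qed.
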